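(* Let $F$ be a non-archimedean local field of nonzero characteristic, $D_F$ a central division algebra of dimension $d^2$ over $F$, $r\ge1$, and $G'_F=GL_r(D_F)$. Let $l\ge 1$ be an integer. There exists an integer $m\ge l$ such that, if $L$ is a local field of characteristic zero which is $m$-close to $F$, then the isomorphism of vector spaces $$\bar\zeta^{\,l}_{D_FD_L}: H(G'_F;K_F^l)\simeq H(G'_L;K_L^l)$$ is an isomorphism of algebras.
   Context: Notation. $O_F,P_F,k_F$: ring of integers, maximal ideal, residue field of $F$; similarly $O_{D_F}$, $P_{D_F}$ for $D_F$. $K_F=GL_r(O_{D_F})$, and for $l\ge1$, $K_F^l=Id+M_r(P_{D_F}^{ld})$. For a compact open subgroup $K$ of $G'_F$, $H(G'_F;K)$ is the convolution algebra of complex locally constant compactly supported functions on $G'_F$ bi-invariant under $K$ (Haar measure with $vol(K_F)=1$). Fix a uniformizer $\pi_F$ of $F$, a maximal subfield $E\subset D_F$ unramified of degree $d$ over $F$, an element $\pi_{D_F}\in D_F$ and a generator $\sigma_E$ of $Gal(E/F)$ with $\pi_{D_F}^d=\pi_F$, $D_F=\bigoplus_{i=0}^{d-1}\pi_{D_F}^iE$, $\pi_{D_F}^{-1}e\pi_{D_F}=\sigma_E(e)$ for $e\in E$. Close fields. A local field $L$ of characteristic $0$ is $m$-close to $F$ if $O_F/P_F^m$ and $O_L/P_L^m$ are isomorphic rings; one then fixes a triple $(\pi_F;\pi_L;\bar\lambda^m_{FL})$, $\pi_L$ a uniformizer of $L$ and $\bar\lambda^m_{FL}:O_F/P_F^m\simeq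 O_L/P_L^m$ a ring isomorphism sending the class of $\pi_F$ to that of $\pi_L$. Let $K/L$ be the unramified extension of degree $d$; one fixes a ring isomorphism $\bar\lambda^m_{EK}:O_E/P_E^m\simeq O_K/P_K^m$ extending $\bar\lambda^m_{FL}$. Let $\sigma_K\in Gal(K/L)$ be the image of $\sigma_E$ under the isomorphism $Gal(E/F)\simeq Gal(K/L)$ matching the Frobenius elements, let $D_L=\bigoplus_{i=0}^{d-1}\pi_{D_L}^iK$ be the division algebra with $\pi_{D_L}^d=\pi_L$, $\pi_{D_L}^{-1}e\pi_{D_L}=\sigma_K(e)$ ($e\in K$), and put $G'_L=GL_r(D_L)$, with $K_L$, $K_L^l$ defined as over $F$. The map $\sum_i\pi_{D_F}^i\hat e_i\mapsto\sum_i\pi_{D_L}^i\bar\lambda^m_{EK}(\hat e_i)$ is a ring isomorphism $O_{D_F}/P_{D_F}^{md}\simeq O_{D_L}/P_{D_L}^{md}$; for $l\le m$ its reduction induces $GL_r(O_{D_F}/P_{D_F}^{ld})\simeq GL_r(O_{D_L}/P_{D_L}^{ld})$. The map $\bar\zeta^{\,l}_{D_FD_L}$ ($l\le m$). Let $\mathcal{A}_F$ be the set of matrices $diag(\pi_{D_F}^{a_1},\dots,\pi_{D_F}^{a_r})$ with integers $a_1\le\dots\le a_r$; for $A$ in it let $A_L=diag(\pi_{D_L}^{a_1},\dots,\pi_{D_L}^{a_r})$. $G'_F$ is the disjoint union of the $K_FAK_F$, $A\in\mathcal{A}_F$, and the characteristic functions $\mathbf{1}_{K_F^lBAC^{-1}K_F^l}$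 ($A\in\mathcal{A}_F$, $B,C\in K_F$) span $H(G'_F;K_F^l)$, the distinct ones forming a basis. $\bar\zeta^{\,l}_{D_FD_L}$ is the linear isomorphism sending $\mathbf{1}_{K_F^lBAC^{-1}K_F^l}$ to $\mathbf{1}_{K_L^lB_LA_LC_L^{-1}K_L^l}$, where $B_L,C_L\in K_L$ are any lifts of the images of $B,C$ in $GL_r(O_{D_L}/P_{D_L}^{ld})$; it is well defined. *)

(* Defs.v *)
From HB Require Import structures.
From mathcomp Require Import all_boot all_order all_algebra all_field.
From mathcomp Require Import all_classical all_reals all_analysis.
From mathcomp Require Import complex.

Set Implicit Arguments.
Unset Strict Implicit.
Unset Printing Implicit Defensive.

Import Order.TTheory GRing.Theory Num.Theory.

Local Open Scope classical_set_scope.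
Local Open Scope ring_scope.

(* [lfval] is the normalized valuation on nonzero elements; its value at 0 is
   irrelevant, the convention v(0) = +oo being built into [lfval_ge]. *)
Definition lfval_ge (F : fieldType) (v : F -> int) (n : int) (x : F) : bool :=
  (x == 0) || (n <= v x).

HB.mixin Record Field_isLocalField F & GRing.Field F := {
  lfval : F -> int;
  lfvalM : forall x y : F, x != 0 -> y != 0 -> lfval (x * y) = lfval x + lfval y;
  lfvalD : forall (n : int) (x y : F),
    lfval_ge lfval n x -> lfval_ge lfval n y -> lfval_ge lfval n (x + y);
  lfval_normalized : exists x : F, x != 0 /\ lfval x = 1;
  lf_complete : forall u : nat -> F,
    (forall n : int, exists N : nat, forall i j : nat,
       (N <= i)%N -> (N <= j)%N -> lfval_ge lfval n (u i - u j)) ->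
    exists x : F, forall n : int, exists N : nat, forall i : nat,
       (N <= i)%N -> lfval_ge lfval n (u i - x);
  lf_finite_residue : exists s : seq F, forall x : F,
    lfval_ge lfval 0 x -> exists2 y, y \in s & lfval_ge lfval 1 (x - y)
}.

#[short(type="localFieldType")]
HB.structure Definition LocalField := {F of Field_isLocalField F & GRing.Field F}.

Definition vge (F : localFieldType) (n : int) (x : F) : bool :=
  lfval_ge (@lfval F) n x.

Definition OF (F : localFieldType) : set F := [set x | vge 0 x].

Definition uniformizer (F : localFieldType) (x : F) : Prop :=
  x != 0 /\ lfval x = 1.

(* The non-units of O; this is the maximal ideal when O is local. *)
Definition max_ideal (R : nzRingType) (O : set R) : set R :=
  [set x | O x /\ ~ exists y, [/\ O y, x * y = 1 & y * x = 1]].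

(* I^n, generated additively by the n-fold products; I^0 = O. *)
Fixpoint ideal_exp (R : nzRingType) (O I : set R) (n : nat) : set R :=
  if n is k.+1 then
    [set x | exists s : seq (R * R),
      (forall p, p \in s -> I p.1 /\ ideal_exp O I k p.2) /\
      x = \sum_(p <- s) p.1 * p.2]
  else O.

(* f is given on representatives: it induces a ring isomorphism A/I -> B/J. *)
Definition quot_ring_iso (R S : nzRingType) (A I : set R) (B J : set S)
    (f : R -> S) : Prop :=
  (forall x, A x -> B (f x)) /\
  (forall x y, A x -> A y -> (I (x - y) <-> J (f x - f y))) /\
  (forall y, B y -> exists2 x, A x & J (f x - y)) /\
  J (f 1 - 1) /\
  (forall x y, A x -> A y -> J (f (x + y) - (f x + f y))) /\
  (forall x y, A x -> A y -> J (f (x * y) - f x * f y)).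

Definition PF (F : localFieldType) (n : nat) : set F :=
  ideal_exp (@OF F) (max_ideal (@OF F)) n.

Definition residue_card (F : localFieldType) (q : nat) : Prop :=
  exists s : seq F, [/\ size s = q, uniq s, forall x, x \in s -> OF x &
    forall x, OF x -> exists! y, y \in s /\ PF 1 (x - y)].

Section DivisionAlgebra.
Variables (F : localFieldType) (D : falgType F).

Definition central_division_algebra (d : nat) : Prop :=
  [/\ forall x : D, x != 0 -> x \is a GRing.unit,
      'Z({:D})%VS = 1%VS & \dim {:D} = (d ^ 2)%N].

Definition integral_over_OF (x : D) : Prop :=
  exists p : {poly F}, [/\ p \is monic, forall i, OF p`_i &
                           root (map_poly (in_alg D) p) x].

Definition OE (E : {vspace D}) : set D := [set x | x \in E /\ integral_over_OF x].

Definition PE (E : {vspace D}) (n : nat) : set D :=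
  ideal_exp (OE E) (max_ideal (OE E)) n.

Definition OD : set D := OE {:D}.
Definition PD (n : nat) : set D := PE {:D} n.

(* The extension of residue fields is separable since they are finite, so that
   E/F is unramified iff P_F generates P_E. *)
Definition unramified (E : {vspace D}) : Prop :=
  PE E 1 = [set x | exists a y, [/\ PF 1 a, OE E y & x = a *: y]].

(* Restrictions to E of such maps are the elements of Gal(E/F). *)
Definition gal_aut (E : {vspace D}) (s : 'End(D)) : Prop :=
  ahom_in E s /\ (s @: E = E)%VS.

Definition gal_generator (E : {vspace D}) (s : 'End(D)) : Prop :=
  gal_aut E s /\
  forall t, gal_aut E t -> exists k : nat, {in E, t =1 iter k s}.

Definition frobenius (E : {vspace D}) (phi : 'End(D)) : Prop :=
  gal_aut E phi /\
  exists q, residue_card F q /\ forall x, OE E x -> PE E 1 (phi x - x ^+ q).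

(* A subfield E with \dim E = d is automatically a maximal subfield when
   \dim D = d ^ 2. *)
Record cyclic_datum (d : nat) := CyclicDatum {
  cd_pi : F;
  cd_E : {aspace D};
  cd_piD : D;
  cd_sigma : 'End(D);
  cd_uniformizer : uniformizer cd_pi;
  cd_comm : {in cd_E &, commutative (@GRing.mul D)};
  cd_dim : \dim cd_E = d;
  cd_unramified : unramified cd_E;
  cd_generator : gal_generator cd_E cd_sigma;
  cd_piD_pow : cd_piD ^+ d = cd_pi%:A;
  cd_span : (\sum_(i < d) (<[cd_piD ^+ i]> * cd_E))%VS = {:D}%VS;
  cd_direct : directv (\sum_(i < d) (<[cd_piD ^+ i]> * cd_E))%VS;
  cd_conj : {in cd_E, forall e, cd_piD^-1 * e * cd_piD = cd_sigma e}
}.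

End DivisionAlgebra.

Arguments OD {F} D.
Arguments PD {F} D n.

Section GL.
Variables (F : localFieldType) (D : falgType F) (r : nat).

Record GL := MkGL {
  gl_pair : 'M[D]_r * 'M[D]_r;
  _ : (gl_pair.1 *m gl_pair.2 == 1%:M) && (gl_pair.2 *m gl_pair.1 == 1%:M)
}.

HB.instance Definition _ := [isSub for gl_pair].
HB.instance Definition _ := [Choice of GL by <:].

Definition glmx (g : GL) : 'M[D]_r := (gl_pair g).1.

Lemma glmx_inj : injective glmx.
Proof.
move=> [[a b] ab] [[a' b'] ab']; rewrite /glmx /= => eaa; apply/val_inj => /=.
move: ab ab' => /= /andP[_ /eqP ba] /andP[/eqP ab' _]; subst a'.
by congr pair; rewrite -[b]mulmx1 -ab' mulmxA ba mul1mx.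
Qed.

Fact gl_one_subproof :
  ((1%:M : 'M[D]_r) *m 1%:M == 1%:M) && ((1%:M : 'M[D]_r) *m 1%:M == 1%:M).
Proof. by rewrite mulmx1 eqxx. Qed.

Definition gl_one : GL := @MkGL (1%:M, 1%:M) gl_one_subproof.

Fact gl_inv_subproof (g : GL) :
  ((gl_pair g).2 *m (gl_pair g).1 == 1%:M) &&
  ((gl_pair g).1 *m (gl_pair g).2 == 1%:M).
Proof. by case: g => p /=; rewrite andbC. Qed.

Definition gl_inv (g : GL) : GL :=
  @MkGL ((gl_pair g).2, (gl_pair g).1) (gl_inv_subproof g).

Fact gl_mul_subproof (g h : GL) :
  let a := (gl_pair g).1 *m (gl_pair h).1 in
  let b := (gl_pair h).2 *m (gl_pair g).2 in
  (a *m b == 1%:M) && (b *m a == 1%:M).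
Proof.
case: g h => [[a a'] /= /andP[/eqP aa' /eqP a'a]] [[b b'] /= /andP[/eqP bb' /eqP b'b]].
by rewrite mulmxA -(mulmxA a) bb' mulmx1 aa' mulmxA -(mulmxA b') a'a mulmx1 b'b !eqxx.
Qed.

Definition gl_mul (g h : GL) : GL :=
  @MkGL ((gl_pair g).1 *m (gl_pair h).1, (gl_pair h).2 *m (gl_pair g).2)
    (gl_mul_subproof g h).

Fact gl_mulA : associative gl_mul.
Proof. by move=> x y z; apply: glmx_inj; rewrite /glmx /= mulmxA. Qed.
Fact gl_mul1 : left_id gl_one gl_mul.
Proof. by move=> x; apply: glmx_inj; rewrite /glmx /= mul1mx. Qed.
Fact gl_mulr1 : right_id gl_one gl_mul.
Proof. by move=> x; apply: glmx_inj; rewrite /glmx /= mulmx1. Qed.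
Fact gl_mulV : left_inverse gl_one gl_inv gl_mul.
Proof.
by move=> [p /= pP]; apply: glmx_inj; rewrite /glmx /=; case/andP: pP => _ /eqP.
Qed.
Fact gl_mulrV : right_inverse gl_one gl_inv gl_mul.
Proof.
by move=> [p /= pP]; apply: glmx_inj; rewrite /glmx /=; case/andP: pP => /eqP.
Qed.

HB.instance Definition _ := isGroup.Build GL
  gl_mulA gl_mul1 gl_mulr1 gl_mulV gl_mulrV.
HB.instance Definition _ := isPointed.Build GL gl_one.

(* The open sets of the topology induced from M_r(D), where D has the topology
   of a finite-dimensional F-vector space; inversion is continuous for it. *)
Definition gl_near (n : int) (g h : GL) : Prop :=
  forall i j k, vge n (coord (vbasis {:D}) k (glmx h i j - glmx g i j)).

Definition gl_open : set (set GL) :=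
  [set U | forall g, U g -> exists n : int, forall h, gl_near n g h -> U h].

Fact gl_openT : gl_open setT.
Proof. by move=> g _; exists 0. Qed.

Fact gl_openI : setI_closed gl_open.
Proof.
move=> U V oU oV g [/oU[m mU] /oV[n nV]]; exists (Order.max m n) => h gh.
by split; [apply: mU | apply: nV] => i j k; case/orP: (gh i j k) => [/eqP->|];
   rewrite /vge /lfval_ge ?eqxx // ge_max => /andP[? ?]; apply/orP; right.
Qed.

Fact gl_open_bigU (I : Type) (f : I -> set GL) :
  (forall i, gl_open (f i)) -> gl_open (\bigcup_i f i).
Proof.
move=> of_ g [i _ /of_[n nf]]; exists n => h /nf fh; by exists i.
Qed.

HB.instance Definition _ :=
  isOpenTopological.Build GL gl_openT gl_openI gl_open_bigU.

Definition GLO : set GL :=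
  [set g | forall i j, OD D (glmx g i j) /\ OD D (glmx g^-1%g i j)].

(* K_F^l is [GLcong (l * d)]; for n > 0 any matrix in 1 + M_r(P_D^n) is in
   GL_r(O_D). *)
Definition GLcong (n : nat) : set GL :=
  [set g | forall i j, PD D n (glmx g i j - (1%:M : 'M[D]_r) i j)].

Definition dcoset (K : set GL) (g : GL) : set GL :=
  [set x | exists k1 k2, [/\ K k1, K k2 & x = (k1 * g * k2)%g]].

Definition GLborel := g_sigma_algebraType (@open GL).

(* A left-invariant Borel measure giving the compact open set K_F = GLO volume 1
   is finite on compact sets, hence is the normalized Haar measure. *)
Definition is_haar (R : realType) (mu : {measure set GLborel -> \bar R}) : Prop :=
  (forall (g : GL) (A : set GLborel), measurable A ->
     mu [set (g * x)%g | x in (A : set GL)] = mu A) /\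
  mu GLO = 1%E.

Definition hecke (R : realType) (K : set GL) : set (GL -> R[i]) :=
  [set f | [/\ forall g : GL, \forall h \near g, f h = f g,
               compact (closure [set g | f g != 0]) &
               forall k1 k2 g, K k1 -> K k2 -> f (k1 * g * k2)%g = f g]].

Definition complex_integral (R : realType) (mu : {measure set GLborel -> \bar R})
    (f : GL -> R[i]) : R[i] :=
  Complex (Rintegral mu setT (fun g => complex.Re (f g)))
          (Rintegral mu setT (fun g => complex.Im (f g))).

Definition convolution (R : realType) (mu : {measure set GLborel -> \bar R})
    (f1 f2 : GL -> R[i]) : GL -> R[i] :=
  fun x => complex_integral mu (fun g => f1 g * f2 (g^-1 * x)%g).

End GL.

Arguments GL {F} D r.
Arguments GLborel {F} D r.
Arguments hecke {F D r} R K.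

Section Close.
Variables (F L : localFieldType) (DF : falgType F) (DL : falgType L) (d : nat).
Variables (SF : cyclic_datum DF d) (SL : cyclic_datum DL d).

(* lamFL and lamEK are maps on representatives inducing the isomorphisms
   O_F/P_F^m -> O_L/P_L^m and O_E/P_E^m -> O_K/P_K^m.  The last clause says
   that sigma_E and sigma_K correspond under the isomorphism
   Gal(E/F) -> Gal(K/L) mapping phiE^j to phiK^j. *)
Definition close_datum (m : nat) (lamFL : F -> L) (lamEK : DF -> DL) : Prop :=
  [/\ quot_ring_iso (@OF F) (@PF F m) (@OF L) (@PF L m) lamFL,
      PF m (lamFL (cd_pi SF) - cd_pi SL),
      quot_ring_iso (OE (cd_E SF)) (PE (cd_E SF) m)
                    (OE (cd_E SL)) (PE (cd_E SL) m) lamEK,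
      forall x, OF x -> PE (cd_E SL) m (lamEK x%:A - (lamFL x)%:A) &
      exists phiE phiK (j : nat),
        [/\ frobenius (cd_E SF) phiE, frobenius (cd_E SL) phiK,
            {in cd_E SF, cd_sigma SF =1 iter j phiE} &
            {in cd_E SL, cd_sigma SL =1 iter j phiK}]].

Variable lamEK : DF -> DL.

(* The class of y in O_{D_L}/P_{D_L}^n is the image of the class of x; the choice
   of the representative lamEK is immaterial for n <= md. *)
Definition class_corr (n : nat) (x : DF) (y : DL) : Prop :=
  exists e : 'I_d -> DF,
    [/\ forall i, OE (cd_E SF) (e i),
        x = \sum_(i < d) cd_piD SF ^+ i * e i &
        PD DL n (y - \sum_(i < d) cd_piD SL ^+ i * lamEK (e i))].

Variable r : nat.

Definition GLlift (n : nat) (B : GL DF r) (BL : GL DL r) : Prop :=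
  GLO BL /\ forall i j, class_corr n (glmx B i j) (glmx BL i j).

Definition is_diag_pi (F' : localFieldType) (D : falgType F')
    (S : cyclic_datum D d) (a : 'I_r -> int) (A : GL D r) : Prop :=
  glmx A = diag_mx (\row_i exprz (cd_piD S) (a i)).

Variable (R : realType) (l : nat).

(* Only the restriction of zeta to H(G'_F; K_F^l) matters; it is determined by
   the conditions since the indicator functions below span this space. *)
Definition is_zeta (zeta : (GL DF r -> R[i]) -> (GL DL r -> R[i])) : Prop :=
  [/\ set_bij (hecke R (@GLcong F DF r (l * d)))
              (hecke R (@GLcong L DL r (l * d))) zeta,
      forall (c : R[i]) f g,
        hecke R (@GLcong F DF r (l * d)) f ->
        hecke R (@GLcong F DF r (l * d)) g ->
        zeta (fun x => c * f x + g x) = (fun x => c * zeta f x + zeta g x) &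
      forall (a : 'I_r -> int) (A B C : GL DF r) (AL BL CL : GL DL r),
        (forall i j : 'I_r, (i <= j)%N -> a i <= a j) ->
        is_diag_pi SF a A -> is_diag_pi SL a AL ->
        GLO B -> GLO C ->
        GLlift (l * d) B BL -> GLlift (l * d) C CL ->
        zeta \1_(dcoset (@GLcong F DF r (l * d)) (B * A * C^-1)%g) =
        \1_(dcoset (@GLcong L DL r (l * d)) (BL * AL * CL^-1)%g)].

End Close.

(* For a linear bijection, compatibility with the products implies
   compatibility with the units. *)
Definition convolution_morphism (R : realType) (F L : localFieldType)
    (DF : falgType F) (DL : falgType L) (r : nat)
    (muF : {measure set (GLborel DF r) -> \bar R})
    (muL : {measure set (GLborel DL r) -> \bar R})
    (H : set (GL DF r -> R[i]))
    (zeta : (GL DF r -> R[i]) -> (GL DL r -> R[i])) : Prop :=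
  forall f g, H f -> H g ->
    zeta (convolution muF f g) = convolution muL (zeta f) (zeta g).

(* Main.v *)
From HB Require Import structures.
From mathcomp Require Import all_boot all_order all_algebra all_field.
From mathcomp Require Import all_classical all_reals all_analysis.
From mathcomp Require Import finmap measurable_realfun complex ring zify.
Require Import Defs.

(** Take m = l + 4. Put K = K^l and N = ld, and let n(g) be the least n >= 0 such
    that pi^n g and pi^n g^-1 are integral. The Hecke algebra is generated by the
    characteristic functions of the K g K with n(g) <= 1: for dominant a and
    eps = (c, .., c, c + 1, .., c + 1) one has K pi^eps K pi^a K = K pi^(eps + a) K,
    and GL_r(O) normalizes K. By associativity and linearity it is therefore
    enough to compare the convolutions 1_(K x K) * 1_(K g K) with n(x) <= 1.
    Their value at y counts the cosets zK in K x K with z^-1 y in K g K. These z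
    satisfy n(z) <= 1, so that they can be transferred entrywise to matrices z'
    over D_L modulo a high power of P. If g = B pi^a C^-1 corresponds to
    g' = B' pi^a C'^-1, then z g and z' g' lie in corresponding double cosets as
    soon as 2 n(z) + N <= md, whatever a is: the entries of pi^-s z pi^t which are
    not determined by z modulo P^(md - n(z)) can be prescribed by moving z' within
    its class. The product z1^-1 z2 g with n(z1^-1 z2) <= 2 requires N + 4 <= md.
    The Haar measures match because vol(K)^-1 is the index of K in GL_r(O).

    The valuation of D is that of the norm det(x |-> ax); its ultrametric
    inequality follows from compactness and the binomial formula. *)

Set Implicit Arguments.
Unset Strict Implicit.
Unset Printing Implicit Defensive.

Import Order.TTheory GRing.Theory Num.Theory.

Local Open Scope classical_set_scope.
Local Open Scope ring_scope.

(** * Valuations on division rings *)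

Section Valuation.
Variables (D : unitRingType) (v : D -> int).
Implicit Types x y z : D.

(** The obstacle is that pi^a is unbounded, while data modulo P^(md) only describe elements with
    bounded denominators: no m allows a direct comparison of the convolutions of two arbitrary
    characteristic functions. Generation confines the loss of precision to the left factor. If n(z)
    <= n, the entries of z are known modulo P^(md - n), and its entries modulo P^(N + n) are needed
    to fix z up to K, since n digits are lost to the denominators of z^-1. This is the origin of 2n
    + N <= md, and n = 2 gives the constant 4.

    No valuation of D is given: O_D is the set of integral elements, and neither its ring structure
    nor the shape of the powers of P_D is part of the data. Similarly, the map from O_E/P_E^m to
    O_K/P_K^m is only assumed to be a ring isomorphism extending that of O_F/P_F^m; its
    compatibility with sigma has to be extracted from the Frobenius automorphisms.

    Both sides are linked by relations instead of maps. The inverse relations satisfy the same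
    axioms, so that each transfer statement also yields its converse, with F and L exchanged. *)

Definition val_ge (n : int) (x : D) : bool := (x == 0) || (n <= v x).

Record is_valuation : Prop := IsValuation {
  valuation_unit : forall x : D, x != 0 -> x \is a GRing.unit;
  valuationM : forall x y : D, x != 0 -> y != 0 -> v (x * y) = v x + v y;
  val_geD : forall n x y, val_ge n x -> val_ge n y -> val_ge n (x + y)
}.

Hypothesis Hv : is_valuation.

Lemma unitr_neq0 x : x \is a GRing.unit -> x != 0.
Proof. by apply: contraTneq => ->; rewrite unitr0. Qed.

Lemma vdiv_mulf_eq0 x y : (x * y == 0) = (x == 0) || (y == 0).
Proof.
apply/idP/orP => [/eqP xy0|[]/eqP->]; rewrite ?mulr0 ?mul0r //.
case: (eqVneq x 0) => [|/(valuation_unit Hv) xu]; first by left.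
by right; rewrite -[y](mulKr xu) xy0 mulr0.
Qed.

Lemma vdiv_mulf_neq0 x y : x != 0 -> y != 0 -> x * y != 0.
Proof. by rewrite vdiv_mulf_eq0 => /negPf-> /negPf->. Qed.

Lemma vdiv_mulfV x : x != 0 -> x * x^-1 = 1.
Proof. by move/(valuation_unit Hv)/mulrV. Qed.

Lemma vdiv_mulVf x : x != 0 -> x^-1 * x = 1.
Proof. by move/(valuation_unit Hv)/mulVr. Qed.

Lemma vdiv_expf_neq0 x n : x != 0 -> x ^+ n != 0.
Proof. by move/(valuation_unit Hv) => xu; rewrite unitr_neq0 ?unitrX. Qed.

Lemma vdiv_exprz_neq0 x (n : int) : x != 0 -> x ^ n != 0.
Proof.
move/(valuation_unit Hv) => xu; case: n => n; rewrite unitr_neq0 //.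
  exact: unitrX.
by rewrite unitrV unitrX.
Qed.

Lemma valuation1 : v 1 = 0.
Proof.
have := valuationM Hv (oner_neq0 D) (oner_neq0 D); rewrite mulr1 => /eqP.
by rewrite -subr_eq0 opprD addNKr oppr_eq0 => /eqP.
Qed.

Lemma valuationV x : x != 0 -> v x^-1 = - v x.
Proof.
move=> x0; apply/eqP; rewrite -addr_eq0 -valuationM ?invr_eq0 //.
by rewrite vdiv_mulVf // valuation1.
Qed.

Lemma valuationX x n : x != 0 -> v (x ^+ n) = v x *+ n.
Proof.
move=> x0; elim: n => [|n IHn]; first by rewrite valuation1.
by rewrite exprS valuationM ?vdiv_expf_neq0 // IHn mulrS.
Qed.

Lemma valuationXz x (n : int) : x != 0 -> v (x ^ n) = v x * n.
Proof.
move=> x0; case: n => n; first by rewrite -exprnP valuationX // -mulr_natr natz.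
rewrite -[x ^ _]/((x ^+ n.+1)^-1).
by rewrite NegzE valuationV ?vdiv_expf_neq0 // valuationX // mulrN -mulr_natr natz.
Qed.

Lemma valuationN x : v (- x) = v x.
Proof.
have N1 : v (-1) = 0.
  have := valuationX 2 (_ : -1 != 0 :> D); rewrite oppr_eq0 oner_eq0 => /(_ isT).
  by rewrite sqrrN expr1n valuation1; lia.
case: (eqVneq x 0) => [->|x0]; first by rewrite oppr0.
by rewrite -mulN1r valuationM ?N1 ?add0r // oppr_eq0 oner_eq0.
Qed.

Lemma val_ge0 n : val_ge n 0.
Proof. by rewrite /val_ge eqxx. Qed.

Lemma val_geN n x : val_ge n (- x) = val_ge n x.
Proof. by rewrite /val_ge oppr_eq0 valuationN. Qed.

Lemma val_geB n x y : val_ge n x -> val_ge n y -> val_ge n (x - y).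
Proof. by move=> nx ny; apply: val_geD => //; rewrite val_geN. Qed.

Lemma val_ge_sym n x y : val_ge n (x - y) = val_ge n (y - x).
Proof. by rewrite -val_geN opprB. Qed.

Lemma val_ge_trans n x y z :
  val_ge n (x - y) -> val_ge n (y - z) -> val_ge n (x - z).
Proof. by move=> xy yz; rewrite -(subrKA y) val_geD. Qed.

Lemma val_geDl n x y : val_ge n x -> val_ge n (x + y) = val_ge n y.
Proof.
move=> nx; apply/idP/idP => [nxy|]; last exact: val_geD.
by rewrite -(addKr x y) addrC val_geB.
Qed.

Lemma val_ge_eqr n x y : val_ge n (x - y) -> val_ge n x = val_ge n y.
Proof. by move=> nxy; rewrite -[x](subrK y) val_geDl. Qed.

Lemma val_ge_le m n x : m <= n -> val_ge n x -> val_ge m x.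
Proof. by move=> mn /orP[x0|nx]; rewrite /val_ge ?x0 //; apply/orP; right; lia. Qed.

Lemma val_ge_sum (I : Type) (r : seq I) (P : pred I) (f : I -> D) n :
  (forall i, P i -> val_ge n (f i)) -> val_ge n (\sum_(i <- r | P i) f i).
Proof.
move=> h; elim/big_rec: _ => [|i x Pi]; first exact: val_ge0.
by apply: (val_geD Hv); apply: h.
Qed.

Lemma val_ge_neq0 n x : x != 0 -> val_ge n x = (n <= v x).
Proof. by rewrite /val_ge => /negPf->. Qed.

Lemma val_geMl n x y : x != 0 -> val_ge n (x * y) = val_ge (n - v x) y.
Proof.
move=> x0; rewrite /val_ge vdiv_mulf_eq0 (negPf x0) /=.
by case: eqP => //= /eqP y0; rewrite valuationM // lerBlDl.
Qed.

Lemma val_geMr n x y : y != 0 -> val_ge n (x * y) = val_ge (n - v y) x.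
Proof.
move=> y0; rewrite /val_ge vdiv_mulf_eq0 (negPf y0) orbF.
by case: eqP => //= /eqP x0; rewrite valuationM // lerBlDr.
Qed.

Lemma val_geM m n x y : val_ge m x -> val_ge n y -> val_ge (m + n) (x * y).
Proof.
case: (eqVneq x 0) => [->|x0]; first by rewrite mul0r !val_ge0.
rewrite val_geMl // (val_ge_neq0 _ x0) // => mx; apply: val_ge_le; lia.
Qed.

Lemma val_ge0M n x y : val_ge 0 x -> val_ge n y -> val_ge n (x * y).
Proof. by move=> x0 yn; rewrite -(add0r n) val_geM. Qed.

Lemma val_geM0 n x y : val_ge n x -> val_ge 0 y -> val_ge n (x * y).
Proof. by move=> x0 yn; rewrite -(addr0 n) val_geM. Qed.

Lemma val_ge1 n : val_ge n 1 = (n <= 0).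
Proof. by rewrite val_ge_neq0 ?oner_neq0 // valuation1. Qed.

Lemma val_geX x n : val_ge 0 x -> val_ge 0 (x ^+ n).
Proof.
by move=> x0; elim: n => [|n IHn]; rewrite ?val_ge1 // exprS val_ge0M.
Qed.

Lemma val_ge_nat n : val_ge 0 n%:R.
Proof. by elim: n => [|n IHn]; rewrite ?val_ge0 // mulrS val_geD ?val_ge1. Qed.

Lemma val_ge_eq0 x : (forall n : nat, val_ge n x) -> x = 0.
Proof.
move=> h; apply/eqP; apply: contraT => x0; have := h (`|v x|%N).+1.
by rewrite val_ge_neq0 //; lia.
Qed.

(** The term of least valuation cannot be cancelled by the others, whose valuations are strictly
    larger; a lower bound for the sum is therefore one for this term, hence for all terms. *)
Lemma val_ge_sum_distinct (I : finType) (f : I -> D) n :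
  (forall i j, f i != 0 -> f j != 0 -> v (f i) = v (f j) -> i = j) ->
  val_ge n (\sum_i f i) -> forall i, val_ge n (f i).
Proof.
move=> inj sn i; apply: contraT => fi.
have fi0 : f i != 0 by apply: contraNneq fi => ->; rewrite val_ge0.
case: (arg_minP (P := fun i => f i != 0) (fun j => v (f j)) fi0) => j fj0 minj.
have vj : ~~ val_ge n (f j).
  by move: fi; rewrite !val_ge_neq0 // -!ltNge; apply: le_lt_trans; apply: minj.
have : val_ge (Order.min n (v (f j) + 1)) (f j).
  have E : f j = \sum_k f k - \sum_(k | k != j) f k.
    by rewrite (bigD1 j) //= addrK.
  rewrite [X in val_ge _ X]E.
  apply: val_geB; first by apply: val_ge_le sn; rewrite ge_min lexx.
    apply: val_ge_sum => k kj; case: (eqVneq (f k) 0) => [->|fk0]; rewrite ?val_ge0 //.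
    rewrite val_ge_neq0 // ge_min; apply/orP; right.
    have /= := minj k fk0; have : v (f j) != v (f k); last by move=> ? ?; lia.
    by apply: contra_neq kj => /inj ->.
by move: vj; rewrite !val_ge_neq0 //; lia.
Qed.

End Valuation.

(** Compactness of a totally bounded complete ultrametric space, for covers by balls whose index
    [k y] depends on the centre. Without a finite subcover there would be nested sets, contained in
    balls of index 0, 1, 2, ..., none of which is finitely covered; the centres converge to some x,
    and the single ball of index [k x] around x contains one of these sets. *)
Lemma ultrametric_compact (T : eqType) (X : set T) (near : nat -> T -> T -> Prop) :
  (forall n x y, near n x y -> near n y x) ->
  (forall n x y z, near n x y -> near n y z -> near n x z) ->
  (forall n, exists s : seq T, forall x, X x -> exists2 y, y \in s & near n x y) ->
  (forall u, (forall n, X (u n)) -> (forall n, near n (u n) (u n.+1)) ->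
    exists2 x, X x & forall n, near n (u n) x) ->
  forall k : T -> nat, exists2 s : seq T, (forall y, y \in s -> X y) &
    forall x, X x -> exists2 y, y \in s & near (k y) y x.
Proof.
move=> nsym ntrans tot compl k.
pose covered (P : set T) := exists2 s : seq T, (forall y, y \in s -> X y) &
    forall x, X x -> P x -> exists2 y, y \in s & near (k y) y x.
suff [s sX sP] : covered setT by exists s => // x Xx; apply: sP.
apply: contrapT => bad.
have step (P : set T) n : ~ covered P ->
    exists2 y, X y /\ P y & ~ covered [set x | P x /\ near n y x].
  move=> badP; apply: contrapT => good; apply: badP.
  have [s sX] := tot n.
  have : forall s' : seq T, covered [set x | P x /\ exists2 y, y \in s' & near n x y].
    elim=> [|z s' [t tX tP]]; first by exists [::] => // x _ [_ []].
    (* The points of the net need not lie in X or P; a ball that meets both is recentred at a common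
       point x0, as [good] requires. *)
    have [[x0 [Xx0 Px0 zx0]]|no] := pselect (exists x0, [/\ X x0, P x0 & near n z x0]).
      have [t' t'X t'P] : covered [set x | P x /\ near n x0 x].
        by apply: contrapT => bad'; apply: good; exists x0.
      exists (t ++ t') => [y|x Xx [Px [y]]].
        by rewrite mem_cat => /orP[/tX|/t'X].
      rewrite inE => /predU1P[->|ys'] xy.
        have [|y' y't' ?] := t'P x Xx; first split=> //.
          by apply: ntrans (nsym _ _ _ zx0) (nsym _ _ _ xy).
        by exists y' => //; rewrite mem_cat y't' orbT.
      have [|y' y't ?] := tP x Xx; first by split=> //; exists y.
      by exists y' => //; rewrite mem_cat y't.
    exists t => // x Xx [Px [y]]; rewrite inE => /predU1P[->|ys'] xy.
      by case: no; exists x; split=> //; apply: nsym.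
    by apply: tP => //; split=> //; exists y.
  move=> /(_ s)[t tX tP]; exists t => // x Xx Px; apply: tP => //; split=> //.
  exact: sX.
pose state := {P : set T | ~ covered P}.
pose next n (st : state) : T * state :=
  let h := cid2 (step (sval st) n (svalP st)) in
  (s2val h, exist (fun P => ~ covered P) _ (s2valP' h)).
pose st := fix st n : state := if n is m.+1 then (next m (st m)).2
  else exist (fun P => ~ covered P) setT bad.
pose u n := (next n (st n)).1.
have uP n : X (u n) /\ sval (st n) (u n).
  by rewrite /u /next /=; case: cid2.
have stS n : sval (st n.+1) = [set x | sval (st n) x /\ near n (u n) x].
  by rewrite /= /u /next /=; case: cid2.
have [|n|x Xx ux] := compl u; first by move=> n; have [] := uP n.
  by have [_] := uP n.+1; rewrite stS => -[].
(* The set of stage [(k x).+1] lies in the ball of index [k x] around [u (k x)], which is also the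
   ball around the limit x. *)
apply: (svalP (st (k x).+1)); exists [:: x] => [y|y Xy]; first by rewrite inE => /eqP->.
rewrite stS => -[_ uy]; exists x; first by rewrite inE.
by apply: ntrans uy; apply/nsym/ux.
Qed.

(** * Local fields: residues, limits, determinants *)

Section LocalField.
Variable F : localFieldType.
Local Notation v := (@lfval F).

Lemma lfval_valuation : is_valuation v.
Proof.
split; [by move=> x; rewrite unitfE | exact: lfvalM | exact: lfvalD].
Qed.
Local Hint Resolve lfval_valuation : core.

(** Expansion in digits: each refinement from P^(j + k) to P^(j + k + 1) adds a multiple of ov^(j +
    k) by one of the finitely many residues [s0]. *)
Lemma val_ge_reps (j N : int) : exists s : seq F, forall x, val_ge v j x ->
  exists2 y, y \in s & val_ge v N (x - y).
Proof.
have [ov [ov0 vov]] := @lfval_normalized F.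
have [s0 s0P] : exists s0 : seq F, forall x, val_ge v 0 x ->
    exists2 y, y \in s0 & val_ge v 1 (x - y) := @lf_finite_residue F.
have [Nj|jN] := leP N j.
  by exists [:: 0] => x xj; exists 0; rewrite ?inE // subr0 (val_ge_le Nj).
have -> : N = j + `|N - j|%N by lia.
elim: `|N - j|%N => [|k [s sP]].
  by exists [:: 0] => x xj; exists 0; rewrite ?inE // !subr0.
exists [seq y + ov ^ (j + k) * z | y <- s, z <- s0] => x /sP[y ys xy].
have ok0 : ov ^ (j + k) != 0 by rewrite expfz_neq0.
have vok : v (ov ^ (j + k)) = j + k by rewrite (valuationXz lfval_valuation) // vov mul1r.
have [|z zs0 xyz] := s0P ((ov ^ (j + k))^-1 * (x - y)).
  by rewrite (val_geMl lfval_valuation) ?invr_eq0 // valuationV // vok opprK add0r.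
exists (y + ov ^ (j + k) * z); first by apply/allpairsP; exists (y, z).
have -> : x - (y + ov ^ (j + k) * z) = ov ^ (j + k) * ((ov ^ (j + k))^-1 * (x - y) - z).
  by rewrite mulrBr mulVKf // opprD addrA.
rewrite (val_geMl lfval_valuation) // vok.
by have -> : j + k.+1 - (j + k) = 1 by lia.
Qed.

Lemma val_ge_finfun_bound (I : finType) (f : I -> F) :
  exists c : nat, forall i, val_ge v (- c%:Z) (f i).
Proof.
exists (\sum_i `|v (f i)|)%N => i; apply/orP; right.
by rewrite (bigD1 i) //=; lia.
Qed.

Lemma val_ge_cauchy_limit (u : nat -> F) : (forall n : nat, val_ge v n (u n - u n.+1)) ->
  exists x, forall n : nat, val_ge v n (u n - x).
Proof.
move=> cu.
have cu' (n k : nat) : val_ge v n (u n - u (n + k)%N).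
  elim: k => [|k IHk]; first by rewrite addn0 subrr val_ge0.
  apply: (val_ge_trans lfval_valuation) IHk _; rewrite addnS.
  by apply: (val_ge_le _ (cu _)); lia.
have cu2 (n i j : nat) : (n <= i)%N -> (n <= j)%N -> val_ge v n (u i - u j).
  move=> /subnKC <- /subnKC <-.
  by apply: (val_ge_trans lfval_valuation) (cu' _ _); rewrite (val_ge_sym lfval_valuation).
have [n|x xP] := lf_complete u.
  by exists `|n|%N => i j ni nj; apply: val_ge_le (cu2 `|n|%N _ _ ni nj); lia.
exists x => n; have [N NP] := xP n.
apply: (val_ge_trans lfval_valuation (y := u (maxn n N))); first by apply: cu2; lia.
by apply: NP; lia.
Qed.

Lemma val_ge_prod (I : Type) (r : seq I) (f : I -> F) k :
  (forall i, val_ge v k (f i)) -> val_ge v (k *+ size r) (\prod_(i <- r) f i).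
Proof.
move=> fk; elim: r => [|i r IHr]; first by rewrite big_nil (val_ge1 lfval_valuation).
by rewrite big_cons mulrS (val_geM lfval_valuation).
Qed.

Lemma val_ge_det n (A : 'M[F]_n) k :
  (forall i j, val_ge v k (A i j)) -> val_ge v (k *+ n) (\det A).
Proof.
move=> Ak; apply: (val_ge_sum lfval_valuation) => s _.
rewrite (val_ge0M lfval_valuation) //.
  by apply: (val_geX lfval_valuation); rewrite (val_geN lfval_valuation) (val_ge1 lfval_valuation).
rewrite -[X in _ *+ X](size_enum_ord n) enumT; exact: val_ge_prod.
Qed.

Lemma val_ge_det_congr n (A B : 'M[F]_n) :
  (forall i j, val_ge v 0 (A i j)) -> (forall i j, val_ge v 0 (B i j)) ->
  (forall i j, val_ge v 1 (A i j - B i j)) -> val_ge v 1 (\det A - \det B).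
Proof.
move=> A0 B0 AB; rewrite -sumrB; apply: (val_ge_sum lfval_valuation) => s _.
rewrite -mulrBr (val_ge0M lfval_valuation) //.
  by apply: (val_geX lfval_valuation); rewrite (val_geN lfval_valuation) (val_ge1 lfval_valuation).
elim: index_enum => [|i r IHr]; first by rewrite !big_nil subrr val_ge0.
rewrite !big_cons; set PA := \prod_(j <- r) A j _ in IHr *.
set b := B i _; rewrite -(subrKA (b * PA)) -mulrBl -mulrBr.
apply: (val_geD lfval_valuation); last first.
  by apply: (val_ge0M lfval_valuation) => //; apply: B0.
apply: (val_geM0 lfval_valuation) => //.
by rewrite -(mul0rn _ (size r)); apply: val_ge_prod.
Qed.

Lemma val_ge1_neq0 (a : F) : val_ge v 1 (a - 1) -> a != 0 /\ v a = 0.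
Proof.
move=> a1; have a0 : val_ge v 0 a.
  by rewrite -[a](subrK 1) (val_geD lfval_valuation) ?(val_ge_le _ a1) ?(val_ge1 lfval_valuation).
have na : ~~ val_ge v 1 a by rewrite (val_ge_eqr lfval_valuation a1) (val_ge1 lfval_valuation).
have an0 : a != 0 by apply: contraNneq na => ->; rewrite val_ge0.
by split=> //; move: a0 na; rewrite !val_ge_neq0 //; lia.
Qed.

End LocalField.

(** * The norm of a division algebra and its coordinates *)

Section DivisionNorm.
Variables (F : localFieldType) (D : falgType F) (d : nat).
Hypothesis hD : central_division_algebra D d.
Local Notation v := (@lfval F).
Let vv := lfval_valuation F.
Local Notation n := (\dim {:D}).
Local Notation b := (vbasis {:D}).

Lemma cda_unit (x : D) : x != 0 -> x \is a GRing.unit.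
Proof. by case: hD => h _ _; apply: h. Qed.

Lemma cda_neq0 (x : D) : (x \is a GRing.unit) = (x != 0).
Proof. by apply/idP/idP => [|/cda_unit //]; apply: contraTneq => ->; rewrite unitr0. Qed.

Lemma cda_dim_gt0 : (0 < n)%N.
Proof. by rewrite adim_gt0. Qed.

(** The sup norm of the coordinates in a fixed basis, multiplicative only up to the constant of
    [coord_geM]. It supplies the compactness and completeness from which the valuation is built;
    [coord_ge_dval] shows both to be equivalent. *)
Definition coord_ge (k : int) (x : D) := forall i : 'I_n, val_ge v k (coord b i x).

Lemma coord_vbasisf (x : D) : x = \sum_(i < n) coord b i x *: b`_i.
Proof. by apply: coord_vbasis; rewrite memvf. Qed.

Lemma coord_geD k x y : coord_ge k x -> coord_ge k y -> coord_ge k (x + y).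
Proof. by move=> xk yk i; rewrite linearD; apply: (val_geD vv); [exact: xk|exact: yk]. Qed.

Lemma coord_geN k x : coord_ge k x -> coord_ge k (- x).
Proof. by move=> xk i; rewrite linearN (val_geN vv); apply: xk. Qed.

Lemma coord_ge_sum (I : Type) (r : seq I) (P : pred I) (f : I -> D) k :
  (forall i, P i -> coord_ge k (f i)) -> coord_ge k (\sum_(i <- r | P i) f i).
Proof. by move=> fk j; rewrite linear_sum; apply: (val_ge_sum vv) => i /fk; apply. Qed.

Lemma coord_geZ k j (a : F) x : val_ge v k a -> coord_ge j x -> coord_ge (k + j) (a *: x).
Proof. by move=> ak xj i; rewrite linearZ /=; apply: (val_geM vv) ak _; exact: xj. Qed.

Lemma coord_ge_le k j x : j <= k -> coord_ge k x -> coord_ge j x.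
Proof. by move=> jk xk i; apply: val_ge_le jk _. Qed.

Lemma coord_geM : exists c : nat, forall k l x y,
  coord_ge k x -> coord_ge l y -> coord_ge (k + l - c%:Z) (x * y).
Proof.
have [c cP] := val_ge_finfun_bound (fun t : 'I_n * 'I_n * 'I_n => coord b t.2 (b`_t.1.1 * b`_t.1.2)).
exists c => k l x y xk yl; rewrite [x]coord_vbasisf mulr_suml.
apply: coord_ge_sum => i _; rewrite [y]coord_vbasisf mulr_sumr.
apply: coord_ge_sum => j _; rewrite -scalerAl -scalerAr -!addrA.
apply: coord_geZ => //; apply: coord_geZ => // t.
exact: (cP (i, j, t)).
Qed.

Lemma coord_ge_cauchy_limit (u : nat -> D) :
  (forall k : nat, coord_ge k (u k - u k.+1)) ->
  exists x, forall k : nat, coord_ge k (u k - x).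
Proof.
move=> cu.
have /choice[x xP] (i : 'I_n) : exists x, forall k : nat, val_ge v k (coord b i (u k) - x).
  by apply: val_ge_cauchy_limit => k; rewrite -linearB; apply: cu.
exists (\sum_i x i *: b`_i) => k i; rewrite linearB /=.
by rewrite (coord_sum_free _ _ (basis_free (vbasisP _))).
Qed.

Lemma coord_ge_reps (j N : int) : exists s : seq D, forall x, coord_ge j x ->
  exists2 y, y \in s & coord_ge N (x - y).
Proof.
have [s sP] := val_ge_reps F j N.
exists [seq \sum_i val (g i) *: b`_i | g : {ffun 'I_n -> seq_sub s}] => x xj.
have /choice[g gP] (i : 'I_n) : exists y : seq_sub s, val_ge v N (coord b i x - val y).
  by have [y ys xy] := sP _ (xj i); exists (SeqSub ys).
exists (\sum_i val (g i) *: b`_i).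
  by apply/mapP; exists [ffun i => g i]; rewrite ?mem_enum //; apply: eq_bigr => i _; rewrite ffunE.
move=> i; rewrite linearB /= (coord_sum_free _ _ (basis_free (vbasisP _))); exact: gP.
Qed.

(** Right multiplication by x on row vectors, a convention for which the map is multiplicative. *)
Definition mulmatrix (x : D) : 'M[F]_n := \matrix_(i, j) coord b j (b`_i * x).

Lemma mulmatrixM x y : mulmatrix (x * y) = mulmatrix x *m mulmatrix y.
Proof.
apply/matrixP => i j; rewrite !mxE mulrA [b`_i * x]coord_vbasisf mulr_suml linear_sum.
by apply: eq_bigr => k _; rewrite !mxE -scalerAl linearZ.
Qed.

Lemma mulmatrix1 : mulmatrix 1 = 1%:M.
Proof.
apply/matrixP => i j; rewrite !mxE mulr1 coord_free ?(basis_free (vbasisP _)) //.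
Qed.

Lemma mulmatrixD x y : mulmatrix (x + y) = mulmatrix x + mulmatrix y.
Proof. by apply/matrixP => i j; rewrite !mxE mulrDr linearD. Qed.

Lemma mulmatrixZ a x : mulmatrix (a *: x) = a *: mulmatrix x.
Proof. by apply/matrixP => i j; rewrite !mxE -scalerAr linearZ. Qed.

(** Valuation of the regular norm, which is the d-th power of the reduced norm; the division by d in
    [dval] accounts for this. *)
Definition normval (x : D) : int := v (\det (mulmatrix x)).

Lemma det_mulmatrix_neq0 x : x != 0 -> \det (mulmatrix x) != 0.
Proof.
move=> x0; have : \det (mulmatrix x) * \det (mulmatrix x^-1) = 1.
  by rewrite -det_mulmx -mulmatrixM mulrV ?cda_unit // mulmatrix1 det1.
by move=> h; apply: contraTneq (oner_neq0 F) => x0'; rewrite -h x0' mul0r eqxx.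
Qed.

Lemma normvalM x y : x != 0 -> y != 0 -> normval (x * y) = normval x + normval y.
Proof.
by move=> x0 y0; rewrite /normval mulmatrixM det_mulmx (valuationM vv) ?det_mulmatrix_neq0.
Qed.

Lemma normval1 : normval 1 = 0.
Proof. by rewrite /normval mulmatrix1 det1 (valuation1 vv). Qed.

Lemma normvalZ a x : a != 0 -> x != 0 -> normval (a *: x) = v a *+ n + normval x.
Proof.
move=> a0 x0; rewrite /normval mulmatrixZ detZ (valuationM vv) ?det_mulmatrix_neq0 ?expf_neq0 //.
by rewrite (valuationX vv).
Qed.

Lemma coord_ge_mulmatrix : exists c : nat, forall k x,
  coord_ge k x -> forall i j, val_ge v (k - c%:Z) (mulmatrix x i j).
Proof.
have [c cP] := coord_geM.
exists c => k x xk i j; rewrite mxE -[k]add0r; apply: cP => // t.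
rewrite coord_free ?(basis_free (vbasisP _)) //.
by case: (_ == _); rewrite ?val_ge0 ?(val_ge1 vv).
Qed.

Lemma coord_ge_normval : exists c : nat, forall k x,
  coord_ge k x -> x != 0 -> k *+ n - c%:Z <= normval x.
Proof.
have [c cP] := coord_ge_mulmatrix; exists (c * n)%N => k x xk x0.
have := val_ge_det (cP k x xk); rewrite val_ge_neq0 ?det_mulmatrix_neq0 //.
by apply: le_trans; rewrite mulrnBl lerB //; lia.
Qed.

Lemma coord_ge_primitive x : x != 0 ->
  exists2 j : int, coord_ge j x & ~ coord_ge (j + 1) x.
Proof.
move=> x0; have [i0 xi0] : exists i, coord b i x != 0.
  apply: contrapT => no; move/eqP: x0; apply; rewrite [x]coord_vbasisf big1 // => i _.
  by case: (eqVneq (coord b i x) 0) => [->|h]; rewrite ?scale0r //; case: no; exists i.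
case: (arg_minP (P := fun i => coord b i x != 0) (fun i => v (coord b i x)) xi0) => i xi imin.
exists (v (coord b i x)) => [j|/(_ i)]; last by rewrite val_ge_neq0 //; lia.
by case: (eqVneq (coord b j x) 0) => [->|xj]; rewrite ?val_ge0 // val_ge_neq0 //; apply: imin.
Qed.

(** Here y = x (1 + x^-1 (y - x)), and for y close to x the matrix of the second factor is congruent
    to 1 modulo P, so that its determinant is a unit. *)
Lemma normval_locally_constant x : x != 0 -> exists k : nat, forall y,
  coord_ge k (x - y) -> y != 0 /\ normval y = normval x.
Proof.
move=> x0; have [c cP] := coord_ge_mulmatrix; have [c' c'P] := coord_geM.
have [c2 c2P] := val_ge_finfun_bound (fun i : 'I_n => coord b i x^-1).
(* The three constants pay for x^-1, for the product and for the matrix entries; the last 1 makes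
   the result divisible by pi. *)
exists (c2 + c' + c + 1)%N => y xy.
have e1 : coord_ge (c%:Z + 1) (x^-1 * (y - x)).
  have : coord_ge (c2 + c' + c + 1)%N (y - x) by rewrite -opprB; apply: coord_geN.
  by move=> /(c'P _ _ _ _ c2P); apply: coord_ge_le; lia.
have {cP}e2 i j : val_ge v 1 (mulmatrix (x^-1 * (y - x)) i j).
  by apply: val_ge_le (cP _ _ e1 i j); lia.
have yE : y = x * (1 + x^-1 * (y - x)).
  by rewrite mulrDr mulr1 mulrA mulrV ?cda_unit // mul1r addrC subrK.
have [] : \det (mulmatrix (1 + x^-1 * (y - x))) != 0 /\ v (\det (mulmatrix (1 + x^-1 * (y - x)))) = 0.
  apply: val_ge1_neq0; have <- : \det (1%:M : 'M[F]_n) = 1 by rewrite det1.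
  apply: val_ge_det_congr => [i j|i j|i j].
  - rewrite mulmatrixD mulmatrix1 mxE (val_geD vv) ?(val_ge_le _ (e2 i j)) //.
    by rewrite mxE; case: (_ == _); rewrite ?val_ge0 ?(val_ge1 vv).
  - by rewrite mxE; case: (_ == _); rewrite ?val_ge0 ?(val_ge1 vv).
  - by rewrite mulmatrixD mulmatrix1 mxE addrAC subrr add0r.
set z := 1 + _ in yE * => dz vz; have z0 : z != 0.
  apply: contraNneq dz => ->; apply/eqP; rewrite -(scale0r 1) mulmatrixZ detZ expr0n.
  by rewrite -leqn0 leqNgt cda_dim_gt0 mul0r.
have y0 : y != 0 by rewrite yE -cda_neq0 unitrMr ?cda_unit.
by split=> //; rewrite yE normvalM // [normval z]vz addr0.
Qed.

(** Converse of [coord_ge_normval]. Up to a power of a uniformizer x is primitive, and the primitive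
    elements form a compact set, on which the locally constant norm valuation takes finitely many
    values. *)
Lemma normval_coord_ge : exists c : nat, forall k x,
  x != 0 -> k *+ n + c%:Z <= normval x -> coord_ge k x.
Proof.
pose X : set D := [set x | coord_ge 0 x /\ ~ coord_ge 1 x].
pose near (k : nat) (x y : D) := coord_ge k (x - y).
have nsym k x y : near k x y -> near k y x.
  by rewrite /near -[y - x]opprB => /coord_geN.
have ntrans k x y z : near k x y -> near k y z -> near k x z.
  by move=> xy yz; rewrite /near -(subrKA y); apply: coord_geD.
have X0 x : X x -> x != 0.
  by move=> [_ x1]; apply/eqP => xE; apply: x1 => i; rewrite xE linear0 val_ge0.
have /choice[k kP] x : exists k : nat, X x -> forall y, near k x y -> y != 0 /\ normval y = normval x.
  case: (eqVneq x 0) => [->|x0]; first by exists 0%N => /X0; rewrite eqxx.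
  by have [k kP] := normval_locally_constant x0; exists k => _ y /kP.
have [||s sX sP] := ultrametric_compact (X := X) nsym ntrans _ _ k.
- move=> m; have [s sP] := coord_ge_reps 0 m; exists s => x [x0 _]; exact: sP.
- move=> u uX uc; have [x xP] := coord_ge_cauchy_limit uc.
  exists x => //; have [u0 u1] := uX 1%N; have := xP 1%N => /= ux; split.
    rewrite -[x](subrK (u 1%N)); apply: coord_geD => //.
    by rewrite -opprB; apply: coord_geN; apply: coord_ge_le ux.
  by move=> x1; apply: u1; rewrite -[u 1%N](subrK x); apply: coord_geD.
exists (\sum_(x <- s) `|normval x|).+1%N => j x x0 jx.
have [i xi xi1] := coord_ge_primitive x0.
have [ov [ov0 vov]] := @lfval_normalized F.
have vovi z : v (ov ^ z) = z by rewrite (valuationXz vv) // vov mul1r.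
pose y := ov ^ (- i) *: x.
have ovi0 z : ov ^ z != 0 by rewrite expfz_neq0.
have Xy : X y.
  split=> [|y1]; first by rewrite -(addNr i); apply: coord_geZ => //; rewrite val_ge_neq0 ?vovi.
  apply: xi1; have -> : x = ov ^ i *: y by rewrite scalerA -expfzDr // subrr scale1r.
  by apply: coord_geZ => //; rewrite val_ge_neq0 ?vovi.
have [y' y's /kP[|_ wy]] := sP _ Xy; first exact: sX.
suff ji : j <= i by apply: coord_ge_le xi.
move: wy; rewrite normvalZ // vovi => wy.
have y'S : (`|normval y'| <= \sum_(x <- s) `|normval x|)%N.
  by rewrite (big_rem _ y's) /= leq_addr.
move: (\sum_(x <- s) _)%N jx y'S => S jx y'S.
have n0 := cda_dim_gt0; rewrite -mulr_natr natz in jx; rewrite -mulr_natr natz in wy.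
rewrite leNgt; apply/negP => ij.
have : (i + 1) * n%:Z <= j * n%:Z by rewrite ler_pM2r; lia.
move: (normval y') (normval x) wy jx y'S => a c wy jx y'S; nia.
Qed.

End DivisionNorm.

(** * Powers of the maximal ideal in terms of a valuation *)

Section ValuationIdeals.
Variables (D : unitRingType) (v : D -> int) (S : set D) (O : set D).
Hypotheses (Hv : is_valuation v) (HO : O = [set x | S x /\ val_ge v 0 x]).
Hypotheses (S1 : S 1) (SD : forall x y, S x -> S y -> S (x + y)).
Hypotheses (SM : forall x y, S x -> S y -> S (x * y)) (SV : forall x, S x -> S x^-1).

Lemma valuation_max_ideal : max_ideal O = [set x | S x /\ val_ge v 1 x].
Proof.
rewrite HO; apply/seteqP; split=> x /=.
  move=> [[Sx x0] nu]; split=> //; apply: contrapT => x1; apply: nu.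
  have xn0 : x != 0 by apply: contra_notN x1 => /eqP ->; rewrite val_ge0.
  move: x0 x1; rewrite !val_ge_neq0 // => x0 x1.
  exists x^-1; rewrite (vdiv_mulfV Hv) // (vdiv_mulVf Hv) //; split=> //; split; first exact: SV.
  by rewrite val_ge_neq0 ?invr_eq0 // (valuationV Hv) //; lia.
move=> [Sx x1]; split; first by split=> //; apply: val_ge_le x1.
move=> [y [[_ y0] xy _]]; have := val_geM0 Hv x1 y0.
by rewrite xy (val_ge1 Hv).
Qed.

Variable u : D.
Hypotheses (Su : S u) (u0 : u != 0) (S0 : S 0).
Hypothesis u_min : forall x, S x -> val_ge v 1 x -> val_ge v (v u) x.
Hypothesis vu : 0 < v u.

(** The element u generates the maximal ideal of O. Its valuation is the least positive value on S
    and may exceed 1: for S = E and [normval] it is the dimension of D. *)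
Lemma valuation_ideal_exp k :
  ideal_exp O (max_ideal O) k = [set x | S x /\ val_ge v (v u * k%:Z) x].
Proof.
elim: k => [|k IHk]; first by rewrite mulr0 /= HO.
rewrite [LHS]/= IHk valuation_max_ideal; apply/seteqP; split=> x /=.
  move=> [s [sP ->]]; elim: s sP => [|p s IHs] sP.
    by rewrite big_nil val_ge0.
  have [|Ss s1] := IHs; first by move=> q qs; apply: sP; rewrite inE qs orbT.
  have [[S1p v1p] [S2p v2p]] := sP p (mem_head _ _).
  rewrite big_cons; split; first by apply: SD => //; apply: SM.
  apply: (val_geD Hv) => //; have := val_geM Hv (u_min S1p v1p) v2p.
  by apply: val_ge_le; lia.
move=> [Sx xk]; exists [:: (u, u^-1 * x)]; split; last first.
  by rewrite big_seq1 /= mulrA (vdiv_mulfV Hv) // mul1r.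
move=> p; rewrite inE => /eqP -> /=; split.
  by split=> //; rewrite val_ge_neq0 //; lia.
split; first by apply: SM => //; apply: SV.
rewrite (val_geMl Hv) ?invr_eq0 // valuationV // opprK.
by apply: val_ge_le xk; lia.
Qed.

End ValuationIdeals.

(** * Ultrametric inequality and integral elements *)

Section CyclicValuation.
Variables (F : localFieldType) (D : falgType F) (d : nat).
Hypothesis hD : central_division_algebra D d.
Variable SF : cyclic_datum D d.
Local Notation v := (@lfval F).
Let vv := lfval_valuation F.
Local Notation n := (\dim {:D}).
Local Notation b := (vbasis {:D}).
Local Notation w := (@normval F D).
Local Notation E := (cd_E SF).
Local Notation piF := (cd_pi SF).
Local Notation piD := (cd_piD SF).

Lemma normvalX x k : x != 0 -> w (x ^+ k) = w x *+ k.
Proof.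
move=> x0; elim: k => [|k IHk]; first by rewrite normval1.
by rewrite exprS (normvalM hD) ?IHk ?mulrS // -(cda_neq0 hD) unitrX ?(cda_unit hD).
Qed.

Lemma normval_pow_coord_ge : exists c : nat, forall x, val_ge w 0 x ->
  forall k : nat, coord_ge (- c%:Z) (x ^+ k).
Proof.
have [c cP] := normval_coord_ge hD; exists c => x x0 k.
case: (eqVneq (x ^+ k) 0) => [->|xk0] i; first by rewrite linear0 val_ge0.
apply: cP => //; case: (eqVneq x 0) x0 xk0 => [->|xn0].
  by rewrite expr0n; case: k => [|k]; rewrite ?eqxx // normval1 => _ _; have := cda_dim_gt0 D; rewrite -mulr_natr natz; nia.
by rewrite val_ge_neq0 // normvalX // => x0 _; have := cda_dim_gt0 D; rewrite -(mulr_natr _ n) -(mulr_natr _ k) !natz; nia.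
Qed.

(** It suffices that w(x) >= 0 implies w(1 + x) >= 0. The power (1 + x)^k is a combination of powers
    of x with integer coefficients, so its coordinates are bounded below independently of k, whereas
    w((1 + x)^k) = k w(1 + x) would tend to minus infinity if w(1 + x) were negative. *)
Lemma normval_valuation : is_valuation w.
Proof.
split; [exact: (cda_unit hD) | exact: (normvalM hD) |].
have ge0D x : val_ge w 0 x -> val_ge w 0 (1 + x).
  have [c1 c1P] := coord_ge_normval hD; have [c2 c2P] := normval_pow_coord_ge.
  move=> x0; case: (eqVneq (1 + x) 0) => [->|x10]; first by rewrite val_ge0.
  rewrite val_ge_neq0 // leNgt; apply/negP => wlt0.
  (* As w(1 + x) <= -1, this power has valuation below - c2 n - c1, the bound that results from the
     two comparisons. *)
  pose k := (c2 * n + c1).+1.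
  have /c1P : coord_ge (- c2%:Z) ((1 + x) ^+ k).
    rewrite exprDn_comm; last exact/commr_sym/commr1.
    apply: coord_ge_sum => i _; rewrite expr1n mul1r.
    elim: 'C(_, _) => [|j IHj]; first by move=> t; rewrite linear0 val_ge0.
    by rewrite mulrS; apply: coord_geD => //; apply: c2P.
  rewrite -(cda_neq0 hD) unitrX ?(cda_unit hD) // => /(_ isT).
  rewrite normvalX // -(mulr_natr _ n) -(mulr_natr _ k) !natz /k; nia.
have le m x y : x != 0 -> y != 0 -> w x <= w y -> m <= w x -> val_ge w m (x + y).
  move=> x0 y0 xy mx; have -> : x + y = x * (1 + x^-1 * y).
    by rewrite mulrDr mulr1 mulVKr ?(cda_unit hD).
  have xV0 : x^-1 != 0 by rewrite invr_eq0.
  have xVy0 : x^-1 * y != 0 by rewrite -(cda_neq0 hD) unitrMr ?(cda_unit hD).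
  have wV : w x^-1 = - w x.
    apply/eqP; rewrite -addr_eq0 -(normvalM hD) // mulVr ?(cda_unit hD) //; exact/eqP/normval1.
  have /ge0D : val_ge w 0 (x^-1 * y).
    by rewrite val_ge_neq0 // (normvalM hD) // wV; lia.
  rewrite /val_ge; case: (eqVneq (1 + x^-1 * y) 0) => [->|h] /= wy; first by rewrite mulr0 eqxx.
  by rewrite (normvalM hD) //; apply/orP; right; lia.
move=> m x y; case: (eqVneq x 0) => [->|x0]; first by rewrite add0r.
case: (eqVneq y 0) => [->|y0]; first by rewrite addr0.
rewrite !(val_ge_neq0 _ _ x0) !(val_ge_neq0 _ _ y0) => mx my.
have [xy|yx] := lerP (w x) (w y); first exact: le.
by rewrite addrC; apply: le => //; lia.
Qed.

Lemma normval_alg a : a != 0 -> w a%:A = v a * n%:Z.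
Proof.
by move=> a0; rewrite (normvalZ hD) ?oner_neq0 // normval1 addr0 -mulr_natr natz.
Qed.

Lemma val_ge_alg k a : val_ge v k a -> val_ge w (k * n%:Z) a%:A.
Proof.
case: (eqVneq a 0) => [->|a0]; first by rewrite scale0r !val_ge0.
rewrite val_ge_neq0 // => ka; apply/orP; right; rewrite normval_alg //.
by rewrite ler_wpM2r.
Qed.

Let ww := normval_valuation.

Lemma integral_val_ge (x : D) : integral_over_OF x -> val_ge w 0 x.
Proof.
move=> [p [pm pO px]]; apply: contraT => nx.
have xn0 : x != 0 by apply: contraNneq nx => ->; rewrite val_ge0.
move: (nx); rewrite val_ge_neq0 // -ltNge => wx.
pose k := (size p).-1.
have sp : size p = k.+1 by rewrite prednK // size_poly_gt0 monic_neq0.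
have xk : x ^+ k = - \sum_(i < k) (p`_i)%:A * x ^+ i.
  move: px; rewrite /root horner_coef size_map_poly sp big_ord_recr /= coef_map /=.
  have -> : p`_k = 1 by move: pm; rewrite monicE /lead_coef => /eqP.
  rewrite scale1r mul1r addrC addr_eq0 => /eqP ->; congr (- _).
  by apply: eq_bigr => i _; rewrite coef_map.
have : val_ge w (w x * k%:Z + 1) (x ^+ k).
  rewrite xk (val_geN ww); apply: (val_ge_sum ww) => i _.
  apply: (val_ge0M ww); first by have := val_ge_alg (pO i); rewrite mul0r.
  rewrite val_ge_neq0 ?(vdiv_expf_neq0 ww) // normvalX // -mulr_natr natz.
  have := ltn_ord i; nia.
by rewrite val_ge_neq0 ?(vdiv_expf_neq0 ww) // normvalX // -mulr_natr natz; lia.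
Qed.

Lemma free_powers (x : D) k :
  (forall j, (j < k)%N -> x ^+ j \notin <<mkseq (fun i => x ^+ i)%R j>>%VS) ->
  free (mkseq (fun i => x ^+ i) k).
Proof.
elim: k => [|k IHk] h; first exact: nil_free.
rewrite mkseqS.
have /perm_free -> : perm_eq (rcons (mkseq (fun i => x ^+ i) k) (x ^+ k))
  (x ^+ k :: mkseq (fun i => x ^+ i) k) by rewrite perm_rcons.
rewrite free_cons h //=.
by apply: IHk => j jk; apply: h; lia.
Qed.

(** With k the degree of the minimal polynomial of x, the span of 1, ..., x^(k-1) is stable under
    multiplication by x. *)
Lemma free_powers_span (x : D) : exists2 k, free (mkseq (fun i => x ^+ i) k) &
  forall j, x ^+ j \in <<mkseq (fun i => x ^+ i)%R k>>%VS.
Proof.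
pose X k := mkseq (fun i => x ^+ i) k.
have ex : exists k, x ^+ k \in <<X k>>%VS.
  apply: contrapT => no; have : free (X n.+1).
    by apply: free_powers => j _; apply/negP => xj; apply: no; exists j.
  rewrite /free size_mkseq => /eqP e.
  by have := dimvS (subvf <<X n.+1>>%VS); rewrite e ltnn.
case: (ex_minnP ex) => k xk kmin; exists k.
  by apply: free_powers => j; apply: contraTN => /kmin; rewrite -leqNgt.
elim=> [|j IHj].
  case: k xk {kmin} => // k _; apply: memv_span; apply/mapP.
  by exists 0%N; rewrite ?mem_iota ?expr0.
rewrite exprS; move: IHj; rewrite -[X in <<X>>%VS]/(X k) -/(tval [tuple of X k]) => /coord_span ->.
rewrite mulr_sumr; apply: memv_suml => i _; rewrite -scalerAr; apply: memvZ.
have ik : (i < k)%N by exact: ltn_ord.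
rewrite nth_mkseq // -exprS.
move: (ik); rewrite leq_eqVlt => /orP[/eqP->//|ik1].
by apply: memv_span; apply/mapP; exists i.+1; rewrite ?mem_iota.
Qed.

(** The equation is not the minimal one. The powers of x are bounded, so that two of them, x^(k + a)
    and x^(k + a'), agree modulo a power of pi so high that the coordinates of their difference on
    1, ..., x^(k-1) are integral; this relation is monic of degree k + a'. *)
Lemma val_ge_integral (x : D) : val_ge w 0 x -> integral_over_OF x.
Proof.
move=> x0; have [k Xfree Xspan] := free_powers_span x.
set X := mkseq _ k in Xfree Xspan.
have sX : size X = k by rewrite size_mkseq.
have [N NP] : exists N : nat, forall y : D, coord_ge N y ->
    forall j : 'I_(size X), val_ge v 0 (coord (in_tuple X) j y).
  have [c cP] := val_ge_finfun_bound (fun t : 'I_n * 'I_(size X) => coord (in_tuple X) t.2 b`_t.1).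
  exists c => y yc j; rewrite [y](coord_vbasisf) linear_sum; apply: (val_ge_sum vv) => i _.
  by rewrite linearZ /= -(subrr c%:Z); apply: (val_geM vv) (yc i) (cP (i, j)).
have [c cP] := normval_pow_coord_ge.
have [s sP] := coord_ge_reps D (- c%:Z) N.
(* The exponents start at k in order that ['X^(k + a')] dominates the remainder, of degree below k,
   in the final equation. *)
have /choice[f fP] (i : nat) : exists y : seq_sub (undup s), coord_ge N (x ^+ (k + i) - val y).
  have [y ys xy] := sP _ (cP _ x0 (k + i)%N).
  by rewrite -mem_undup in ys; exists (SeqSub ys).
have [a [a' [aa' fa]]] : exists a a', (a < a')%N /\ f a = f a'.
  pose g (i : 'I_(size (undup s)).+1) := f i.
  have : ~~ injectiveb g.
    apply/negP => /injectiveP /leq_card; rewrite card_ord card_seq_sub ?undup_uniq //.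
    by rewrite ltnn.
  move=> /injectivePn[i [j ij gij]].
  by case: (ltngtP i j) ij => // [ij _|ji _|/val_inj->]; [exists i, j | exists j, i | rewrite eqxx].
have del : coord_ge N (x ^+ (k + a') - x ^+ (k + a)).
  rewrite -(subrKA (val (f a))) {1}fa -[X in _ + X]opprB.
  by apply: coord_geD => //; apply: coord_geN.
pose y := x ^+ (k + a') - x ^+ (k + a).
have yX : y \in <<X>>%VS by rewrite memvB.
have yE := coord_span (X := in_tuple X) yX.
pose q : {poly F} := 'X^(k + a) + \sum_(j < size X) coord (in_tuple X) j y *: 'X^j.
have sq : (size q < size ('X^(k + a') : {poly F}))%N.
  rewrite size_polyXn ltnS (leq_trans (size_polyD _ _)) // geq_max size_polyXn; apply/andP; split; first by lia.
  apply: (leq_trans (size_sum _ _ _)); apply/bigmax_leqP => j _.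
  apply: (leq_trans (size_scale_leq _ _)); rewrite size_polyXn.
  by have := ltn_ord j; rewrite [X in (_ < X)%N -> _]sX; lia.
exists ('X^(k + a') - q); split.
- by rewrite monicE lead_coefDl ?lead_coefXn // size_polyN.
- move=> i; rewrite /OF /= -[vge _ _]/(val_ge v 0 _) coefB coefD !coefXn coef_sum.
  apply: (val_geB vv); first exact: (val_ge_nat vv).
  apply: (val_geD vv); first exact: (val_ge_nat vv).
  apply: (val_ge_sum vv) => j _; rewrite coefZ coefXn (val_geM0 vv) //; first exact: NP.
  exact: (val_ge_nat vv).
- rewrite /root rmorphB rmorphD rmorph_sum /= !map_polyXn hornerD hornerN hornerD !hornerXn.
  rewrite opprD addrA -/y horner_sum [X in X - _]yE subr_eq0; apply/eqP.
  apply: eq_bigr => j _; rewrite map_polyZ /= map_polyXn hornerZ hornerXn mulr_algl.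
  congr (_ *: _); rewrite /= nth_mkseq //.
  by have := ltn_ord j; rewrite [X in (_ < X)%N -> _]sX.
Qed.

Lemma integralE (x : D) : integral_over_OF x <-> val_ge w 0 x.
Proof. by split; [exact: integral_val_ge | exact: val_ge_integral]. Qed.

End CyclicValuation.

(** * The normalized valuation of a central division algebra *)

Section NormalizedValuation.
Variables (F : localFieldType) (D : falgType F) (d : nat).
Hypothesis hD : central_division_algebra D d.
Variable SF : cyclic_datum D d.
Local Notation v := (@lfval F).
Let vv := lfval_valuation F.
Local Notation n := (\dim {:D}).
Local Notation w := (@normval F D).
Local Notation E := (cd_E SF).
Local Notation piF := (cd_pi SF).
Local Notation piD := (cd_piD SF).
Let ww := normval_valuation hD.

Lemma cda_dimE : n = (d * d)%N.
Proof. by case: hD => _ _ ->; rewrite mulnn. Qed.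

Lemma cda_deg_gt0 : (0 < d)%N.
Proof. by have := cda_dim_gt0 D; rewrite cda_dimE; case: (d). Qed.

Lemma cd_pi_neq0 : piF != 0. Proof. by have [] := cd_uniformizer SF. Qed.
Lemma cd_pi_val : v piF = 1. Proof. by have [] := cd_uniformizer SF. Qed.

Lemma OF_val_ge : @OF F = [set x | setT x /\ val_ge v 0 x].
Proof. by apply/seteqP; split=> x //= [_]. Qed.

Lemma PF_val_ge k (a : F) : PF k a <-> val_ge v k a.
Proof.
have -> : PF k = [set x : F | setT x /\ val_ge v (v piF * k%:Z) x].
  apply: (valuation_ideal_exp (S := setT) vv OF_val_ge) => //.
  - exact: cd_pi_neq0.
  - by move=> x _; rewrite cd_pi_val.
  - by rewrite cd_pi_val.
by rewrite cd_pi_val mul1r /=; split=> [[]|].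
Qed.

Lemma cd_E1 : 1 \in E.
Proof.
have [x Ex x0] : exists2 x, x \in E & x != 0.
  by exists (algid E); rewrite ?memv_algid ?algid_neq0.
by rewrite -algid_eq1 (unitr_algid1 Ex) // (cda_unit hD).
Qed.

Lemma cd_E_alg a : a%:A \in E.
Proof. by rewrite memvZ // cd_E1. Qed.

Let OEw : OE E = [set x | x \in E /\ val_ge w 0 x].
Proof. by apply/seteqP; split=> x /= [Ex /(integralE hD)]. Qed.

Let SEs : [/\ (1 : D) \in E, forall x y, x \in E -> y \in E -> x + y \in E,
  forall x y, x \in E -> y \in E -> x * y \in E & forall x, x \in E -> x^-1 \in E].
Proof.
split; [exact: cd_E1 | exact: memvD | exact: memvM | by move=> x; rewrite memvV].
Qed.

Let Emax : max_ideal (OE E) = [set x | x \in E /\ val_ge w 1 x].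
Proof.
have [E1 ED EM EV] := SEs.
exact: (valuation_max_ideal (S := [set x | x \in E]) ww OEw).
Qed.

(** This is where the unramifiedness of E enters: P_E is generated by pi_F, whose norm valuation is
    n. *)
Let E_unramified x : x \in E -> val_ge w 1 x -> val_ge w n x.
Proof.
move=> Ex x1; have : PE E 1 x.
  rewrite /PE /= Emax OEw; exists [:: (x, 1)]; rewrite big_seq1 /= mulr1; split=> // p.
  by rewrite inE => /eqP -> /=; rewrite cd_E1 (val_ge1 ww).
rewrite (cd_unramified SF) => -[a [y [/PF_val_ge a1]]]; rewrite OEw => -[_ y0] ->.
rewrite -mulr_algl -[n%:Z]mul1r (val_geM0 ww) //; exact: (val_ge_alg hD).
Qed.

Let piFA0 : piF%:A != 0 :> D.
Proof. by rewrite scaler_eq0 oner_eq0 orbF cd_pi_neq0. Qed.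

Let wpiF : w piF%:A = n%:Z.
Proof. by rewrite (normval_alg hD) ?cd_pi_neq0 // cd_pi_val mul1r. Qed.

Let PEw k : PE E k = [set x | x \in E /\ val_ge w (n%:Z * k%:Z) x].
Proof.
have [E1 ED EM EV] := SEs.
rewrite -wpiF; apply: (valuation_ideal_exp (S := [set x | x \in E]) ww OEw) => //.
- exact: cd_E_alg.
- exact: mem0v.
- by move=> x Ex x1; rewrite wpiF; apply: E_unramified.
- by rewrite wpiF; have := cda_dim_gt0 D; lia.
Qed.

(** Dividing by a power of pi_F leaves a remainder in [0, n), which vanishes since no element of E
    has valuation strictly between 0 and n. *)
Let E_normval e : e \in E -> e != 0 -> exists z : int, w e = n%:Z * z.
Proof.
move=> Ee e0; exists (w e %/ n%:Z)%Z.
have n0 := cda_dim_gt0 D.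
have aE : (piF ^ (- (w e %/ n%:Z)%Z))%:A * e \in E by rewrite memvM ?cd_E_alg.
have piz z : piF ^ z != 0 by rewrite expfz_neq0 ?cd_pi_neq0.
have pizA z : (piF ^ z)%:A != 0 :> D by rewrite scaler_eq0 oner_eq0 orbF.
have := E_unramified aE.
rewrite !(val_geMl ww) // (normval_alg hD) // (valuationXz vv) ?cd_pi_neq0 // cd_pi_val mul1r.
rewrite !val_ge_neq0 //.
have := divz_eq (w e) n; have := modz_ge0 (w e) (d := n).
have := ltz_pmod (w e) (d := n).
move: (w e %/ n)%Z (w e %% n)%Z => q r h1 h2 ->.
have {}h1 := h1 n0; have {}h2 : 0 <= r by apply: h2; lia.
move=> h3; have -> : r = 0 by lia.
by rewrite addr0 mulrC.
Qed.

Lemma cd_piD_neq0 : piD != 0.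
Proof.
apply: contraNneq piFA0 => p0; rewrite -(cd_piD_pow SF) p0 expr0n.
by rewrite eqn0Ngt cda_deg_gt0.
Qed.

Let wpiD : w piD = d%:Z.
Proof.
have := congr1 w (cd_piD_pow SF); rewrite (normvalX hD) ?cd_piD_neq0 // wpiF cda_dimE.
by rewrite -mulr_natr natz PoszM; apply: mulIf; have := cda_deg_gt0; case: (d).
Qed.

Lemma cyclic_expansion (x : D) : exists e : 'I_d -> D,
  (forall i, e i \in E) /\ x = \sum_(i < d) piD ^+ i * e i.
Proof.
have : x \in (\sum_(i < d) (<[piD ^+ i]> * E))%VS by rewrite (cd_span SF) memvf.
move=> /memv_sumP[vs vsE ->].
have /choice[e eP] (i : 'I_d) : exists e, e \in E /\ vs i = piD ^+ i * e.
  have : (<[piD ^+ i]> * E <= amull (piD ^+ i) @: E)%VS.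
    apply/prodvP => _ y /vlineP[a ->] Ey.
    rewrite -scalerAl scalerAr; have -> : piD ^+ i * (a *: y) = amull (piD ^+ i) (a *: y).
      by rewrite lfunE.
    by rewrite memv_img // memvZ.
  move=> /subvP /(_ _ (vsE i isT)) /memv_imgP[y Ey ->].
  by exists y; rewrite lfunE.
exists e; split=> [i|]; first by have [] := eP i.
by apply: eq_bigr => i _; have [] := eP i.
Qed.

Let w_term i e : e \in E -> piD ^+ i * e != 0 ->
  exists z : int, w (piD ^+ i * e) = d%:Z * (i%:Z + d%:Z * z).
Proof.
move=> Ee; rewrite (vdiv_mulf_eq0 ww) (negPf (vdiv_expf_neq0 ww i cd_piD_neq0)) /= => e0.
have [z wz] := E_normval Ee e0; exists z.
rewrite (normvalM hD) ?(vdiv_expf_neq0 ww) ?cd_piD_neq0 // wz (normvalX hD) ?cd_piD_neq0 //.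
by rewrite wpiD cda_dimE -mulr_natr natz; lia.
Qed.

(** By [w_term] the valuation of the i-th term determines i modulo d, so that no two nonzero terms
    have the same valuation. *)
Lemma cyclic_terms_normval (e : 'I_d -> D) k : (forall i, e i \in E) ->
  val_ge w k (\sum_(i < d) piD ^+ i * e i) -> forall i : 'I_d, val_ge w k (piD ^+ i * e i).
Proof.
move=> eE; apply: (val_ge_sum_distinct ww) => i j /(w_term (eE i))[z ->] /(w_term (eE j))[z' ->].
move=> h; apply: val_inj => /=; have d0 := cda_deg_gt0.
have := ltn_ord i; have := ltn_ord j; move: (nat_of_ord i) (nat_of_ord j) h => {}i {}j h jd id.
have {}h : i%:Z + d%:Z * z = j%:Z + d%:Z * z' by apply: (@mulfI _ d%:Z); lia.
have : z = z' by nia.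
by move=> zz; subst z'; lia.
Qed.

(** The valuation of x is attained by a term of its expansion, where divisibility by d is known from
    [w_term]. *)
Let d_dvd_normval x : x != 0 -> exists z, w x = d%:Z * z.
Proof.
move=> x0; have [e [eE xE]] := cyclic_expansion x.
have h : forall i : 'I_d, val_ge w (w x) (piD ^+ i * e i).
  by apply: cyclic_terms_normval => //; rewrite -xE val_ge_neq0.
have [i ni] : exists i : 'I_d, ~~ val_ge w (w x + 1) (piD ^+ i * e i).
  apply: contrapT => no; suff : val_ge w (w x + 1) x by rewrite val_ge_neq0 //; lia.
  rewrite {2}xE; apply: (val_ge_sum ww) => i _; apply: contraT => ni; by case: no; exists i.
have t0 : piD ^+ i * e i != 0 by apply: contraNneq ni => ->; rewrite val_ge0.
have [z wz] := w_term (eE i) t0; exists (i%:Z + d%:Z * z).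
by move: ni (h i); rewrite !val_ge_neq0 // wz; lia.
Qed.

(** An exact division for x != 0, by [d_dvd_normval]. The result is the valuation of the reduced
    norm, with value 1 at pi_D and d at pi_F. *)
Definition dval (x : D) : int := (w x %/ d%:Z)%Z.

Lemma normval_dval x : x != 0 -> w x = d%:Z * dval x.
Proof.
move=> /d_dvd_normval[z wz]; rewrite /dval wz mulKz //.
by have := cda_deg_gt0; case: (d).
Qed.

Lemma val_ge_dval k x : val_ge dval k x = val_ge w (d%:Z * k) x.
Proof.
case: (eqVneq x 0) => [->|x0]; first by rewrite !val_ge0.
rewrite !val_ge_neq0 // (normval_dval x0) ler_pM2l //.
by have := cda_deg_gt0; lia.
Qed.

Lemma dval_valuation : is_valuation dval.
Proof.
have d0 : d%:Z != 0 by have := cda_deg_gt0; lia.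
split; [exact: (cda_unit hD) | move=> x y x0 y0 | move=> k x y].
  apply: (mulfI d0); rewrite mulrDr -(normval_dval x0) -(normval_dval y0).
  by rewrite -normval_dval ?(vdiv_mulf_neq0 ww) // (normvalM hD).
by rewrite !val_ge_dval; apply: (val_geD ww).
Qed.

Lemma dval_piD : dval piD = 1.
Proof. by rewrite /dval wpiD divzz; have := cda_deg_gt0; case: (d). Qed.

Lemma OD_val_ge x : OD D x <-> val_ge dval 0 x.
Proof.
rewrite val_ge_dval mulr0 -(integralE hD); split=> [[]//|h]; split=> //; exact: memvf.
Qed.

Lemma PD_val_ge k x : PD D k x <-> val_ge dval k x.
Proof.
have dd := dval_valuation.
have OO : OE {:D} = [set x | setT x /\ val_ge dval 0 x].
  by apply/seteqP; split=> y /=; [move=> /OD_val_ge | move=> [_ ?]; apply/OD_val_ge].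
have -> : PD D k = [set x : D | setT x /\ val_ge dval (dval piD * k%:Z) x].
  apply: (valuation_ideal_exp (S := setT) dd OO) => //.
  - exact: cd_piD_neq0.
  - by move=> y _; rewrite dval_piD.
  - by rewrite dval_piD.
by rewrite dval_piD mul1r /=; split=> [[]|].
Qed.

Lemma OE_val_ge x : OE E x <-> x \in E /\ val_ge dval 0 x.
Proof. by rewrite OEw /= val_ge_dval mulr0. Qed.

Lemma PE_val_ge k x : PE E k x <-> x \in E /\ val_ge dval (d%:Z * k%:Z) x.
Proof. by rewrite PEw /= val_ge_dval mulrA cda_dimE PoszM. Qed.

Lemma dval_alg a : a != 0 -> dval a%:A = d%:Z * v a.
Proof.
move=> a0; have := normval_dval (x := a%:A); rewrite scaler_eq0 oner_eq0 orbF => /(_ a0).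
rewrite (normval_alg hD) // cda_dimE PoszM => h.
have d0 : d%:Z != 0 by have := cda_deg_gt0; lia.
by apply: (mulfI d0); rewrite -h; lia.
Qed.

Lemma dval_ge_alg k a : val_ge v k a -> val_ge dval (d%:Z * k) a%:A.
Proof.
case: (eqVneq a 0) => [->|a0]; first by rewrite scale0r !val_ge0.
rewrite !val_ge_neq0 ?dval_alg ?scaler_eq0 ?oner_eq0 ?orbF //.
by move=> ka; apply: ler_wpM2l.
Qed.

Lemma cyclic_terms_val_ge (e : 'I_d -> D) k : (forall i, e i \in E) ->
  val_ge dval k (\sum_(i < d) piD ^+ i * e i) ->
  forall i : 'I_d, val_ge dval k (piD ^+ i * e i).
Proof. by move=> eE h i; rewrite val_ge_dval; apply: cyclic_terms_normval => //; rewrite -val_ge_dval. Qed.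

Lemma cd_E_dval e : e \in E -> e != 0 -> exists z, dval e = d%:Z * z.
Proof.
move=> Ee e0; have [z] := E_normval Ee e0; rewrite (normval_dval e0) cda_dimE => h.
exists z; have d0 : d%:Z != 0 by have := cda_deg_gt0; lia.
by apply: (mulfI d0); rewrite h; lia.
Qed.

(** On E the valuation takes multiples of d as values, and a shift by i < d does not cross the next
    multiple. *)
Lemma cyclic_term_val_ge e k (i : 'I_d) : e \in E ->
  val_ge dval (d%:Z * k) (piD ^+ i * e) = val_ge dval (d%:Z * k) e.
Proof.
move=> Ee; have p0 := vdiv_expf_neq0 ww i cd_piD_neq0.
rewrite (val_geMl dval_valuation) // (valuationX dval_valuation) ?cd_piD_neq0 // dval_piD.
case: (eqVneq e 0) => [->|e0]; first by rewrite !val_ge0.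
rewrite !val_ge_neq0 //; have [z ->] := cd_E_dval Ee e0.
have := ltn_ord i; rewrite -mulr_natr natz mul1r => id; apply/idP/idP => h; last by lia.
have d0 := cda_deg_gt0; rewrite ler_pM2l ?leNgt; last by lia.
apply/negP => zk; have : d%:Z * (z + 1) <= d%:Z * k by rewrite ler_pM2l; lia.
by lia.
Qed.

Lemma OD_expansion x : val_ge dval 0 x -> exists e : 'I_d -> D,
  (forall i, OE E (e i)) /\ x = \sum_(i < d) piD ^+ i * e i.
Proof.
move=> x0; have [e [eE xE]] := cyclic_expansion x; exists e; split=> // i.
apply/OE_val_ge; split=> //; rewrite -[X in val_ge _ X](mulr0 d%:Z) -(cyclic_term_val_ge 0 i) //.
by rewrite mulr0; apply: cyclic_terms_val_ge => //; rewrite -xE.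
Qed.

(** The coordinates define the topology of [GL], the valuation its congruence subgroups; the factor
    d is the valuation of pi_F. *)
Lemma coord_ge_dval : exists c : nat, forall (k : int) (x : D),
  (coord_ge k x -> val_ge dval (d%:Z * k - c%:Z) x) /\
  (val_ge dval (d%:Z * k + c%:Z) x -> coord_ge k x).
Proof.
have [c1 c1P] := coord_ge_normval hD; have [c2 c2P] := normval_coord_ge hD.
exists (c1 + c2)%N => k x; have d0 := cda_deg_gt0.
case: (eqVneq x 0) => [->|x0].
  by split=> [|_ i]; rewrite ?linear0 val_ge0.
rewrite !val_ge_dval !val_ge_neq0 //; split=> [/c1P/(_ x0)|h].
  by rewrite -mulr_natr natz cda_dimE; nia.
by apply: c2P => //; rewrite -mulr_natr natz cda_dimE; nia.
Qed.

End NormalizedValuation.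

Lemma uniq_rel_leq (T T' : eqType) (s : seq T) (s' : seq T') (r : T -> T' -> Prop) :
  uniq s -> (forall x, x \in s -> exists2 y, y \in s' & r x y) ->
  (forall x1 x2 y, x1 \in s -> x2 \in s -> r x1 y -> r x2 y -> x1 = x2) ->
  (size s <= size s')%N.
Proof.
move=> us tot inj.
have /choice[f fP] (x : T) : exists y : option T', x \in s -> exists y', [/\ y = Some y', y' \in s' & r x y'].
  case: (boolP (x \in s)) => [/tot[y ys' xy]|_]; last by exists None.
  by exists (Some y) => _; exists y.
rewrite -(size_map f) -(size_map Some s'); apply: uniq_leq_size.
  rewrite map_inj_in_uniq // => x1 x2 x1s x2s.
  have [y1 [-> _ r1]] := fP _ x1s; have [y2 [-> _ r2]] := fP _ x2s => -[e].
  by apply: (inj _ _ y2) => //; rewrite -e.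
by move=> _ /mapP[x xs ->]; have [y [-> ys' _]] := fP _ xs; rewrite map_f.
Qed.

(** * Galois action and Frobenius on the unramified subfield *)

Section GaloisValuation.
Variables (F : localFieldType) (D : falgType F) (d : nat).
Hypothesis hD : central_division_algebra D d.
Variable SF : cyclic_datum D d.
Local Notation v := (@lfval F).
Let vv := lfval_valuation F.
Local Notation E := (cd_E SF).
Local Notation w := (@dval F D d).
Let ww := dval_valuation hD SF.
Let d0 := cda_deg_gt0 hD.

(** Adding 1 permutes the residue classes. Summing y + 1 - g(y) over the representatives, where g(y)
    represents y + 1, leaves exactly q, while every summand lies in P. *)
Lemma residue_card_val_ge q : residue_card F q -> val_ge v 1 (q%:R : F).
Proof.
move=> [s [sz us sO sP]].
have PFE := PF_val_ge SF.
have /choice[g gP] (y : F) : exists y', y \in s -> y' \in s /\ val_ge v 1 (y + 1 - y').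
  case: (boolP (y \in s)) => [ys|_]; last by exists 0.
  have [|y' [[y's /PFE yy'] _]] := sP (y + 1); last by exists y'.
  by apply: (val_geD vv); [exact: sO | rewrite (val_ge1 vv)].
have uniq_rep x y z : OF x -> y \in s -> z \in s -> val_ge v 1 (x - y) -> val_ge v 1 (x - z) -> y = z.
  move=> Ox ys zs xy xz; have [t [_ tu]] := sP x Ox.
  by transitivity t; [apply/esym|]; apply: tu; split=> //; apply/PFE.
have gs : perm_eq (map g s) s.
  have sgs : {subset map g s <= s} by move=> _ /mapP[y ys ->]; have [] := gP y ys.
  have ug : uniq (map g s).
    rewrite map_inj_in_uniq // => y z ys zs gyz.
    have [gys yg] := gP y ys; have [_ zg] := gP z zs.
    apply: (uniq_rep y) => //; first exact: sO; first by rewrite subrr val_ge0.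
    have -> : y - z = (y + 1 - g y) - (z + 1 - g z) by rewrite gyz; ring.
    exact: (val_geB vv).
  by apply: uniq_perm => //; have [_] := uniq_min_size ug sgs (eq_leq (esym (size_map g s))).
have : val_ge v 1 (\sum_(y <- s) (y + 1 - g y)).
  by rewrite big_seq; apply: (val_ge_sum vv) => y ys; have [] := gP y ys.
rewrite sumrB big_split /= -[X in _ - X](big_map g xpredT id) (perm_big _ gs) /=.
by rewrite addrAC subrr add0r -sz big_const_seq count_predT iter_addr_0.
Qed.

Lemma gal_mem s x : gal_aut E s -> x \in E -> s x \in E.
Proof. by move=> [_ sE] Ex; rewrite -sE memv_img. Qed.

Lemma galM s : gal_aut E s -> {in E &, {morph s : x y / x * y}}.
Proof. by move=> [/ahom_inP[sM _] _]. Qed.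

Lemma gal1 s : gal_aut E s -> s 1 = 1.
Proof. by move=> [/ahom_inP[_ s1] _]. Qed.

Lemma cd_EX x k : x \in E -> x ^+ k \in E.
Proof.
by move=> Ex; elim: k => [|k IHk]; rewrite ?cd_E1 // exprS memvM.
Qed.

Lemma galX s x k : gal_aut E s -> x \in E -> s (x ^+ k) = s x ^+ k.
Proof.
move=> sg Ex; elim: k => [|k IHk]; first by rewrite !expr0 gal1.
by rewrite !exprS galM ?IHk // cd_EX.
Qed.

Lemma gal_OE s x : gal_aut E s -> OE E x -> OE E (s x).
Proof.
move=> sg [Ex [p [pm pO px]]]; split; first exact: gal_mem.
exists p; split=> //; apply/eqP; move/eqP: px.
rewrite !horner_coef !size_map_poly => /(congr1 s); rewrite linear0 linear_sum => h; rewrite -[RHS]h.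
by apply: eq_bigr => i _; rewrite !coef_map /= !mulr_algl linearZ /= galX.
Qed.

(** Automorphisms preserve integrality, hence the valuation: x is first made a unit by a power of
    pi_F, which they fix. *)
Lemma gal_val_ge s x k : gal_aut E s -> x \in E -> val_ge w k x -> val_ge w k (s x).
Proof.
move=> sg Ex; case: (eqVneq x 0) => [->|x0]; first by rewrite linear0 !val_ge0.
have [z wz] := cd_E_dval hD Ex x0; rewrite val_ge_neq0 // wz => kz.
set a := (cd_pi SF) ^ (- z).
have pi0 : cd_pi SF != 0 by exact: cd_pi_neq0.
have a0 : a != 0 by rewrite expfz_neq0.
have wa : w a%:A = d%:Z * - z.
  by rewrite (dval_alg hD SF) // (valuationXz vv) // cd_pi_val mul1r.
have aA0 : a%:A != 0 :> D by rewrite scaler_eq0 oner_eq0 orbF.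
have : OE E (a *: x).
  apply/(OE_val_ge hD); rewrite -mulr_algl memvM ?cd_E_alg //; split=> //.
  by rewrite (val_geMl ww) // wa val_ge_neq0 // wz; lia.
move=> /(gal_OE sg) /(OE_val_ge hD)[_].
rewrite linearZ /= -mulr_algl (val_geMl ww) // wa; apply: val_ge_le; lia.
Qed.

(** A preimage x in E is integral: otherwise x^-1 lies in P_E, and so does 1 = y s(x^-1). *)
Lemma gal_OE_surj s y : gal_aut E s -> OE E y -> exists2 x, OE E x & s x = y.
Proof.
move=> sg /(OE_val_ge hD)[Ey y0]; have [_ sE] := sg.
have /memv_imgP[x Ex yE] : y \in (s @: E)%VS by rewrite sE.
exists x => //; apply/(OE_val_ge hD); split=> //; apply: contraT => nx.
have xn0 : x != 0 by apply: contraNneq nx => ->; rewrite val_ge0.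
have xV : val_ge w 1 x^-1.
  move: nx; rewrite !val_ge_neq0 ?invr_eq0 // (valuationV ww) //; lia.
have Ex' : x^-1 \in E by rewrite memvV.
have := val_ge0M ww y0 (gal_val_ge sg Ex' xV).
by rewrite yE -galM // (vdiv_mulfV ww) // gal1 // (val_ge1 ww).
Qed.

Lemma gal_iter s k : gal_aut E s -> forall x, OE E x -> OE E (iter k s x).
Proof. by move=> sg x Ox; elim: k => //= k; apply: gal_OE. Qed.

Lemma gal_iter_surj s k y : gal_aut E s -> OE E y -> exists2 x, OE E x & iter k s x = y.
Proof.
move=> sg; elim: k y => [|k IHk] y Oy; first by exists y.
by have [z /IHk[x Ox <-] <-] := gal_OE_surj sg Oy; exists x.
Qed.

Lemma OE_D x y : OE E x -> OE E y -> OE E (x + y).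
Proof.
move=> /(OE_val_ge hD)[Ex x0] /(OE_val_ge hD)[Ey y0]; apply/(OE_val_ge hD).
by rewrite memvD ?(val_geD ww).
Qed.

Lemma OE_M x y : OE E x -> OE E y -> OE E (x * y).
Proof.
move=> /(OE_val_ge hD)[Ex x0] /(OE_val_ge hD)[Ey y0]; apply/(OE_val_ge hD).
by rewrite memvM ?(val_ge0M ww).
Qed.

Lemma OE_alg a : OF a -> OE E a%:A.
Proof.
move=> a0; apply/(OE_val_ge hD); rewrite cd_E_alg //; split=> //.
by have := dval_ge_alg hD SF (a0 : val_ge v 0 a); rewrite mulr0.
Qed.

Lemma OE_1 : OE E 1.
Proof. by apply/(OE_val_ge hD); rewrite cd_E1 ?(val_ge1 ww). Qed.

Lemma OE_0 : OE E 0.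
Proof. by apply/(OE_val_ge hD); rewrite mem0v val_ge0. Qed.

Lemma OE_X x k : OE E x -> OE E (x ^+ k).
Proof. by move=> Ox; elim: k => [|k IHk]; [exact: OE_1 | rewrite exprS; apply: OE_M]. Qed.

Lemma OE_pi x : OE E x -> OE E (cd_pi SF *: x).
Proof.
move=> Ox; rewrite -mulr_algl; apply: OE_M => //; apply: OE_alg.
by apply/orP; right; rewrite cd_pi_val.
Qed.

Lemma OE_sub x y : OE E x -> OE E y -> x - y \in E.
Proof. by move=> [Ex _] [Ey _]; rewrite memvB. Qed.

(* a = b mod P^i implies a^q = b^q mod P^(i+1): the cofactor of a - b in
   a^q - b^q is congruent to q b^(q-1), hence to 0. *)
Lemma OE_expr_congr q x y (i : nat) : residue_card F q -> OE E x -> OE E y -> (0 < i)%N ->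
  val_ge w (d%:Z * i%:Z) (x - y) -> val_ge w (d%:Z * i.+1%:Z) (x ^+ q - y ^+ q).
Proof.
move=> qF Ox Oy i0 xy; have [Ex _] := Ox; have [Ey _] := Oy.
have wq : val_ge w (d%:Z * 1) (q%:R : D).
  have := dval_ge_alg hD SF (residue_card_val_ge qF).
  by rewrite scaler_nat.
have xyc : GRing.comm x y by exact: (cd_comm Ex Ey).
rewrite subrXX_comm //.
have -> : d%:Z * i.+1%:Z = d%:Z * i%:Z + d%:Z * 1 by lia.
apply: (val_geM ww) => //; rewrite mulr1.
have gex z : OE E z -> forall k, val_ge w 0 (z ^+ k).
  by move=> Oz k; have /(OE_val_ge hD)[_] := OE_X k Oz.
have xy1 : val_ge w d (x - y) by apply: val_ge_le xy; nia.
have term k : val_ge w d (x ^+ k - y ^+ k).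
  rewrite subrXX_comm //; apply: (val_geM0 ww) => //; apply: (val_ge_sum ww) => j _.
  by apply: (val_ge0M ww); apply: gex.
rewrite -(subrK (\sum_(k < q) y ^+ q.-1) (\sum_(k < q) _)); apply: (val_geD ww).
  rewrite -sumrB; apply: (val_ge_sum ww) => k _.
  have -> : y ^+ q.-1 = y ^+ (q.-1 - k) * y ^+ k.
    by rewrite -exprD subnK //; have := ltn_ord k; lia.
  by rewrite -mulrBl; apply: (val_geM0 ww) => //; apply: gex.
rewrite sumr_const card_ord -mulr_natr; apply: (val_ge0M ww); first exact: gex.
by rewrite mulr1 in wq.
Qed.

Lemma OE_expr_congr_iter q x y (k : nat) : residue_card F q -> OE E x -> OE E y ->
  val_ge w d%:Z (x - y) -> val_ge w (d%:Z * k.+1%:Z) (x ^+ (q ^ k) - y ^+ (q ^ k)).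
Proof.
move=> qF Ox Oy xy; elim: k => [|k IHk]; first by rewrite mulr1.
by rewrite expnSr !exprM; apply: OE_expr_congr => //; apply: OE_X.
Qed.

Lemma frobenius_iter phi q : frobenius E phi -> residue_card F q ->
  (forall x, OE E x -> val_ge w d (phi x - x ^+ q)) ->
  forall k x, OE E x -> val_ge w d (iter k phi x - x ^+ (q ^ k)).
Proof.
move=> [pg _] qF h k x Ox; elim: k => [|k IHk]; first by rewrite subrr val_ge0.
rewrite [iter _ _ _]/=; apply: (val_ge_trans ww) (h _ (gal_iter k pg Ox)) _.
have := OE_expr_congr qF (gal_iter k pg Ox) (OE_X (q ^ k) Ox) (ltnSn 0).
rewrite mulr1 expnSr exprM => /(_ IHk); apply: val_ge_le; lia.
Qed.

(* phi^k is onto, and it is the q^k-th power modulo P_E. *)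
Lemma frobenius_power_rep phi q k : frobenius E phi -> residue_card F q ->
  (forall x, OE E x -> val_ge w d (phi x - x ^+ q)) ->
  forall x, OE E x -> exists2 y, OE E y & val_ge w d (x - y ^+ (q ^ k)).
Proof.
move=> pf qF h x Ox; have [y Oy yx] := gal_iter_surj k (proj1 pf) Ox.
by exists y => //; rewrite -yx; apply: frobenius_iter.
Qed.

Lemma OE_div_pi x : x \in E -> val_ge w d x -> exists2 y, OE E y & x = cd_pi SF *: y.
Proof.
move=> Ex xd; have pi0 : cd_pi SF != 0 by exact: cd_pi_neq0.
exists ((cd_pi SF)^-1 *: x); last by rewrite scalerA divff // scale1r.
apply/(OE_val_ge hD); rewrite memvZ //; split=> //.
rewrite -mulr_algl (val_geMl ww) ?scaler_eq0 ?invr_eq0 ?oner_eq0 ?orbF //.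
by rewrite (dval_alg hD SF) ?invr_eq0 // (valuationV vv) // cd_pi_val; apply: val_ge_le xd; lia.
Qed.

Lemma val_ge_piZ k x : val_ge w k x -> val_ge w (d%:Z + k) (cd_pi SF *: x).
Proof.
move=> xk; rewrite -mulr_algl; apply: (val_geM ww) => //.
rewrite -[d%:Z]mulr1; apply: (dval_ge_alg hD SF).
by apply/orP; right; rewrite cd_pi_val.
Qed.

Lemma val_ge_piZE k (j : nat) x :
  val_ge w (d%:Z * j%:Z + k) (cd_pi SF ^+ j *: x) = val_ge w k x.
Proof.
have pi0 : cd_pi SF != 0 by exact: cd_pi_neq0.
rewrite -mulr_algl (val_geMl ww) ?scaler_eq0 ?oner_eq0 ?orbF ?expf_neq0 //.
rewrite (dval_alg hD SF) ?expf_neq0 // (valuationX vv) // cd_pi_val; congr (val_ge _ _ _).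
by rewrite -mulr_natr natz; lia.
Qed.

End GaloisValuation.

(* R x y means that y lifts the image of the class of x under an isomorphism
   O_D/P_D^M -> O_D'/P_D'^M compatible with the uniformizers p and p'. *)
Record truncated_iso (D D' : unitRingType) (v : D -> int) (v' : D' -> int)
    (p : D) (p' : D') (M : nat) (R : D -> D' -> Prop) : Prop := TruncatedIso {
  tiso_l : forall x y, R x y -> val_ge v 0 x;
  tiso_r : forall x y, R x y -> val_ge v' 0 y;
  tiso_total_l : forall x, val_ge v 0 x -> exists y, R x y;
  tiso_total_r : forall y, val_ge v' 0 y -> exists x, R x y;
  tisoD : forall x y x' y', R x x' -> R y y' -> R (x + y) (x' + y');
  tisoM : forall x y x' y', R x x' -> R y y' -> R (x * y) (x' * y');
  tiso1 : R 1 1;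
  tiso_unif : R p p';
  tiso_conj : forall x y, R x y -> R (p^-1 * x * p) (p'^-1 * y * p');
  tiso_val_ge : forall x y, R x y -> val_ge v M x = val_ge v' M y;
  tiso_congr : forall x y y', R x y -> val_ge v' M (y' - y) -> R x y'
}.

(** * The isomorphism between the truncations of O_D *)

Section ClassCorrespondence.
Variables (F L : localFieldType) (DF : falgType F) (DL : falgType L) (d : nat).
Hypotheses (hF : central_division_algebra DF d) (hL : central_division_algebra DL d).
Variables (SF : cyclic_datum DF d) (SL : cyclic_datum DL d) (m : nat).
Variables (lamFL : F -> L) (lam : DF -> DL).
Hypotheses (m0 : (0 < m)%N) (hc : close_datum SF SL m lamFL lam).
Local Notation E := (cd_E SF).
Local Notation K := (cd_E SL).
Local Notation vF := (@dval F DF d).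
Local Notation vL := (@dval L DL d).
Let ff := dval_valuation hF SF.
Let ll := dval_valuation hL SL.
Let d0 : (0 < d)%N := cda_deg_gt0 hF.
Local Notation M := (d%:Z * m%:Z).
Local Notation eqm x y := (val_ge vL M (x - y)).

Let eqmD x y x' y' : eqm x x' -> eqm y y' -> eqm (x + y) (x' + y').
Proof. by move=> h1 h2; rewrite opprD addrACA (val_geD ll). Qed.

Let eqmM x y x' y' : val_ge vL 0 x -> val_ge vL 0 y' -> eqm x x' -> eqm y y' -> eqm (x * y) (x' * y').
Proof.
move=> x0 y0 h1 h2; rewrite -(subrKA (x * y')) -mulrBr -mulrBl.
by apply: (val_geD ll); [apply: (val_ge0M ll) | apply: (val_geM0 ll)].
Qed.

Let eqm_trans x y z : eqm x y -> eqm y z -> eqm x z.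
Proof. exact: (val_ge_trans ll). Qed.

Let eqm_sym x y : eqm x y -> eqm y x.
Proof. by rewrite (val_ge_sym ll). Qed.

Let OK0 x : OE K x -> val_ge vL 0 x.
Proof. by move=> /(OE_val_ge hL)[]. Qed.

Let eqm_ge0 x y : eqm x y -> val_ge vL 0 x = val_ge vL 0 y.
Proof. by move=> h; apply: (val_ge_eqr ll); apply: val_ge_le h; lia. Qed.

Let lamO x : OE E x -> OE K (lam x).
Proof. by case: hc => _ _ [h _] _ _; apply: h. Qed.

Let lam_eqm x y : OE E x -> OE E y -> val_ge vF M (x - y) = eqm (lam x) (lam y).
Proof.
move=> Ox Oy; case: hc => _ _ [_ [h _]] _ _; have {}h := h x y Ox Oy.
apply/idP/idP => xy.
  have /h/(PE_val_ge hL)[] // : PE E m (x - y).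
  by apply/(PE_val_ge hF); split=> //; apply: OE_sub.
have /h/(PE_val_ge hF)[] // : PE K m (lam x - lam y).
by apply/(PE_val_ge hL); split=> //; apply: OE_sub; apply: lamO.
Qed.

Let lam_surj y : OE K y -> exists2 x, OE E x & eqm (lam x) y.
Proof.
move=> Oy; case: hc => _ _ [_ [_ [h _]]] _ _; have [x Ox /(PE_val_ge hL)[_ xy]] := h y Oy.
by exists x.
Qed.

Let lam1 : eqm (lam 1) 1.
Proof. by case: hc => _ _ [_ [_ [_ [/(PE_val_ge hL)[] //]]]]. Qed.

Let lamD x y : OE E x -> OE E y -> eqm (lam (x + y)) (lam x + lam y).
Proof.
move=> Ox Oy; case: hc => _ _ [_ [_ [_ [_ [h _]]]]] _ _.
by have /(PE_val_ge hL)[] := h x y Ox Oy.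
Qed.

Let lamM x y : OE E x -> OE E y -> eqm (lam (x * y)) (lam x * lam y).
Proof.
move=> Ox Oy; case: hc => _ _ [_ [_ [_ [_ [_ h]]]]] _ _.
by have /(PE_val_ge hL)[] := h x y Ox Oy.
Qed.

Let lam_alg a : OF a -> eqm (lam a%:A) (lamFL a)%:A.
Proof. by move=> Oa; case: hc => _ _ _ /(_ a Oa) /(PE_val_ge hL)[]. Qed.

Let lam0 : val_ge vL M (lam 0).
Proof.
have := lamD (OE_0 hF SF) (OE_0 hF SF); rewrite addr0 opprD addrA subrr sub0r.
by rewrite (val_geN ll).
Qed.

Let lamX x k : OE E x -> eqm (lam (x ^+ k)) (lam x ^+ k).
Proof.
move=> Ox; elim: k => [|k IHk]; first exact: lam1.
rewrite !exprS; apply: eqm_trans (lamM Ox (OE_X hF k Ox)) _.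
have Olx := lamO Ox.
apply: eqmM => //; [exact: OK0 | exact: (OK0 (OE_X hL k Olx)) | by rewrite subrr val_ge0].
Qed.

Let lam_pi x : OE E x -> eqm (lam (cd_pi SF *: x)) (cd_pi SL *: lam x).
Proof.
move=> Ox; rewrite -[cd_pi SF *: x]mulr_algl -[cd_pi SL *: _]mulr_algl.
have OpF : OF (cd_pi SF) by apply/orP; right; rewrite cd_pi_val.
have OpL : OF (cd_pi SL) by apply/orP; right; rewrite cd_pi_val.
apply: eqm_trans (lamM (OE_alg hF SF OpF) Ox) _.
apply: eqmM; [exact/OK0/lamO/OE_alg | exact/OK0/lamO | | by rewrite subrr val_ge0].
apply: eqm_trans (lam_alg OpF) _; rewrite -scalerBl.
by case: hc => _ /(PF_val_ge SL) h _ _ _; apply: (dval_ge_alg hL SL).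
Qed.

Let lam_piX k x : OE E x -> eqm (lam (cd_pi SF ^+ k *: x)) (cd_pi SL ^+ k *: lam x).
Proof.
move=> Ox; elim: k => [|k IHk]; first by rewrite !expr0 !scale1r subrr val_ge0.
have Ok : OE E (cd_pi SF ^+ k *: x).
  by elim: (k) => [|j IHj]; rewrite ?expr0 ?scale1r // exprS -scalerA; apply: OE_pi.
rewrite !exprS -!scalerA; apply: eqm_trans (lam_pi Ok) _.
rewrite -scalerBr; have := val_ge_piZ hL SL IHk; apply: val_ge_le; lia.
Qed.

(** Multiplication by pi^(m - j) turns a congruence modulo P^j into one modulo P^m, to which the
    injectivity of the given isomorphism applies. *)
Let lam_val_ge x y (j : nat) : (j <= m)%N -> OE E x -> OE E y ->
  val_ge vF (d%:Z * j%:Z) (x - y) = val_ge vL (d%:Z * j%:Z) (lam x - lam y).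
Proof.
move=> jm Ox Oy; have Mj : M = d%:Z * (m - j)%N%:Z + d%:Z * j%:Z by nia.
rewrite -(val_ge_piZE hF SF _ (m - j)) -(val_ge_piZE hL SL _ (m - j)) -Mj !scalerBr.
have Ok z : OE E z -> OE E (cd_pi SF ^+ (m - j) *: z).
  move=> Oz; elim: (m - j)%N => [|k IHk]; rewrite ?expr0 ?scale1r // exprS -scalerA; exact: OE_pi.
rewrite (lam_eqm (Ok _ Ox) (Ok _ Oy)).
have ex := lam_piX (m - j) Ox; have ey := lam_piX (m - j) Oy.
apply/idP/idP => h.
  by apply: eqm_trans (eqm_sym ex) _; apply: eqm_trans h _.
by apply: eqm_trans ex _; apply: eqm_trans h _; apply: eqm_sym.

Qed.

(** The isomorphism modulo P_F^m, with m > 0, induces one of residue fields; congruences modulo P_F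
    are tested inside E, where [lam_val_ge] is available. *)
Let residue_card_eq q q' : residue_card F q -> residue_card L q' -> q = q'.
Proof.
move=> [s [<- us sO sP]] [s' [<- us' sO' sP']].
have lamF1 a b : OF a -> OF b -> val_ge (@lfval F) 1 (a - b) = val_ge (@lfval L) 1 (lamFL a - lamFL b).
  move=> Oa Ob.
  have algE (F' : localFieldType) (D' : falgType F') (h' : central_division_algebra D' d)
     (S' : cyclic_datum D' d) (c : F') : val_ge (@lfval F') 1 c = val_ge (@dval F' D' d) (d%:Z * 1%:Z) c%:A.
    case: (eqVneq c 0) => [->|c0]; first by rewrite scale0r !val_ge0.
    by rewrite !val_ge_neq0 ?scaler_eq0 ?oner_eq0 ?orbF // (dval_alg h' S') // ler_pM2l //; lia.
  rewrite (algE _ _ hF SF) (algE _ _ hL SL) !scalerBl (lam_val_ge m0 (OE_alg hF SF Oa) (OE_alg hF SF Ob)).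
  have t c : OF c -> val_ge vL (d%:Z * 1%:Z) (lam c%:A - (lamFL c)%:A).
    by move=> /lam_alg; apply: val_ge_le; nia.
  apply/idP/idP => h.
    by apply: (val_ge_trans ll) (t b Ob); apply: (val_ge_trans ll) h; rewrite (val_ge_sym ll) t.
  by apply: (val_ge_trans ll) (t a Oa) _; apply: (val_ge_trans ll) h _; rewrite (val_ge_sym ll) t.
have lO : forall a, OF a -> OF (lamFL a) by case: hc => -[h _] _ _ _ _.
have PFE := PF_val_ge SF; have PFE' := PF_val_ge SL.
have ffl := lfval_valuation F; have lfl := lfval_valuation L.
apply/eqP; rewrite eqn_leq; apply/andP; split.
  apply: (uniq_rel_leq (r := fun x y => val_ge (@lfval L) 1 (lamFL x - y))) => //.
    by move=> x xs; have [|y [[ys /PFE' xy] _]] := sP' (lamFL x); [exact/lO/sO | exists y].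
  move=> x1 x2 y x1s x2s h1 h2.
  have x12 : val_ge (@lfval F) 1 (x1 - x2).
    by rewrite (lamF1 _ _ (sO _ x1s) (sO _ x2s)); apply: (val_ge_trans lfl) h1 _; rewrite (val_ge_sym lfl).
  have [t [_ tu]] := sP x1 (sO _ x1s).
  transitivity t; [apply/esym|]; apply: tu; split=> //; apply/PFE => //.
  by rewrite subrr val_ge0.
apply: (uniq_rel_leq (r := fun y x => exists z, [/\ OF z, val_ge (@lfval L) 1 (lamFL z - y) & val_ge (@lfval F) 1 (z - x)])) => //.
  move=> y ys; have [z Oz /PFE' zy] : exists2 z, OF z & PF m (lamFL z - y).
    by case: hc => -[_ [_ [h _]]] _ _ _ _; apply: h; apply: sO'.
  have [x [[xs /PFE zx] _]] := sP z Oz; exists x => //; exists z; split=> //.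
  by apply: val_ge_le zy; lia.
move=> y1 y2 x y1s y2s [z1 [Oz1 zy1 zx1]] [z2 [Oz2 zy2 zx2]].
have z12 : val_ge (@lfval F) 1 (z1 - z2).
  by apply: (val_ge_trans ffl) zx1 _; rewrite (val_ge_sym ffl).
have y12 : val_ge (@lfval L) 1 (y1 - y2).
  apply: (val_ge_trans lfl) zy2; rewrite lamF1 // in z12.
  by apply: (val_ge_trans lfl) z12; rewrite (val_ge_sym lfl).
have [t [_ tu]] := sP' y1 (sO' _ y1s).
transitivity t; [apply/esym|]; apply: tu; split=> //; apply/PFE' => //.
by rewrite subrr val_ge0.
Qed.

(* Both lam o phiE and phiK o lam raise a q^m-th power y^(q^m) to its q-th power
   modulo P_K^m; every element is such a power up to a multiple of pi. *)
Let lam_frobenius phiE phiK : frobenius E phiE -> frobenius K phiK ->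
  forall x, OE E x -> eqm (lam (phiE x)) (phiK (lam x)).
Proof.
move=> fE fK.
have [gE [q [qF qE]]] := fE; have [gK [q' [qL qK]]] := fK.
have qq := residue_card_eq qF qL; subst q'.
have {}qE x : OE E x -> val_ge vF d (phiE x - x ^+ q).
  by move=> /qE/(PE_val_ge hF)[_]; rewrite mulr1.
have {}qK x : OE K x -> val_ge vL d (phiK x - x ^+ q).
  by move=> /qK/(PE_val_ge hL)[_]; rewrite mulr1.
have phiK_eqm x y : OE K x -> OE K y -> eqm x y -> eqm (phiK x) (phiK y).
  by move=> Ox Oy xy; rewrite -linearB; apply: (gal_val_ge hL gK) => //; apply: OE_sub.
have pow y : OE E y -> eqm (lam (phiE (y ^+ (q ^ m)))) (phiK (lam (y ^+ (q ^ m)))).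
  move=> Oy; set t := y ^+ (q ^ m); have Oly := lamO Oy.
  have h1 : eqm (lam (phiE t)) (lam (y ^+ (q ^ m.+1))).
    rewrite -lam_eqm; last exact: OE_X.
      rewrite (galX hF _ gE); last by have [] := Oy.
      rewrite expnS exprM.
      have := OE_expr_congr_iter hF m qF (gal_OE hF gE Oy) (OE_X hF q Oy) (qE _ Oy).
      by apply: val_ge_le; nia.
    by apply: gal_OE => //; apply: OE_X.
  have h2 : eqm (phiK (lam t)) (phiK (lam y ^+ (q ^ m))).
    by apply: phiK_eqm; [exact/lamO/OE_X | exact: OE_X | exact: lamX].
  have h3 : eqm (phiK (lam y ^+ (q ^ m))) (lam y ^+ (q ^ m.+1)).
    rewrite (galX hL _ gK); last by have [] := Oly.
    rewrite expnS exprM.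
    have := OE_expr_congr_iter hL m qL (gal_OE hL gK Oly) (OE_X hL q Oly) (qK _ Oly).
    by apply: val_ge_le; nia.
  apply: eqm_trans h1 _; apply: eqm_trans (lamX _ Oy) _.
  by apply: eqm_sym; apply: eqm_trans h2 h3.
(* Induction on the precision: x = t + pi x1 with t a q^m-th power, and an error modulo P^j at x1
   becomes one modulo P^(j + 1) at pi x1. *)
suff : forall j : nat, (j <= m)%N -> forall x, OE E x ->
    val_ge vL (d%:Z * j%:Z) (lam (phiE x) - phiK (lam x)) by apply.
elim=> [|j IHj] jm x Ox.
  have h1 := OK0 (lamO (gal_OE hF gE Ox)); have h2 := OK0 (gal_OE hL gK (lamO Ox)).
  by rewrite mulr0; apply: (val_geB ll).
have [y Oy xy] := frobenius_power_rep hF m fE qF qE Ox.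
set t := y ^+ (q ^ m) in xy; have Ot : OE E t by exact: OE_X.
have [x1 Ox1 xt] := OE_div_pi hF (OE_sub Ox Ot) xy.
have xE : x = t + cd_pi SF *: x1 by rewrite -xt addrC subrK.
have Op1 : OE E (cd_pi SF *: x1) by exact: OE_pi.
have lx : eqm (lam x) (lam t + cd_pi SL *: lam x1).
  rewrite xE; apply: eqm_trans (lamD Ot Op1) _.
  by apply: eqmD (lam_pi Ox1); rewrite subrr val_ge0.
have Ox1' := gal_OE hF gE Ox1.
have lpx : eqm (lam (phiE x)) (lam (phiE t) + cd_pi SL *: lam (phiE x1)).
  rewrite xE linearD linearZ; apply: eqm_trans (lamD (gal_OE hF gE Ot) (OE_pi hF Ox1')) _.
  by apply: eqmD (lam_pi Ox1'); rewrite subrr val_ge0.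
have Olt := lamO Ot; have Olx1 := lamO Ox1.
have plx : eqm (phiK (lam x)) (phiK (lam t) + cd_pi SL *: phiK (lam x1)).
  have -> : phiK (lam t) + cd_pi SL *: phiK (lam x1) = phiK (lam t + cd_pi SL *: lam x1).
    by rewrite linearD linearZ.
  by apply: phiK_eqm => //; [exact: lamO | apply: OE_D => //; apply: OE_pi].
have le_M a : eqm a 0 -> val_ge vL (d%:Z * j.+1%:Z) a.
  by rewrite subr0; apply: val_ge_le; nia.
have leM a c : eqm a c -> val_ge vL (d%:Z * j.+1%:Z) (a - c).
  by apply: val_ge_le; nia.
apply: (val_ge_trans ll) (leM _ _ lpx) _.
rewrite (val_ge_sym ll); apply: (val_ge_trans ll) (leM _ _ plx) _; rewrite (val_ge_sym ll).
rewrite opprD addrACA; apply: (val_geD ll); first exact/leM/pow.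
rewrite -scalerBr; have := val_ge_piZ hL SL (IHj (ltnW jm) _ Ox1).
by apply: val_ge_le; lia.
Qed.

(** Both generators are the same power j of the respective Frobenius automorphisms. *)
Let lam_sigma x : OE E x -> eqm (lam (cd_sigma SF x)) (cd_sigma SL (lam x)).
Proof.
case: hc => _ _ _ _ [phiE [phiK [j [fE fK sE sK]]]] Ox.
have Olx := lamO Ox.
rewrite sE; last by have [] := Ox.
rewrite sK; last by have [] := Olx.
elim: j {sE sK} => [|j IHj] /=; first by rewrite subrr val_ge0.
have gE := proj1 fE; have gK := proj1 fK.
have Oj := gal_iter hF j gE Ox.
apply: eqm_trans (lam_frobenius fE fK Oj) _.
rewrite -linearB; apply: (gal_val_ge hL gK) => //.
by apply: OE_sub; [exact: lamO | exact: gal_iter].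
Qed.

Local Notation piF := (cd_piD SF).
Local Notation piL := (cd_piD SL).
Local Notation Rel := (class_corr SF SL lam (m * d)%N).

Let MN : (m * d)%N%:Z = M. Proof. by rewrite PoszM mulrC. Qed.

Let Rel_def x y : Rel x y <-> exists e : 'I_d -> DF, [/\ forall i, OE E (e i),
  x = \sum_(i < d) piF ^+ i * e i & eqm y (\sum_(i < d) piL ^+ i * lam (e i))].
Proof.
split=> -[e [Oe xe ye]]; exists e; split=> //.
  by rewrite -MN; apply/(PD_val_ge hL SL).
by apply/(PD_val_ge hL SL); rewrite MN.
Qed.

Let Rel_congr x y y' : Rel x y -> eqm y' y -> Rel x y'.
Proof.
move=> /Rel_def[e [Oe xe ye]] yy'; apply/Rel_def; exists e; split=> //.
exact: eqm_trans yy' ye.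
Qed.

Let piLX_ge0 i : val_ge vL 0 (piL ^+ i).
Proof. by apply: (val_geX ll); apply/orP; right; rewrite (dval_piD hL). Qed.

Let RelD x y x' y' : Rel x x' -> Rel y y' -> Rel (x + y) (x' + y').
Proof.
move=> /Rel_def[e [Oe xe ye]] /Rel_def[f [Of xf yf]]; apply/Rel_def.
exists (fun i => e i + f i); split=> [i||]; first exact: OE_D.
  by rewrite xe xf -big_split; apply: eq_bigr => i _; rewrite mulrDr.
apply: eqm_trans (eqmD ye yf) _; rewrite -big_split -sumrB; apply: (val_ge_sum ll) => i _.
rewrite /= -mulrDr -mulrBr; apply: (val_ge0M ll) => //; apply: eqm_sym; exact: lamD.
Qed.

Let Rel0 : Rel 0 0.
Proof.
apply/Rel_def; exists (fun=> 0); split=> [i||]; first exact: OE_0.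
  by rewrite big1 // => i _; rewrite mulr0.
by rewrite sub0r (val_geN ll); apply: (val_ge_sum ll) => i _; apply: (val_ge0M ll).
Qed.

Let Rel_sum (I : Type) (r : seq I) (f : I -> DF) (g : I -> DL) :
  (forall i, Rel (f i) (g i)) -> Rel (\sum_(i <- r) f i) (\sum_(i <- r) g i).
Proof.
by move=> h; elim: r => [|i r IHr]; rewrite ?big_nil ?big_cons //; apply: RelD.
Qed.

(** For k < d this is the definition of the relation. Otherwise pi_D^d = pi_F is absorbed into the
    coefficient, and [lam] commutes with pi_F modulo P^m. *)
Let Rel_monomial k x : OE E x -> Rel (piF ^+ k * x) (piL ^+ k * lam x).
Proof.
elim/ltn_ind: k x => k IHk x Ox.
case: (ltnP k d) => [kd|dk].
  apply/Rel_def; exists (fun i => if i == k :> nat then x else 0); split=> [i||].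
  - by case: eqP => // _; apply: OE_0.
  - rewrite (bigD1 (Ordinal kd)) //= eqxx big1 ?addr0 // => i ik.
    by rewrite ifN ?mulr0.
  rewrite (bigD1 (Ordinal kd)) //= eqxx opprD addrA subrr sub0r (val_geN ll).
  apply: (val_ge_sum ll) => i ik; rewrite ifN //; exact: (val_ge0M ll).
have kE : k = ((k - d) + d)%N by lia.
rewrite kE !exprD (cd_piD_pow SF) (cd_piD_pow SL) -!mulrA !mulr_algl.
apply: (Rel_congr (IHk (k - d)%N _ (cd_pi SF *: x) _)); [by lia | exact: OE_pi |].
rewrite -mulrBr; apply: (val_ge0M ll) => //; apply: eqm_sym; exact: lam_pi.
Qed.

Let cd_conjX (F' : localFieldType) (D' : falgType F') (h' : central_division_algebra D' d)
  (S' : cyclic_datum D' d) e k : e \in cd_E S' ->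
  e * cd_piD S' ^+ k = cd_piD S' ^+ k * iter k (cd_sigma S') e.
Proof.
have [gS _] := cd_generator S'.
elim: k e => [|k IHk] e Ee; first by rewrite !expr0 mulr1 mul1r.
have p0 : cd_piD S' \is a GRing.unit by rewrite (cda_unit h') // (cd_piD_neq0 h').
have -> : e * cd_piD S' ^+ k.+1 = cd_piD S' * (cd_sigma S' e * cd_piD S' ^+ k).
  by rewrite -(cd_conj Ee) !mulrA mulrV // mul1r exprS !mulrA.
by rewrite IHk ?gal_mem // mulrA -exprS -iterSr.
Qed.

Let lam_sigma_iter k x : OE E x -> eqm (lam (iter k (cd_sigma SF) x)) (iter k (cd_sigma SL) (lam x)).
Proof.
have [gE _] := cd_generator SF; have [gK _] := cd_generator SL.
move=> Ox; elim: k => [|k IHk] /=; first by rewrite subrr val_ge0.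
have Ok := gal_iter hF k gE Ox; apply: eqm_trans (lam_sigma Ok) _.
rewrite -linearB; apply: (gal_val_ge hL gK) => //.
by apply: OE_sub; [exact: lamO | apply: gal_iter => //; apply: lamO].
Qed.

(** On monomials, pi^i e pi^j f = pi^(i + j) sigma^j(e) f, so that multiplicativity amounts to the
    compatibility with sigma; exponents i + j >= d are settled by [Rel_monomial]. *)
Let RelM x y x' y' : Rel x x' -> Rel y y' -> Rel (x * y) (x' * y').
Proof.
move=> /Rel_def[e [Oe xe ye]] /Rel_def[f [Of xf yf]].
have ge0_sum (g : 'I_d -> DF) : (forall i, OE E (g i)) -> val_ge vL 0 (\sum_(i < d) piL ^+ i * lam (g i)).
  by move=> Og; apply: (val_ge_sum ll) => i _; apply: (val_ge0M ll) => //; apply/OK0/lamO.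
have x'0 : val_ge vL 0 x' by rewrite (eqm_ge0 ye) ge0_sum.
apply: Rel_congr (eqmM x'0 (ge0_sum f Of) ye yf).
rewrite xe xf !mulr_suml; apply: Rel_sum => i; rewrite !mulr_sumr; apply: Rel_sum => j.
have [gE _] := cd_generator SF; have [gK _] := cd_generator SL.
have [Ei _] := Oe i; have Olei := lamO (Oe i); have [Eli _] := Olei.
have -> : piF ^+ i * e i * (piF ^+ j * f j) =
    piF ^+ (i + j) * (iter j (cd_sigma SF) (e i) * f j).
  by rewrite -mulrA (mulrA (e i)) (cd_conjX hF) // exprD !mulrA.
have -> : piL ^+ i * lam (e i) * (piL ^+ j * lam (f j)) =
    piL ^+ (i + j) * (iter j (cd_sigma SL) (lam (e i)) * lam (f j)).
  by rewrite -mulrA (mulrA (lam (e i))) (cd_conjX hL) // exprD !mulrA.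
have Oi := gal_iter hF j gE (Oe i).
have Oli := gal_iter hL j gK Olei.
apply: Rel_congr (Rel_monomial (i + j) (OE_M hF Oi (Of j))) _.
rewrite -mulrBr; apply: (val_ge0M ll) => //; apply: eqm_sym.
apply: eqm_trans (lamM Oi (Of j)) _; apply: eqmM; [exact/OK0/lamO | exact/OK0/lamO | exact: lam_sigma_iter |].
by rewrite subrr val_ge0.
Qed.

Lemma class_corr_truncated_iso : truncated_iso vF vL piF piL (m * d) Rel.
Proof.
split.
- move=> x y /Rel_def[e [Oe -> _]]; apply: (val_ge_sum ff) => i _.
  apply: (val_ge0M ff); last by have /(OE_val_ge hF)[] := Oe i.
  by apply: (val_geX ff); apply/orP; right; rewrite (dval_piD hF).
- move=> x y /Rel_def[e [Oe _ /eqm_ge0 ->]]; apply: (val_ge_sum ll) => i _.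
  by apply: (val_ge0M ll) => //; apply/OK0/lamO.
- move=> x /(OD_expansion hF SF)[e [Oe xe]].
  by exists (\sum_(i < d) piL ^+ i * lam (e i)); apply/Rel_def; exists e; rewrite subrr val_ge0.
- move=> y /(OD_expansion hL SL)[f [Of yf]].
  have /choice[e eP] (i : 'I_d) : exists e, OE E e /\ eqm (lam e) (f i).
    by have [e] := lam_surj (Of i); exists e.
  exists (\sum_(i < d) piF ^+ i * e i); apply/Rel_def; exists e; split=> // [i|].
    by have [] := eP i.
  rewrite yf -sumrB; apply: (val_ge_sum ll) => i _; rewrite -mulrBr.
  by apply: (val_ge0M ll) => //; apply: eqm_sym; have [] := eP i.
- exact: RelD.
- exact: RelM.
- have := Rel_monomial 0 (OE_1 hF SF); rewrite !expr0 !mul1r => /Rel_congr; apply.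
  exact: eqm_sym.
- have := Rel_monomial 1 (OE_1 hF SF); rewrite !expr1 mulr1 => /Rel_congr; apply.
  rewrite -[X in X - _]mulr1 -mulrBr; apply: (val_ge0M ll); first exact: (piLX_ge0 1).
  exact: eqm_sym.
- move=> x y /Rel_def[e [Oe xe ye]]; apply/Rel_def.
  have [gE _] := cd_generator SF; have [gK _] := cd_generator SL.
  have conjE (F' : localFieldType) (D' : falgType F') (h' : central_division_algebra D' d)
      (S' : cyclic_datum D' d) (f : 'I_d -> D') : (forall i, f i \in cd_E S') ->
      (cd_piD S')^-1 * (\sum_(i < d) cd_piD S' ^+ i * f i) * cd_piD S' =
      \sum_(i < d) cd_piD S' ^+ i * cd_sigma S' (f i).
    have p0 : cd_piD S' \is a GRing.unit by rewrite (cda_unit h') // (cd_piD_neq0 h').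
    move=> Ef; rewrite mulr_sumr mulr_suml; apply: eq_bigr => i _.
    have -> : (cd_piD S')^-1 * (cd_piD S' ^+ i * f i) = cd_piD S' ^+ i * ((cd_piD S')^-1 * f i).
      have pe : cd_piD S' ^+ i * (cd_piD S')^-1 = (cd_piD S')^-1 * cd_piD S' ^+ i.
        exact: (commrV (commr_sym (commrX i (commr_refl (cd_piD S'))))).
      by rewrite !mulrA pe.
    by rewrite -mulrA (cd_conj (Ef i)).
  exists (fun i => cd_sigma SF (e i)); split.
  - by move=> i; apply: gal_OE.
  - by rewrite xe (conjE _ _ hF) // => i; have [] := Oe i.
  have Ole i : lam (e i) \in K by have [] := lamO (Oe i).
  have y1 : eqm (piL^-1 * y * piL) (\sum_(i < d) piL ^+ i * cd_sigma SL (lam (e i))).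
    have pL0 : piL != 0 by exact: (cd_piD_neq0 hL).
    rewrite -(conjE _ _ hL) // -mulrBl -mulrBr (val_geMr ll) // (val_geMl ll) ?invr_eq0 //.
    by rewrite (valuationV ll) // opprK subrK.
  apply: eqm_trans y1 _; rewrite -sumrB; apply: (val_ge_sum ll) => i _; rewrite -mulrBr.
  by apply: (val_ge0M ll) => //; apply: eqm_sym; apply: lam_sigma.
(* Divisibility by P^M is tested on the coefficients, since M = d m is a multiple of d. *)
- move=> x y /Rel_def[e [Oe xe ye]]; rewrite MN (val_ge_eqr ll ye) xe.
  have [OeF OeL] : (forall i, e i \in E) /\ (forall i, lam (e i) \in K).
    by split=> i; [have [] := Oe i | have [] := lamO (Oe i)].
  have lam_M i : val_ge vF M (e i) = val_ge vL M (lam (e i)).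
    by rewrite -[e i in LHS]subr0 (lam_eqm (Oe i) (OE_0 hF SF)) addrC (val_geDl ll) ?(val_geN ll).
  apply/idP/idP => h; [apply: (val_ge_sum ll) => i _ | apply: (val_ge_sum ff) => i _].
    rewrite (cyclic_term_val_ge hL _ i (OeL i)) -lam_M -(cyclic_term_val_ge hF _ i (OeF i)).
    exact: (cyclic_terms_val_ge hF).
  rewrite (cyclic_term_val_ge hF _ i (OeF i)) lam_M -(cyclic_term_val_ge hL _ i (OeL i)).
  exact: (cyclic_terms_val_ge hL (e := fun i => lam (e i))).
- by move=> x y y' xy; rewrite MN; apply: Rel_congr.
Qed.

End ClassCorrespondence.

(** * Matrices over a valued division ring *)

Section ValuedMatrices.
Variables (D : unitRingType) (v : D -> int) (p : D).
Hypotheses (Hv : is_valuation v) (p0 : p != 0) (vp : v p = 1).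

Definition mx_ge (k : int) m n (X : 'M[D]_(m, n)) := forall i j, val_ge v k (X i j).

Lemma mx_geD k m n (X Y : 'M[D]_(m, n)) : mx_ge k X -> mx_ge k Y -> mx_ge k (X + Y).
Proof. by move=> Xk Yk i j; rewrite mxE; apply: (val_geD Hv). Qed.

Lemma mx_geN k m n (X : 'M[D]_(m, n)) : mx_ge k X -> mx_ge k (- X).
Proof. by move=> Xk i j; rewrite mxE (val_geN Hv). Qed.

Lemma mx_geB k m n (X Y : 'M[D]_(m, n)) : mx_ge k X -> mx_ge k Y -> mx_ge k (X - Y).
Proof. by move=> Xk Yk; apply: mx_geD => //; apply: mx_geN. Qed.

Lemma mx_ge_le k j m n (X : 'M[D]_(m, n)) : j <= k -> mx_ge k X -> mx_ge j X.
Proof. by move=> jk Xk i i'; apply: val_ge_le (Xk i i'). Qed.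

Lemma mx_geM k j m n q (X : 'M[D]_(m, n)) (Y : 'M[D]_(n, q)) :
  mx_ge k X -> mx_ge j Y -> mx_ge (k + j) (X *m Y).
Proof.
by move=> Xk Yj i i'; rewrite mxE; apply: (val_ge_sum Hv) => t _; apply: (val_geM Hv).
Qed.

Lemma mx_ge0M k m n q (X : 'M[D]_(m, n)) (Y : 'M[D]_(n, q)) :
  mx_ge 0 X -> mx_ge k Y -> mx_ge k (X *m Y).
Proof. by rewrite -[X in mx_ge X (_ *m _)]add0r; apply: mx_geM. Qed.

Lemma mx_geM0 k m n q (X : 'M[D]_(m, n)) (Y : 'M[D]_(n, q)) :
  mx_ge k X -> mx_ge 0 Y -> mx_ge k (X *m Y).
Proof. by rewrite -[X in mx_ge X (_ *m _)]addr0; apply: mx_geM. Qed.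

Lemma mx_ge0 k m n : mx_ge k (0 : 'M[D]_(m, n)).
Proof. by move=> i j; rewrite mxE val_ge0. Qed.

Lemma mx_ge1 k n : k <= 0 -> mx_ge k (1%:M : 'M[D]_n).
Proof. by move=> k0 i j; rewrite mxE; case: eqP; rewrite ?val_ge0 ?(val_ge1 Hv). Qed.

Lemma mx_ge_block k m n (A : 'M[D]_m) (B : 'M[D]_(m, n)) (C : 'M[D]_(n, m)) (E : 'M[D]_n) :
  mx_ge k A -> mx_ge k B -> mx_ge k C -> mx_ge k E -> mx_ge k (block_mx A B C E).
Proof.
move=> Ak Bk Ck Ek i j; rewrite -(splitK i) -(splitK j).
by case: (fintype.split i) => i'; case: (fintype.split j) => j' /=;
  rewrite ?(block_mxEul, block_mxEur, block_mxEdl, block_mxEdr).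
Qed.

Lemma mx_ge_bound m n (X : 'M[D]_(m, n)) : exists k : nat, mx_ge (- k%:Z) X.
Proof.
clear Hv p0 vp.
exists (\sum_i \sum_j `|v (X i j)|)%N => i j; apply/orP; right.
by rewrite (bigD1 i) //= (bigD1 j) //=; lia.
Qed.

Definition invertible n (X : 'M[D]_n) := exists Y, X *m Y = 1%:M /\ Y *m X = 1%:M.

(** Membership in GL_n(O). Over the noncommutative D there is no determinant to decide it, hence
    explicit two-sided inverses here and in [invertible]. *)
Definition unimodular n (X : 'M[D]_n) :=
  exists Y, [/\ X *m Y = 1%:M, Y *m X = 1%:M, mx_ge 0 X & mx_ge 0 Y].

Lemma unimodularM n (X Y : 'M[D]_n) : unimodular X -> unimodular Y -> unimodular (X *m Y).
Proof.
move=> [X' [XX' X'X X0 X'0]] [Y' [YY' Y'Y Y0 Y'0]]; exists (Y' *m X'); split.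
- by rewrite mulmxA -(mulmxA X) YY' mulmx1.
- by rewrite mulmxA -(mulmxA Y') X'X mulmx1.
- exact: mx_ge0M.
- exact: mx_ge0M.
Qed.

Lemma invertibleM n (X Y : 'M[D]_n) : invertible X -> invertible Y -> invertible (X *m Y).
Proof.
move=> [X' [XX' X'X]] [Y' [YY' Y'Y]]; exists (Y' *m X'); split.
  by rewrite mulmxA -(mulmxA X) YY' mulmx1.
by rewrite mulmxA -(mulmxA Y') X'X mulmx1.
Qed.

Lemma unimodular_invertible n (X : 'M[D]_n) : unimodular X -> invertible X.
Proof. by move=> [Y [? ? _ _]]; exists Y. Qed.

Lemma unimodular_lower m n (C : 'M[D]_(n, m)) : mx_ge 0 C ->
  unimodular (block_mx 1%:M 0 C 1%:M).
Proof.
move=> C0; exists (block_mx 1%:M 0 (- C) 1%:M); split.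
- by rewrite mulmx_block !mul1mx !mulmx1 !mul0mx !mulmx0 !addr0 !add0r addrN -scalar_mx_block.
- by rewrite mulmx_block !mul1mx !mulmx1 !mul0mx !mulmx0 !addr0 !add0r addNr -scalar_mx_block.
- by apply: mx_ge_block => //; [exact: mx_ge1 | exact: mx_ge0 | exact: mx_ge1].
- by apply: mx_ge_block => //; [exact: mx_ge1 | exact: mx_ge0 | exact: mx_geN | exact: mx_ge1].
Qed.

Lemma unimodular_upper m n (C : 'M[D]_(m, n)) : mx_ge 0 C ->
  unimodular (block_mx 1%:M C 0 1%:M).
Proof.
move=> C0; exists (block_mx 1%:M (- C) 0 1%:M); split.
- by rewrite mulmx_block !mul1mx !mulmx1 !mul0mx !mulmx0 !addr0 !add0r addNr -scalar_mx_block.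
- by rewrite mulmx_block !mul1mx !mulmx1 !mul0mx !mulmx0 !addr0 !add0r addrN -scalar_mx_block.
- by apply: mx_ge_block => //; [exact: mx_ge1 | exact: mx_ge0 | exact: mx_ge1].
- by apply: mx_ge_block => //; [exact: mx_ge1 | exact: mx_geN | exact: mx_ge0 | exact: mx_ge1].
Qed.

Lemma unimodular_diag m n (A : 'M[D]_m) (B : 'M[D]_n) : unimodular A -> unimodular B ->
  unimodular (block_mx A 0 0 B).
Proof.
move=> [A' [AA' A'A A0 A'0]] [B' [BB' B'B B0 B'0]]; exists (block_mx A' 0 0 B'); split.
- by rewrite mulmx_block !mul0mx !mulmx0 !addr0 !add0r AA' BB' -scalar_mx_block.
- by rewrite mulmx_block !mul0mx !mulmx0 !addr0 !add0r A'A B'B -scalar_mx_block.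
- by apply: mx_ge_block => //; apply: mx_ge0.
- by apply: mx_ge_block => //; apply: mx_ge0.
Qed.

Lemma invertible_diag m n (A : 'M[D]_m) (B : 'M[D]_n) : invertible A -> invertible B ->
  invertible (block_mx A 0 0 B).
Proof.
move=> [A' [AA' A'A]] [B' [BB' B'B]]; exists (block_mx A' 0 0 B'); split.
  by rewrite mulmx_block !mul0mx !mulmx0 !addr0 !add0r AA' BB' -scalar_mx_block.
by rewrite mulmx_block !mul0mx !mulmx0 !addr0 !add0r A'A B'B -scalar_mx_block.
Qed.

Lemma invertible_dr m n (A : 'M[D]_m) (B : 'M[D]_n) :
  invertible (block_mx A 0 0 B) -> invertible B.
Proof.
move=> [Y [AY YA]]; exists (drsubmx Y); split.
  move: AY; rewrite -{1}[Y]submxK mulmx_block (scalar_mx_block m n) => /eq_block_mx[_ _ _].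
  by rewrite mul0mx add0r.
move: YA; rewrite -{1}[Y]submxK mulmx_block (scalar_mx_block m n) => /eq_block_mx[_ _ _].
by rewrite mulmx0 add0r.
Qed.

Lemma schur_factorization n (x : D) (y : 'M[D]_(1, n)) (z : 'M[D]_(n, 1)) (w : 'M[D]_n) : x != 0 ->
  block_mx x%:M y z w = block_mx 1%:M 0 (z *m x^-1%:M) 1%:M *m
    block_mx x%:M 0 0 (w - z *m x^-1%:M *m y) *m block_mx 1%:M (x^-1%:M *m y) 0 1%:M.
Proof.
move=> x0; rewrite !mulmx_block !mul1mx !mulmx1 !mul0mx !mulmx0 !addr0 !add0r.
congr block_mx.
- by rewrite mulmxA -scalar_mxM (vdiv_mulfV Hv) // mul1mx.
- by rewrite -mulmxA -scalar_mxM (vdiv_mulVf Hv) // mulmx1.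
- by rewrite -(mulmxA z) -scalar_mxM (vdiv_mulVf Hv) // mulmx1 mulmxA addrC subrK.
Qed.

Lemma mx_ge_scalar k n (x : D) : val_ge v k x -> mx_ge k (x%:M : 'M[D]_n).
Proof. by move=> xk i j; rewrite mxE; case: eqP; rewrite ?val_ge0. Qed.

Lemma mx_ge_sub k m m' n n' (X : 'M[D]_(m + m', n + n')) : mx_ge k X ->
  [/\ mx_ge k (ulsubmx X), mx_ge k (ursubmx X), mx_ge k (dlsubmx X) & mx_ge k (drsubmx X)].
Proof. by move=> Xk; split=> i j; rewrite !mxE. Qed.

(** Elimination in place of a geometric series: the pivot is congruent to 1, hence a unit, and the
    Schur complement w - z x^-1 y is again congruent to 1. *)
Lemma invertible_congr1 n (X : 'M[D]_n) : mx_ge 1 (X - 1%:M) -> invertible X.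
Proof.
clear p0 vp; elim: n X => [|n IHn] X X1.
  by exists 0; split; apply/matrixP => -[].
have {X1} : mx_ge 1 ((X : 'M[D]_(1 + n)) - (1%:M : 'M[D]_(1 + n))) by [].
rewrite -(submxK (X : 'M[D]_(1 + n))) (scalar_mx_block 1 n) opp_block_mx add_block_mx.
rewrite !oppr0 !addr0 => /mx_ge_sub; rewrite block_mxKul block_mxKur block_mxKdl block_mxKdr.
set A := ulsubmx _; set y := ursubmx _; set z := dlsubmx _; set w := drsubmx _.
rewrite [A]mx11_scalar; set x := A 0 0 => -[x1 y1 z1 w1].
have {}x1 : val_ge v 1 (x - 1) by have := x1 0 0; rewrite !mxE eqxx.
have x0 : x != 0.
  by apply: contraTneq x1 => ->; rewrite sub0r (val_geN Hv) (val_ge1 Hv).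
have vx : val_ge v 0 x^-1.
  rewrite val_ge_neq0 ?invr_eq0 // (valuationV Hv) //.
  have := val_ge_eqr Hv x1; rewrite (val_ge1 Hv) val_ge_neq0 // => /negbT; lia.
have xV : mx_ge 0 (x^-1%:M : 'M[D]_1) by exact: mx_ge_scalar.
rewrite schur_factorization //.
apply: invertibleM; first apply: invertibleM.
- apply: unimodular_invertible; apply: (@unimodular_lower 1 n); apply: mx_geM0 => //.
  by apply: mx_ge_le z1.
- apply: (@invertible_diag 1 n).
    by exists (x^-1%:M); rewrite -!scalar_mxM (vdiv_mulfV Hv) // (vdiv_mulVf Hv).
  apply: IHn; rewrite addrAC; apply: mx_geB => //.
  by apply: mx_geM0; [exact: mx_geM0 | apply: mx_ge_le y1].
- apply: unimodular_invertible; apply: (@unimodular_upper 1 n); apply: mx_ge0M => //.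
  by apply: mx_ge_le y1.
Qed.

Lemma unimodular_tperm n (i j : 'I_n) : unimodular (tperm_mx i j).
Proof.
have tt : tperm_mx i j *m tperm_mx i j = 1%:M :> 'M[D]_n.
  by rewrite -xrowE; apply/matrixP => a b; rewrite !mxE perm.tpermK eq_sym.
have t0 : mx_ge 0 (tperm_mx i j : 'M[D]_n).
  by move=> a b; rewrite !mxE; case: (_ == _); rewrite ?val_ge0 ?(val_ge1 Hv).
by exists (tperm_mx i j).
Qed.

Definition pdiag n (a : 'I_n -> int) : 'M[D]_n := diag_mx (\row_i p ^ (a i)).

Lemma p_exprz_neq0 (z : int) : p ^ z != 0.
Proof. exact: (vdiv_exprz_neq0 Hv). Qed.

Lemma val_p_exprz (z : int) : v (p ^ z) = z.
Proof. by rewrite (valuationXz Hv) // vp mul1r. Qed.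

Lemma p_exprzD (y z : int) : p ^ (y + z) = p ^ y * p ^ z.
Proof. by rewrite exprzDr // (valuation_unit Hv). Qed.

(** An entry of least valuation is moved to the corner and serves as pivot, so that all quotients in
    the elimination are integral. The bound k is carried along to make the later exponents at least
    as large as the first. *)
Lemma smith_normal_form n (X : 'M[D]_n) k : invertible X -> mx_ge k X ->
  exists a B C, [/\ forall i j : 'I_n, (i <= j)%N -> a i <= a j, forall i, k <= a i,
    unimodular B, unimodular C & X = B *m pdiag a *m C].
Proof.
elim: n X k => [|n IHn] X k Xi Xk.
  exists (fun=> 0), X, 1%:M; split; try by case.
  - by exists 0; split; try (by apply/matrixP => -[]); case.
  - by exists 1%:M; rewrite mulmx1; split=> //; case.
  - by apply/matrixP => -[].
have [[i1 j1] /= X1] : exists ij : 'I_n.+1 * 'I_n.+1, X ij.1 ij.2 != 0.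
  apply: contrapT => no; have X0 : X = 0.
    apply/matrixP => i j; rewrite mxE; apply: contrapT => /eqP Xij.
    by apply: no; exists (i, j).
  have [Y [/matrixP/(_ 0 0)]] := Xi; rewrite X0 mul0mx !mxE eqxx => /esym/eqP.
  by rewrite oner_eq0.
case: (arg_minP (P := fun ij : 'I_n.+1 * 'I_n.+1 => X ij.1 ij.2 != 0)
  (fun ij => v (X ij.1 ij.2)) (X1 : X (i1, j1).1 (i1, j1).2 != 0)) => -[i0 j0] /= X0 Xmin.
pose X' : 'M[D]_(1 + n) := tperm_mx ord0 i0 *m X *m tperm_mx ord0 j0.
have XE : X = tperm_mx ord0 i0 *m X' *m tperm_mx ord0 j0.
  have tt i : tperm_mx ord0 i *m tperm_mx ord0 i = 1%:M :> 'M[D]_n.+1.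
    by rewrite -xrowE; apply/matrixP => a b; rewrite !mxE perm.tpermK eq_sym.
  by rewrite /X' !mulmxA tt mul1mx -mulmxA tt mulmx1.
have X'00 : X' 0 0 = X i0 j0.
  by rewrite /X' -xrowE -xcolE !mxE !perm.tpermL.
set x := X i0 j0 in X0 Xmin X'00.
have Xvx : mx_ge (v x) X.
  move=> i j; case: (eqVneq (X i j) 0) => [->|Xij]; first exact: val_ge0.
  by rewrite val_ge_neq0 //; apply: (Xmin (i, j)).
have [T1 [_ _ T10 _]] := unimodular_tperm ord0 i0.
have [T2 [_ _ T20 _]] := unimodular_tperm ord0 j0.
have X'vx : mx_ge (v x) X' by apply: mx_geM0 => //; apply: mx_ge0M.
have X'i : invertible X'.
  apply: invertibleM; last exact/unimodular_invertible/unimodular_tperm.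
  by apply: invertibleM => //; apply/unimodular_invertible/unimodular_tperm.
have [_ yvx zvx wvx] := mx_ge_sub X'vx.
move: X'i XE; rewrite -[X']submxK [ulsubmx X']mx11_scalar.
have -> : ulsubmx X' 0 0 = x.
  have ul (Z : 'M[D]_(1 + n)) : ulsubmx Z 0 0 = Z 0 0.
    by rewrite !mxE; congr (Z _ _); apply: val_inj.
  by rewrite ul.
set y := ursubmx _ in yvx *; set z := dlsubmx _ in zvx *; set w := drsubmx _ in wvx *.
have xV : mx_ge (- v x) (x^-1%:M : 'M[D]_1).
  by apply: mx_ge_scalar; rewrite val_ge_neq0 ?invr_eq0 // (valuationV Hv).
have zx : mx_ge 0 (z *m x^-1%:M) by rewrite -(subrr (v x)); apply: mx_geM.
have xy : mx_ge 0 (x^-1%:M *m y) by rewrite -(addNr (v x)); apply: mx_geM.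
rewrite schur_factorization //; set s := w - _.
have svx : mx_ge (v x) s by apply: mx_geB => //; apply: mx_ge0M.
set L := block_mx 1%:M 0 _ _; set U := block_mx 1%:M _ 0 _ => X'i XE.
have UL : unimodular L by exact: unimodular_lower.
have UU : unimodular U by exact: unimodular_upper.
have si : invertible s.
  apply: (@invertible_dr 1 n x%:M).
  have [L' [LL' L'L _ L'0]] := UL; have [U' [UU' U'U _ U'0]] := UU.
  have -> : block_mx x%:M 0 0 s = L' *m (L *m block_mx x%:M 0 0 s *m U) *m U'.
    by rewrite !mulmxA L'L mul1mx -mulmxA UU' mulmx1.
  apply: invertibleM; last by exists U.
  by apply: invertibleM => //; exists L.
have [a' [B' [C' [a'mono a'ge UB' UC' sE]]]] := IHn s (v x) si svx.
pose a (i : 'I_n.+1) := if unlift ord0 i is Some j then a' j else v x.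
(* The pivot is p^(v x) u; its unit part u, on the right of the power of p, goes into the right
   factor. *)
pose u := p ^ (- v x) * x.
have u0 : u != 0 by rewrite (vdiv_mulf_neq0 Hv) ?p_exprz_neq0.
have vu : v u = 0 by rewrite (valuationM Hv) ?p_exprz_neq0 // val_p_exprz addNr.
have Uu : unimodular (u%:M : 'M[D]_1).
  exists (u^-1%:M); rewrite -!scalar_mxM (vdiv_mulfV Hv) // (vdiv_mulVf Hv) //; split=> //.
    by apply: mx_ge_scalar; rewrite val_ge_neq0 // vu.
  by apply: mx_ge_scalar; rewrite val_ge_neq0 ?invr_eq0 // (valuationV Hv) // vu.
have U1 : unimodular (1%:M : 'M[D]_1).
  by exists 1%:M; rewrite mulmx1; split=> //; apply: mx_ge1.
exists a, (tperm_mx ord0 i0 *m (L *m block_mx 1%:M 0 0 B')),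
  (block_mx u%:M 0 0 C' *m U *m tperm_mx ord0 j0); split.
- move=> i j; rewrite /a.
  case: (unliftP ord0 i) => [i'|] ->; case: (unliftP ord0 j) => [j'|] -> /=;
    rewrite /bump ?leq0n ?add1n //.
  by rewrite ltnS => /a'mono.
- have kvx : k <= v x by have := Xk i0 j0; rewrite val_ge_neq0.
  by move=> i; rewrite /a; case: unliftP => // i' _; apply: le_trans (a'ge i').
- apply: unimodularM; first exact: unimodular_tperm.
  by apply: unimodularM => //; apply: (@unimodular_diag 1 n).
- apply: unimodularM; last exact: unimodular_tperm.
  by apply: unimodularM => //; apply: (@unimodular_diag 1 n).
have aE : pdiag a = block_mx (p ^ (v x))%:M 0 0 (pdiag a') :> 'M[D]_(1 + n).
  apply/matrixP => i j; rewrite -(splitK i) -(splitK j).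
  case: (fintype.split i) => i'; case: (fintype.split j) => j' /=.
  - rewrite block_mxEul !mxE !ord1 eqxx /a.
    have -> : lshift n 0 = ord0 :> 'I_(1 + n) by exact: val_inj.
    by rewrite unlift_none eqxx.
  - by rewrite block_mxEur !mxE; case: eqP => // /(congr1 val) /=; rewrite !ord1.
  - by rewrite block_mxEdl !mxE; case: eqP => // /(congr1 val) /=; rewrite !ord1.
  - by rewrite block_mxEdr !mxE /a !rshift1 liftK (inj_eq lift_inj).
have key : block_mx x%:M 0 0 s = block_mx 1%:M 0 0 B' *m
    block_mx (p ^ (v x))%:M 0 0 (pdiag a') *m block_mx u%:M 0 0 C' :> 'M[D]_(1 + n).
  rewrite !mulmx_block !(mul0mx, mulmx0, addr0, add0r, mul1mx) -sE; congr block_mx.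
  by rewrite -scalar_mxM mulrA -p_exprzD subrr mul1r.
by rewrite XE key aE !mulmxA.
Qed.

End ValuedMatrices.

(** Interface between the division algebra and its matrix groups, instantiated by [dval] in
    [dval_normalized]. The last two clauses turn integrality and ideal powers into inequalities. *)
Record is_normalized_valuation (F : localFieldType) (D : falgType F) (v : D -> int) (p : D) : Prop :=
  IsNormalizedValuation {
  nval_valuation : is_valuation v;
  nval_unif_neq0 : p != 0;
  nval_unif : v p = 1;
  nval_OD : forall x, OD D x <-> val_ge v 0 x;
  nval_PD : forall (k : nat) x, PD D k x <-> val_ge v k x
}.

(** * Congruence subgroups and Cartan decomposition *)

Section ValuedGL.
Variables (F : localFieldType) (D : falgType F) (r : nat) (v : D -> int) (p : D).
Hypothesis H : is_normalized_valuation v p.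
Let Hv := nval_valuation H.
Let p0 := nval_unif_neq0 H.
Let vp := nval_unif H.
Let ODv := nval_OD H.
Let PDv := nval_PD H.
Local Notation G := (GL D r).
Implicit Types (g h : G) (X Y : 'M[D]_r).

Lemma glmxM g h : glmx (g * h)%g = glmx g *m glmx h. Proof. by []. Qed.
Lemma glmx1 : glmx (1%g : G) = 1%:M. Proof. by []. Qed.
Lemma glmxV g : glmx g *m glmx g^-1%g = 1%:M. Proof. by rewrite -glmxM mulgV. Qed.
Lemma glmxVl g : glmx g^-1%g *m glmx g = 1%:M. Proof. by rewrite -glmxM mulVg. Qed.

Lemma invertible_GL X : invertible X -> exists g : G, glmx g = X.
Proof.
move=> [Y [XY YX]].
have XYP : (X *m Y == 1%:M) && (Y *m X == 1%:M) by rewrite XY YX !eqxx.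
by exists (@MkGL F D r (X, Y) XYP).
Qed.

(** The condition n(g) <= n of the overview, for n >= 0. *)
Definition bounded (n : int) (g : G) := mx_ge v (- n) (glmx g) /\ mx_ge v (- n) (glmx g^-1%g).

Lemma GLO_bounded g : GLO g <-> bounded 0 g.
Proof.
rewrite /bounded oppr0; split=> [h|[h1 h2] i j].
  by split=> i j; have [/ODv ? /ODv ?] := h i j.
by split; apply/ODv; [apply: h1 | apply: h2].
Qed.

Lemma boundedV n g : bounded n g -> bounded n g^-1%g.
Proof. by move=> [h1 h2]; split=> //; rewrite invgK. Qed.

Lemma boundedM m n g h : bounded m g -> bounded n h -> bounded (m + n) (g * h)%g.
Proof.
move=> [g1 g2] [h1 h2]; split; rewrite ?invgM glmxM.
  by rewrite opprD; apply: mx_geM.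
by rewrite opprD addrC; apply: mx_geM.
Qed.

Lemma bounded_le m n g : m <= n -> bounded m g -> bounded n g.
Proof. by move=> mn [g1 g2]; split; [apply: mx_ge_le g1 | apply: mx_ge_le g2]; lia. Qed.

Lemma bounded_ex g : exists n : nat, bounded n g.
Proof.
have [n1 g1] := mx_ge_bound v (glmx g); have [n2 g2] := mx_ge_bound v (glmx g^-1%g).
by exists (n1 + n2)%N; split; [apply: mx_ge_le g1 | apply: mx_ge_le g2]; lia.
Qed.

Lemma bounded_GLOl n g h : GLO g -> bounded n h -> bounded n (g * h)%g.
Proof. by move=> /GLO_bounded g0 /(boundedM g0); rewrite add0r. Qed.

Lemma bounded_GLOr n g h : bounded n g -> GLO h -> bounded n (g * h)%g.
Proof. by move=> gn /GLO_bounded /(boundedM gn); rewrite addr0. Qed.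

Lemma GLO1 : GLO (1%g : G).
Proof. by apply/GLO_bounded; split; rewrite ?invg1 glmx1; apply: mx_ge1. Qed.

Lemma GLOM g h : GLO g -> GLO h -> GLO (g * h)%g.
Proof. by move=> g0 /GLO_bounded h0; apply/GLO_bounded; apply: bounded_GLOl. Qed.

Lemma GLOV g : GLO g -> GLO g^-1%g.
Proof. by move=> /GLO_bounded h; apply/GLO_bounded; apply: boundedV. Qed.

Lemma GLO_ge0 g : GLO g -> mx_ge v 0 (glmx g).
Proof. by move=> /GLO_bounded[]; rewrite oppr0. Qed.

Lemma GLcongE k g : GLcong k g <-> mx_ge v k (glmx g - 1%:M).
Proof.
by split=> h i j; have := h i j; rewrite ?mxE => /PDv.
Qed.

(** The identity g^-1 = 1 - (g - 1) g^-1 lowers the exponent of a denominator of g^-1 by one each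
    time it is applied. *)
Lemma GLcong_GLO k g : (0 < k)%N -> GLcong k g -> GLO g.
Proof.
move=> k0 /GLcongE gk; have g0 : mx_ge v 0 (glmx g).
  rewrite -[glmx g](subrK 1%:M); apply: (mx_geD Hv); last exact: mx_ge1.
  by apply: mx_ge_le gk.
apply/GLO_bounded; split; rewrite oppr0 //.
have [n] := mx_ge_bound v (glmx g^-1%g).
elim: n => [|n IHn]; first by rewrite oppr0.
move=> gn; apply: IHn.
have -> : glmx g^-1%g = 1%:M - (glmx g - 1%:M) *m glmx g^-1%g.
  by rewrite mulmxBl glmxV mul1mx opprB addrCA subrr addr0.
apply: (mx_geB Hv); first by apply: (mx_ge1 Hv); lia.
by apply: mx_ge_le (mx_geM Hv gk gn); lia.
Qed.

Lemma GLcong1 k : GLcong k (1%g : G).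
Proof. by apply/GLcongE; rewrite glmx1 subrr; apply: mx_ge0. Qed.

Lemma GLcongM k g h : (0 < k)%N -> GLcong k g -> GLcong k h -> GLcong k (g * h)%g.
Proof.
move=> k0 gk hk; have g0 := GLO_ge0 (GLcong_GLO k0 gk).
move: gk hk => /GLcongE gk /GLcongE hk; apply/GLcongE; rewrite glmxM.
have -> : glmx g *m glmx h - 1%:M = glmx g *m (glmx h - 1%:M) + (glmx g - 1%:M).
  by rewrite mulmxBr mulmx1 addrA subrK.
by apply: (mx_geD Hv) => //; apply: (mx_ge0M Hv).
Qed.

Lemma GLcongV k g : (0 < k)%N -> GLcong k g -> GLcong k g^-1%g.
Proof.
move=> k0 gk; have gV0 := GLO_ge0 (GLOV (GLcong_GLO k0 gk)).
move: gk => /GLcongE gk; apply/GLcongE.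
have -> : glmx g^-1%g - 1%:M = - (glmx g^-1%g *m (glmx g - 1%:M)).
  by rewrite mulmxBr glmxVl mulmx1 opprB.
by apply: (mx_geN Hv); apply: (mx_ge0M Hv).
Qed.

Lemma GLcong_conj k g h : GLO h -> GLcong k g -> GLcong k (h * g * h^-1)%g.
Proof.
move=> hO /GLcongE gk; apply/GLcongE; rewrite !glmxM.
have -> : glmx h *m glmx g *m glmx h^-1%g - 1%:M = glmx h *m (glmx g - 1%:M) *m glmx h^-1%g.
  by rewrite mulmxBr mulmxBl mulmx1 glmxV.
apply: (mx_geM0 Hv); last exact/GLO_ge0/GLOV.
by apply: (mx_ge0M Hv) => //; apply: GLO_ge0.
Qed.

(** Both X g^-1 and g^-1 X are congruent to 1 modulo P^(k - n), as p^n clears the denominators of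
    g^-1. In this way entrywise approximations become equalities of cosets. *)
Lemma GL_approx (k n : int) (l : nat) X g : (0 < l)%N -> l%:Z <= k - n -> bounded n g ->
  mx_ge v k (X - glmx g) ->
  exists h : G, [/\ glmx h = X, GLcong l (h * g^-1)%g & GLcong l (g^-1 * h)%g].
Proof.
move=> l0 lkn [gn gVn] Xg.
have e1 : mx_ge v l (X *m glmx g^-1%g - 1%:M).
  rewrite -[1%:M](glmxV g) -mulmxBl; apply: mx_ge_le (mx_geM Hv Xg gVn); lia.
have e2 : mx_ge v l (glmx g^-1%g *m X - 1%:M).
  rewrite -[1%:M](glmxVl g) -mulmxBr; apply: mx_ge_le (mx_geM Hv gVn Xg); lia.
have [u uE] : exists u : G, glmx u = X *m glmx g^-1%g.
  by apply: invertible_GL; apply: (invertible_congr1 Hv); apply: mx_ge_le e1.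
exists (u * g)%g; have hX : glmx (u * g)%g = X.
  by rewrite glmxM uE -mulmxA glmxVl mulmx1.
split=> //; apply/GLcongE; first by rewrite mulgK uE.
by rewrite glmxM hX.
Qed.

Lemma pdiag_invertible (a : 'I_r -> int) :
  (pdiag p a *m pdiag p (fun i => - a i) == 1%:M) && (pdiag p (fun i => - a i) *m pdiag p a == 1%:M).
Proof.
apply/andP; split; apply/eqP/matrixP => i j; rewrite mul_diag_mx !mxE.
  by case: eqP => [->|_]; rewrite ?mulr0n ?mulr0 // !mulr1n -(p_exprzD Hv) // subrr.
by case: eqP => [->|_]; rewrite ?mulr0n ?mulr0 // !mulr1n -(p_exprzD Hv) // addNr.
Qed.

Definition gl_pdiag (a : 'I_r -> int) : G := @MkGL F D r (pdiag p a, pdiag p (fun i => - a i)) (pdiag_invertible a).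

Lemma gl_pdiagE a : glmx (gl_pdiag a) = pdiag p a. Proof. by []. Qed.
Lemma gl_pdiagV a : glmx (gl_pdiag a)^-1%g = pdiag p (fun i => - a i). Proof. by []. Qed.

Lemma gl_pdiagM a b : (gl_pdiag a * gl_pdiag b)%g = gl_pdiag (fun i => a i + b i).
Proof.
apply: glmx_inj; rewrite glmxM !gl_pdiagE; apply/matrixP => i j; rewrite mul_diag_mx !mxE.
by case: eqP => [->|_]; rewrite ?mulr0 //= -(p_exprzD Hv).
Qed.

Lemma pdiag_conjE a b X i j : (pdiag p a *m X *m pdiag p b) i j = p ^ (a i) * X i j * p ^ (b j).
Proof. by rewrite mul_diag_mx mul_mx_diag !mxE. Qed.

Lemma gl_pdiag_bounded n a : bounded n (gl_pdiag a) <-> forall i, - n <= a i <= n.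
Proof.
split=> [[h1 h2] i|h].
  have := h1 i i; have := h2 i i; rewrite gl_pdiagE gl_pdiagV !mxE eqxx !mulr1n.
  rewrite !val_ge_neq0 ?(p_exprz_neq0 Hv) // !(val_p_exprz Hv) //; lia.
split=> i j; rewrite ?gl_pdiagV ?gl_pdiagE !mxE; case: eqP => [->|_]; rewrite ?val_ge0 // mulr1n.
  by rewrite val_ge_neq0 ?(p_exprz_neq0 Hv) // (val_p_exprz Hv) //; have := h j; lia.
by rewrite val_ge_neq0 ?(p_exprz_neq0 Hv) // (val_p_exprz Hv) //; have := h j; lia.
Qed.

Lemma unimodular_GLO X : unimodular v X -> exists2 g : G, GLO g & glmx g = X.
Proof.
move=> [Y [XY YX X0 Y0]]; have [|g gX] := invertible_GL (X := X); first by exists Y.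
exists g => //; apply/GLO_bounded; split; rewrite oppr0 ?gX //.
suff -> : glmx g^-1%g = Y by [].
by rewrite -[LHS]mul1mx -YX -mulmxA -gX glmxV mulmx1.
Qed.

Lemma cartan g : exists a B C, [/\ forall i j : 'I_r, (i <= j)%N -> a i <= a j,
  GLO B, GLO C & g = (B * gl_pdiag a * C^-1)%g].
Proof.
have gi : invertible (glmx g) by exists (glmx g^-1%g); rewrite glmxV glmxVl.
have [n gn] := mx_ge_bound v (glmx g).
have [a [B [C [amono _ /unimodular_GLO[b bO <-] /unimodular_GLO[c cO <-] gE]]]] :=
  smith_normal_form Hv p0 vp gi gn.
exists a, b, c^-1%g; split=> //; first exact: GLOV.
by apply: glmx_inj; rewrite !glmxM gE invgK.
Qed.

Lemma cartan_bounded n a B C : GLO B -> GLO C ->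
  bounded n (B * gl_pdiag a * C^-1)%g <-> bounded n (gl_pdiag a).
Proof.
move=> BO CO; split=> h; last by apply: bounded_GLOr; [apply: bounded_GLOl | apply: GLOV].
have -> : gl_pdiag a = (B^-1 * (B * gl_pdiag a * C^-1) * C)%g.
  by rewrite !mulgA mulVg mul1g mulgVK.
by apply: bounded_GLOr => //; apply: bounded_GLOl => //; apply: GLOV.
Qed.

(* With e the projection onto the coordinates i < k0 and f = 1 - e, one has
   k = q (1 + u) where u = e u f and e q f = 0. *)
Lemma block_triangular_factorization (l k0 : nat) (k : G) : (0 < l)%N -> GLcong l k ->
  exists U, [/\ GLcong l U, forall i j : 'I_r, ~~ ((i < k0) && (k0 <= j))%N -> (glmx U - 1%:M) i j = 0,
    forall i j : 'I_r, ~~ ((i < k0) && (k0 <= j))%N -> (glmx U^-1%g - 1%:M) i j = 0 &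
    forall i j : 'I_r, (i < k0 <= j)%N -> glmx (k * U^-1)%g i j = 0].
Proof.
move=> l0 kl; have kO := GLcong_GLO l0 kl; move: (kl) => /GLcongE kl'.
pose e : 'M[D]_r := diag_mx (\row_i (i < k0)%:R); pose f : 'M[D]_r := diag_mx (\row_i (k0 <= i)%:R).
have ef : e + f = 1%:M.
  apply/matrixP => i j; rewrite !mxE; case: eqP => [->|_]; rewrite ?addr0 // !mulr1n.
  by rewrite ltnNge; case: (k0 <= j)%N; rewrite ?add0r ?addr0.
have eE A i j : (e *m A) i j = (i < k0)%:R * A i j by rewrite mul_diag_mx !mxE.
have fE A i j : (A *m f) i j = A i j * (k0 <= j)%:R by rewrite mul_mx_diag !mxE.
have eE' A i j : (A *m e) i j = A i j * (j < k0)%:R by rewrite mul_mx_diag !mxE.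
have fe : f *m e = 0.
  apply/matrixP => i j; rewrite eE' !mxE; case: eqP => [->|_]; rewrite ?mul0r // mulr1n.
  by rewrite ltnNge; case: (k0 <= j)%N; rewrite ?mulr0 ?mul0r.
have ee : e *m e = e by rewrite -[RHS]mul1mx -ef mulmxDl fe addr0.
have e_f : e *m f = 0 by rewrite -[LHS]addr0 -[X in _ + X](subrr e) addrA -{2}ee -mulmxDr [f + e]addrC ef mulmx1 subrr.
have ff : f *m f = f by rewrite -[RHS]mul1mx -ef mulmxDl e_f add0r.
have e0 : mx_ge v 0 e.
  by move=> i j; rewrite !mxE; case: eqP => _; rewrite ?val_ge0 // mulr1n (val_ge_nat Hv).
have f0 : mx_ge v 0 f.
  by move=> i j; rewrite !mxE; case: eqP => _; rewrite ?val_ge0 // mulr1n (val_ge_nat Hv).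
(* X is the upper left block of k completed by 1. Its inverse Y gives u = Y e K f, the solution of e
   K u = e K f with u = e u f; this makes e K (1 - u) f vanish. *)
pose K := glmx k; pose X := e *m K *m e + f.
have X1 : mx_ge v l (X - 1%:M).
  have -> : X - 1%:M = e *m (K - 1%:M) *m e.
    by rewrite mulmxBr mulmxBl mulmx1 ee /X -ef [e + f]addrC opprD addrA addrK.
  by apply: (mx_geM0 Hv) => //; apply: (mx_ge0M Hv).
have [x xX] : exists x : G, glmx x = X.
  by apply: invertible_GL; apply: (invertible_congr1 Hv); apply: mx_ge_le X1.
have xl : GLcong l x by apply/GLcongE; rewrite xX.
pose Y := glmx x^-1%g; have YX : Y *m X = 1%:M by rewrite -xX glmxVl.
have XY : X *m Y = 1%:M by rewrite -xX glmxV.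
have Y0 : mx_ge v 0 Y by apply/GLO_ge0/GLOV/(GLcong_GLO l0 xl).
have eX : e *m X = X *m e.
  by rewrite mulmxDl mulmxDr fe e_f !addr0 !mulmxA ee -!mulmxA ee.
have eY : e *m Y = Y *m e.
  by rewrite -[LHS]mul1mx -YX -!mulmxA (mulmxA X) -eX -(mulmxA e) XY mulmx1.
pose u := Y *m (e *m K *m f).
have eu : e *m u = u by rewrite /u mulmxA eY -mulmxA !mulmxA -(mulmxA Y) ee.
have uf : u *m f = u by rewrite /u -!mulmxA ff.
have uu : u *m u = 0 by rewrite -{1}uf -{2}eu mulmxA -(mulmxA u) fe mulmx0 mul0mx.
have ul : mx_ge v l u.
  apply: (mx_ge0M Hv) => //; have -> : e *m K *m f = e *m (K - 1%:M) *m f.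
    by rewrite mulmxBr mulmxBl mulmx1 e_f subr0.
  by apply: (mx_geM0 Hv) => //; apply: (mx_ge0M Hv).
have u_0 (i j : 'I_r) : ~~ ((i < k0) && (k0 <= j))%N -> u i j = 0.
  rewrite negb_and => /orP[ni|nj]; first by rewrite -eu eE (negPf ni) mul0r.
  by rewrite -uf fE (negPf nj) mulr0.
have UP : ((1%:M + u) *m (1%:M - u) == 1%:M) && ((1%:M - u) *m (1%:M + u) == 1%:M).
  apply/andP; split; apply/eqP.
    by rewrite mulmxDl mul1mx mulmxBr mulmx1 uu subr0 subrK.
  by rewrite mulmxBl mul1mx mulmxDr mulmx1 uu addr0 addrK.
pose U : G := @MkGL F D r (1%:M + u, 1%:M - u) UP.
have UE : glmx U = 1%:M + u by [].
have UVE : glmx U^-1%g = 1%:M - u by [].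
exists U; split.
- by apply/GLcongE; rewrite UE addrAC subrr add0r.
- by move=> i j /u_0; rewrite UE addrAC subrr add0r.
- by move=> i j /u_0 uij; rewrite UVE addrAC subrr add0r [LHS]mxE uij oppr0.
move=> i j /andP[ik kj]; rewrite glmxM UVE.
have : e *m (K *m (1%:M - u)) *m f = 0.
  have -> : e *m (K *m (1%:M - u)) *m f = e *m K *m f - e *m (K *m (u *m f)).
    by rewrite mulmxBr mulmx1 mulmxBr mulmxBl !mulmxA.
  rewrite uf.
  have -> : e *m (K *m u) = X *m u.
    by rewrite /X mulmxDl -{3}eu [f *m _]mulmxA fe mul0mx addr0 -!mulmxA eu.
  by rewrite /u mulmxA XY mul1mx subrr.
by move/matrixP/(_ i j); rewrite fE eE ik kj mul1r mulr1 => ->; rewrite mxE.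
Qed.

(** Write k = q U, where q vanishes and U - 1 is supported on the block i < k0 <= j. Conjugation of
    q by p^eps lowers valuations only on this block. There p^(-a) (U - 1) p^a gains a_j - a_i >= 0.
    Both conjugates thus stay in the congruence subgroup. *)
Lemma pdiag_product_dcoset (l k0 : nat) (c : int) (eps a : 'I_r -> int) (k : G) : (0 < l)%N ->
  (forall i : 'I_r, eps i = c + (k0 <= i)%N%:Z) ->
  (forall i j : 'I_r, (i <= j)%N -> a i <= a j) -> GLcong l k ->
  exists k1 k2, [/\ GLcong l k1, GLcong l k2 &
    (gl_pdiag eps * k * gl_pdiag a = k1 * gl_pdiag (fun i => eps i + a i)%R * k2)%g].
Proof.
move=> l0 epsE amono kl.
have [U [Ul U0 UV0 kU0]] := block_triangular_factorization k0 l0 kl.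
have ql : GLcong l (k * U^-1)%g by apply: GLcongM => //; apply: GLcongV.
exists (gl_pdiag eps * (k * U^-1) * (gl_pdiag eps)^-1)%g, ((gl_pdiag a)^-1 * U * gl_pdiag a)%g.
split.
- move: ql => /GLcongE ql; apply/GLcongE => i j.
  have -> : glmx (gl_pdiag eps * (k * U^-1) * (gl_pdiag eps)^-1)%g - 1%:M =
      pdiag p eps *m (glmx (k * U^-1)%g - 1%:M) *m pdiag p (fun i => - eps i).
    by rewrite !(glmxM, gl_pdiagE, gl_pdiagV) mulmxBr mulmxBl mulmx1 -[X in _ - X](glmxV (gl_pdiag eps)).
  rewrite pdiag_conjE.
  case: (boolP ((i < k0 <= j)%N)) => [ikj|nikj].
    move: (ikj) => /andP[ik kj].
    have ij : (i == j) = false by apply/eqP => ij; move: ik; rewrite ij ltnNge kj.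
    rewrite [(_ - _ : 'M[D]_r) i j]mxE kU0 // !mxE ij subr0.
    by rewrite mulr0 mul0r val_ge0.
  rewrite (val_geMr Hv) ?(p_exprz_neq0 Hv) // (val_geMl Hv) ?(p_exprz_neq0 Hv) //.
  rewrite !(val_p_exprz Hv) // !epsE; apply: val_ge_le (ql i j).
  by move: nikj; case: (leqP k0 i); case: (leqP k0 j) => /=; lia.
- move: Ul => /GLcongE Ul; apply/GLcongE => i j.
  have -> : glmx ((gl_pdiag a)^-1 * U * gl_pdiag a)%g - 1%:M =
      pdiag p (fun i => - a i) *m (glmx U - 1%:M) *m pdiag p a.
    by rewrite !(glmxM, gl_pdiagE, gl_pdiagV) mulmxBr mulmxBl mulmx1 -[X in _ - X](glmxVl (gl_pdiag a)).
  rewrite pdiag_conjE.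
  case: (boolP ((i < k0) && (k0 <= j))%N) => [/andP[ik kj]|/U0->].
    rewrite (val_geMr Hv) ?(p_exprz_neq0 Hv) // (val_geMl Hv) ?(p_exprz_neq0 Hv) //.
    rewrite !(val_p_exprz Hv) //; apply: val_ge_le (Ul i j).
    by have := amono i j; lia.
  by rewrite mulr0 mul0r val_ge0.
- by rewrite -gl_pdiagM !mulgA mulgVK mulgK mulgVK.
Qed.

End ValuedGL.

Lemma finite_codes (T : Type) (Ft : finType) (X : set T) (code : T -> Ft) :
  exists2 s : seq T, (forall y, List.In y s -> X y) &
    forall x, X x -> exists2 y, List.In y s & code y = code x.
Proof.
suff h (e : seq Ft) : exists2 s : seq T, (forall y, List.In y s -> X y) &
    forall x, X x -> code x \in e -> exists2 y, List.In y s & code y = code x.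
  by have [s sX sP] := h (enum Ft); exists s => // x Xx; apply: sP; rewrite ?mem_enum.
elim: e => [|c e [s sX sP]]; first by exists [::].
have [[y [Xy yc]]|no] := pselect (exists y, X y /\ code y = c).
  exists (y :: s) => [z /= [<-//|/sX//]|x Xx].
  rewrite inE => /orP[/eqP xc|/(sP x Xx)[z zs zx]]; last by exists z => //; right.
  by exists y; [left | rewrite yc].
exists s => // x Xx; rewrite inE => /orP[/eqP xc|]; last exact: sP.
by case: no; exists x.
Qed.

Lemma irredundant_reps (T : eqType) (r : T -> T -> Prop) (s : seq T) :
  (forall x, r x x) -> (forall x y, r x y -> r y x) -> (forall x y z, r x y -> r y z -> r x z) ->
  exists s', [/\ uniq s', {subset s' <= s}, forall x, x \in s -> exists2 y, y \in s' & r y x &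
    forall x y, x \in s' -> y \in s' -> r x y -> x = y].
Proof.
move=> rrefl rsym rtrans; elim: s => [|x s [s' [us' ss' cov irr]]]; first by exists [::].
have [[y ys' ryx]|no] := pselect (exists2 y, y \in s' & r y x).
  exists s'; split=> // [z /ss' zs|z]; first by rewrite inE zs orbT.
  by rewrite inE => /predU1P[->|/cov//]; exists y.
have nx y : y \in s' -> ~ r y x by move=> ys' ryx; apply: no; exists y.
exists (x :: s'); split=> /=.
- rewrite us' andbT; apply/negP => xs'; exact: (nx x).
- by move=> z; rewrite !inE => /predU1P[->|/ss'->]; rewrite ?eqxx ?orbT.
- move=> z; rewrite inE => /predU1P[->|/cov[y ys' ryz]]; first by exists x; rewrite ?inE ?eqxx.
  by exists y; rewrite // inE ys' orbT.
- move=> a b; rewrite !inE => /predU1P[->|as'] /predU1P[->|bs'] // rab; last exact: irr.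
    by case: (nx b) => //; apply: rsym.
  by case: (nx a).
Qed.

(** * Hecke functions and convolution *)

Section RintegralIndic.
Context d (T : measurableType d) (R : realType) (mu : {measure set T -> \bar R}).

Lemma integrable_indic_fin (A : set T) : measurable A -> (mu A < +oo)%E ->
  mu.-integrable setT (EFin \o (\1_A : T -> R)).
Proof.
move=> mA fA; apply/integrableP; split; first exact/measurable_EFinP.
rewrite (eq_integral (fun x => (\1_A x)%:E)); last first.
  by move=> t _; rewrite gee0_abs// lee_fin.
by rewrite integral_indic// setIT.
Qed.

Lemma Rintegral_sum_indic (I : Type) (s : seq I) (c : I -> R) (A : I -> set T) :
  (forall i, measurable (A i)) -> (forall i, mu (A i) < +oo)%E ->
  mu.-integrable setT (EFin \o (fun x => \sum_(i <- s) c i * \1_(A i) x)) /\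
  Rintegral mu setT (fun x => \sum_(i <- s) c i * \1_(A i) x) = \sum_(i <- s) c i * fine (mu (A i)).
Proof.
move=> mA fA; elim: s => [|i s [IHi IHs]].
  have -> : (fun x => \sum_(i <- [::]) c i * \1_(A i) x) = (fun=> 0) :> (T -> R).
    by apply/funext => x; rewrite big_nil.
  rewrite big_nil; split; first exact: integrable0.
  by rewrite /Rintegral integral0.
have -> : (fun x => \sum_(j <- i :: s) c j * \1_(A j) x) =
    (fun x => c i * \1_(A i) x + \sum_(j <- s) c j * \1_(A j) x) :> (T -> R).
  by apply/funext => x; rewrite big_cons.
have ii : mu.-integrable setT (EFin \o (\1_(A i) : T -> R)) by exact: integrable_indic_fin.
have ci : mu.-integrable setT (EFin \o (fun x => c i * \1_(A i) x)).
  exact: (integrableZl measurableT (c i) ii).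
split; first exact: (integrableD measurableT ci IHi).
rewrite big_cons RintegralD // IHs RintegralZl //; congr (_ * _ + _).
by rewrite /Rintegral integral_indic // setIT.
Qed.

End RintegralIndic.

(** * Topology of the general linear group *)

Section Topology.
Variables (F : localFieldType) (D : falgType F) (d r : nat).
Hypothesis hD : central_division_algebra D d.
Variable SF : cyclic_datum D d.
Local Notation v := (@dval F D d).
Local Notation G := (GL D r).
Let Hv := dval_valuation hD SF.
Let d0 := cda_deg_gt0 hD.

Lemma dval_normalized : is_normalized_valuation v (cd_piD SF).
Proof.
split; [exact: dval_valuation | exact: cd_piD_neq0 | exact: dval_piD | | ].
  exact: (OD_val_ge hD SF).
exact: (PD_val_ge hD SF).
Qed.
Let H := dval_normalized.

Lemma dval_reps (j k : int) : exists s : seq D, forall x, val_ge v j x ->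
  exists2 y, y \in s & val_ge v k (x - y).
Proof.
have [c cP] := coord_ge_dval hD SF.
have [s sP] := coord_ge_reps D (- (`|j| + c)%N%:Z) (`|k| + c)%N%:Z.
exists s => x xj; have [|y ys xy] := sP x; last first.
  exists y => //; have [h _] := cP (`|k| + c)%N (x - y); apply: val_ge_le (h xy); nia.
have [_] := cP (- (`|j| + c)%N%:Z) x; apply; apply: val_ge_le xj; nia.
Qed.

Lemma dval_cauchy_limit (u : nat -> D) : (forall k : nat, val_ge v k (u k - u k.+1)) ->
  exists x, forall k : nat, val_ge v k (u k - x).
Proof.
move=> cu; have [c cP] := coord_ge_dval hD SF.
have cu' (k j : nat) : val_ge v k (u k - u (k + j)%N).
  elim: j => [|j IHj]; first by rewrite addn0 subrr val_ge0.
  by apply: (val_ge_trans Hv) IHj _; rewrite addnS; apply: val_ge_le (cu _); lia.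
pose u' k := u (d * k + c)%N.
have [k|x xP] := coord_ge_cauchy_limit (u := u').
  have [_] := cP k (u' k - u' k.+1); apply; rewrite /u'.
  have -> : (d * k.+1 + c = (d * k + c) + d)%N by lia.
  by apply: val_ge_le (cu' _ _); lia.
exists x => k; have [h _] := cP (k + c)%N (u' (k + c)%N - x).
have {}h := h (xP (k + c)%N).
apply: (val_ge_trans Hv (y := u' (k + c)%N)).
  rewrite /u'; have -> : (d * (k + c) + c = k + (d * (k + c) + c - k))%N by nia.
  exact: cu'.
by apply: val_ge_le h; nia.
Qed.

(** Inverses are compared as well, which makes the limits of bounded sequences invertible. *)
Definition gl_close (k : int) (g h : G) :=
  mx_ge v k (glmx g - glmx h) /\ mx_ge v k (glmx g^-1%g - glmx h^-1%g).

Lemma gl_near_mx_ge : exists c : nat, forall (k : int) (g h : G),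
  (gl_near k g h -> mx_ge v (d%:Z * k - c%:Z) (glmx h - glmx g)) /\
  (mx_ge v (d%:Z * k + c%:Z) (glmx h - glmx g) -> gl_near k g h).
Proof.
have [c cP] := coord_ge_dval hD SF; exists c => k g h; split=> gh i j.
  by have [h1 _] := cP k (glmx h i j - glmx g i j); rewrite !mxE; apply: h1 => t; apply: gh.
move=> t; have [_ h2] := cP k (glmx h i j - glmx g i j); apply: h2.
by have := gh i j; rewrite !mxE.
Qed.

Lemma GL_openE (A : set G) : open A = gl_open A. Proof. by []. Qed.

(** A matrix of representatives of the entries need not be invertible; instead one group element is
    chosen for each pair of reductions of g and g^-1 that occurs. *)
Lemma bounded_reps (n k : int) : exists2 s : seq G, (forall g, g \in s -> bounded v n g) &
  forall g, bounded v n g -> exists2 h, h \in s & gl_close k g h.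
Proof.
have [s sP] := dval_reps (- n) k.
have /choice[f fP] (x : D) : exists o : option (seq_sub s), val_ge v (- n) x ->
    exists2 y, o = Some y & val_ge v k (x - val y).
  case: (pselect (val_ge v (- n) x)) => [xn|nx]; last by exists None.
  by have [y ys xy] := sP x xn; exists (Some (SeqSub ys)) => _; exists (SeqSub ys).
pose code (g : G) := ([ffun ij : 'I_r * 'I_r => f (glmx g ij.1 ij.2)],
  [ffun ij : 'I_r * 'I_r => f (glmx g^-1%g ij.1 ij.2)]).
have [t tX tP] := finite_codes (@bounded F D r v n) code.
have In_mem (a : G) : List.In a t <-> a \in t.
  elim: t {tX tP} => //= b t IHt; rewrite inE; split=> [[->|/IHt->]|/predU1P[->|/IHt]]; rewrite ?eqxx ?orbT //; tauto.
exists t => [g /In_mem|g gn]; first exact: tX.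
have [h /In_mem ht hg] := tP g gn; exists h => //.
have [hn1 hn2] := tX h (iffRL (In_mem h) ht); move: gn => [gn1 gn2].
have fc x y : val_ge v (- n) x -> val_ge v (- n) y -> f x = f y -> val_ge v k (x - y).
  move=> /fP[x' xx' xk] /fP[y' yy' yk]; rewrite xx' yy' => -[xy].
  by apply: (val_ge_trans Hv) xk _; rewrite xy (val_ge_sym Hv).
case: hg => /ffunP h1 /ffunP h2; split=> i j; rewrite !mxE; apply: fc; rewrite ?(gn1, gn2, hn1, hn2) //.
  by have := h1 (i, j); rewrite !ffunE.
by have := h2 (i, j); rewrite !ffunE.
Qed.

(** The entrywise limits X and Y of the sequence and of its inverses satisfy XY = YX = 1, since
    bounded denominators make the product continuous. *)
Lemma bounded_cauchy_limit n (u : nat -> G) : (forall k, bounded v n (u k)) ->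
  (forall k : nat, gl_close k (u k) (u k.+1)) ->
  exists2 g, bounded v n g & forall k : nat, gl_close k (u k) g.
Proof.
move=> un uc.
have lim (w : nat -> 'M[D]_r) : (forall k : nat, mx_ge v k (w k - w k.+1)) ->
    exists X, forall k : nat, mx_ge v k (w k - X).
  move=> wc; have /choice[X XP] (ij : 'I_r * 'I_r) : exists x, forall k : nat, val_ge v k (w k ij.1 ij.2 - x).
    by apply: dval_cauchy_limit => k; have := wc k ij.1 ij.2; rewrite !mxE.
  exists (\matrix_(i, j) X (i, j)) => k i j; have := XP (i, j) k; by rewrite !mxE.
have [|X XP] := lim (fun k => glmx (u k)); first by move=> k; have [] := uc k.
have [|Y YP] := lim (fun k => glmx (u k)^-1%g); first by move=> k; have [] := uc k.
have bd (w : nat -> 'M[D]_r) (Z : 'M[D]_r) : (forall k, mx_ge v (- n) (w k)) ->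
    (forall k : nat, mx_ge v k (w k - Z)) -> mx_ge v (- n) Z.
  move=> wn wZ; have -> : Z = w `|n|%N - (w `|n|%N - Z) by rewrite opprB addrC subrK.
  by apply: (mx_geB Hv) => //; apply: mx_ge_le (wZ _); lia.
have Xn : mx_ge v (- n) X by apply: (bd _ _ _ XP) => k; have [] := un k.
have Yn : mx_ge v (- n) Y by apply: (bd _ _ _ YP) => k; have [] := un k.
have inv (w w' : nat -> 'M[D]_r) (Z Z' : 'M[D]_r) : (forall k, mx_ge v (- n) (w k)) -> mx_ge v (- n) Z' ->
    (forall k, w k *m w' k = 1%:M) ->
    (forall k : nat, mx_ge v k (w k - Z)) -> (forall k : nat, mx_ge v k (w' k - Z')) -> Z *m Z' = 1%:M.
  move=> wn Z'n ww' wZ wZ'; apply/matrixP => i j; apply/eqP; rewrite -subr_eq0; apply/eqP.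
  apply: (val_ge_eq0 (v := v)) => k; pose m := (k + `|n|)%N.
  have : mx_ge v k (Z *m Z' - 1%:M).
    rewrite -(ww' m); have -> : Z *m Z' - w m *m w' m = - ((w m - Z) *m Z' + w m *m (w' m - Z')).
      by rewrite mulmxBl mulmxBr [X in _ = - X]addrC subrKA opprB.
    apply: (mx_geN Hv); apply: (mx_geD Hv).
      by apply: mx_ge_le (mx_geM Hv (wZ m) Z'n); lia.
    by apply: mx_ge_le (mx_geM Hv (wn m) (wZ' m)); lia.
  by move=> /(_ i j); rewrite !mxE.
have XY : X *m Y = 1%:M.
  apply: (inv (fun k => glmx (u k)) (fun k => glmx (u k)^-1%g)) => // k; last exact: glmxV.
  by have [] := un k.
have YX : Y *m X = 1%:M.
  apply: (inv (fun k => glmx (u k)^-1%g) (fun k => glmx (u k))) => // k; last exact: glmxVl.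
  by have [] := un k.
have P : (X *m Y == 1%:M) && (Y *m X == 1%:M) by rewrite XY YX !eqxx.
by exists (@MkGL F D r (X, Y) P).
Qed.

(** Each element of the set receives a member of the cover and the index of a ball around it inside
    this member; [ultrametric_compact] extracts finitely many of these. *)
Lemma bounded_compact n : compact (@bounded F D r v n).
Proof.
rewrite compact_cover => I J f fop cov.
have [c cP] := gl_near_mx_ge.
have /choice[ik ikP] (g : G) : exists ik : option I * nat, bounded v n g ->
    exists i, [/\ ik.1 = Some i, J i & forall h, gl_close ik.2 g h -> f i h].
  case: (pselect (bounded v n g)) => [gn|]; last by exists (None, 0%N).
  have [i Ji fig] := cov g gn.
  have := fop i Ji; rewrite GL_openE => /(_ g fig)[m mP].
  exists (Some i, (d * `|m| + c)%N) => _; exists i; split=> // h [gh _]; apply: mP.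
  have [_ h2] := cP m g h; apply: h2; rewrite -opprB; apply: (mx_geN Hv).
  by apply: mx_ge_le gh; rewrite PoszD PoszM lerD2r ler_wpM2l //; lia.
have csym (k : nat) (x y : G) : gl_close k x y -> gl_close k y x.
  by move=> [h1 h2]; split; rewrite -opprB; apply: (mx_geN Hv).
have ctrans (k : nat) (x y z : G) : gl_close k x y -> gl_close k y z -> gl_close k x z.
  by move=> [h1 h2] [h3 h4]; split; [rewrite -(subrKA (glmx y)) | rewrite -(subrKA (glmx y^-1%g))]; apply: (mx_geD Hv).
have [||s sX sP] := ultrametric_compact (X := @bounded F D r v n) csym ctrans _ _ (fun g => (ik g).2).
- by move=> k; have [s _ sP] := bounded_reps n k; exists s.
- exact: bounded_cauchy_limit.
exists [fset x in pmap (fun g => (ik g).1) s]%fset.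
  move=> i; rewrite !inE /= mem_pmap => /mapP[g gs ie].
  have [i' [ie' Ji' _]] := ikP g (sX g gs); rewrite ie' in ie; case: ie => ->; exact: mem_set.
move=> h hn; have [g gs gh] := sP h hn; have [i [ie Ji fi]] := ikP g (sX g gs).
exists i; last exact: fi.
by rewrite /= !inE mem_pmap; apply/mapP; exists g.
Qed.

Variable N : nat.
Hypothesis N0 : (0 < N)%N.
Local Notation K := (@GLcong F D r N).

Definition right_invariant (A : set G) := forall g k, K k -> A (g * k)%g <-> A g.

(** If the entries of h and g agree modulo P^(N + n), where n bounds the denominators of g^-1, then
    g^-1 h lies in K. Applied to complements as well, this also gives closed sets, and it provides
    measurability. *)
Lemma open_right_invariant (A : set G) : right_invariant A -> open A.
Proof.
move=> AK; rewrite GL_openE => g Ag.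
have [n gn] := bounded_ex H g; have [c cP] := gl_near_mx_ge.
exists (N + n + c)%N%:Z => h gh; have [h1 _] := cP (N + n + c)%N g h.
have {}h1 : mx_ge v (N + n)%N (glmx h - glmx g) by apply: mx_ge_le (h1 gh); nia.
have [|h' [hh' _ kh]] := GL_approx H N0 _ gn h1; first by lia.
rewrite (glmx_inj hh') in kh; have := AK g _ kh; rewrite mulgA mulgV mul1g => -[_]; exact.
Qed.

Lemma right_invariantC (A : set G) : right_invariant A -> right_invariant (~` A).
Proof. by move=> AK g k /(AK g) h; split=> h1 h2; apply: h1; apply/h. Qed.

Lemma GLcong_right_invariant_bounded n : right_invariant (@bounded F D r v n).
Proof.
move=> g k kK; have kO := GLcong_GLO H N0 kK; split=> h.
  by rewrite -(mulgK k g); apply: (bounded_GLOr H) => //; apply: (GLOV H).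
exact: (bounded_GLOr H).
Qed.

Lemma coset_reps (n : int) : exists s : seq G, [/\ uniq s, forall g, g \in s -> bounded v n g,
  forall g, bounded v n g -> exists2 x, x \in s & K (x^-1 * g)%g &
  forall x y, x \in s -> y \in s -> K (x^-1 * y)%g -> x = y].
Proof.
have [s sX sP] := bounded_reps n (N + `|n|)%N.
have [||| s' [us' ss' cov irr]] := @irredundant_reps G (fun x y => K (x^-1 * y)%g) s.
- by move=> x; rewrite mulVg; apply: (GLcong1 H).
- by move=> x y /(GLcongV H N0); rewrite invgM invgK.
- move=> x y z xy yz; have -> : (x^-1 * z = (x^-1 * y) * (y^-1 * z))%g by rewrite mulgA mulgK.
  exact: (GLcongM H N0).
exists s'; split=> // [g /ss'|g gn]; first exact: sX.
have [h hs [gh _]] := sP g gn.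
have hn := sX h hs.
have [|g' [gg' _ hK]] := GL_approx (k := (N + `|n|)%N) H N0 _ hn gh; first by lia.
rewrite (glmx_inj gg') in hK; have [x xs' xh] := cov h hs.
exists x => //; have -> : (x^-1 * g = (x^-1 * h) * (h^-1 * g))%g by rewrite mulgA mulgK.
exact: (GLcongM H N0).
Qed.

End Topology.

(** Reindexing along a partial bijection given as a relation. Only terms that do not vanish need a
    partner, because the two index sets may cover regions of different size. *)
Lemma sum_match (T T' : eqType) (V : nmodType) (s : seq T) (s' : seq T') (f : T -> V)
    (f' : T' -> V) (r : T -> T' -> Prop) : uniq s -> uniq s' ->
  (forall x, x \in s -> f x != 0 -> exists2 x', x' \in s' & r x x') ->
  (forall x', x' \in s' -> f' x' != 0 -> exists2 x, x \in s & r x x') ->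
  (forall x y z, x \in s -> y \in s' -> z \in s' -> r x y -> r x z -> y = z) ->
  (forall x y z, x \in s -> y \in s -> z \in s' -> r x z -> r y z -> x = y) ->
  (forall x x', x \in s -> x' \in s' -> r x x' -> f x = f' x') ->
  \sum_(x <- s) f x = \sum_(x' <- s') f' x'.
Proof.
move=> us us' tot tot' fct inj ff'.
have nz (U : eqType) (h : U -> V) (t : seq U) : \sum_(x <- t) h x = \sum_(x <- t | h x != 0) h x.
  by rewrite (bigID (fun x => h x != 0)) /= [X in _ + X]big1 ?addr0 // => x /negPn/eqP.
rewrite nz [RHS]nz -big_filter -[RHS]big_filter.
have /choice[g gP] (x : T) : exists o : option T', x \in s -> f x != 0 -> exists y, [/\ o = Some y, y \in s' & r x y].
  case: (boolP (x \in s)) => [xs|_]; last by exists None.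
  case: (boolP (f x != 0)) => [fx|_]; last by exists None.
  by have [y ys xy] := tot x xs fx; exists (Some y) => _ _; exists y.
pose t := [seq x <- s | f x != 0].
have -> : \sum_(x <- t) f x = \sum_(o <- map g t) oapp f' 0 o.
  rewrite big_map !big_seq; apply: eq_bigr => x; rewrite mem_filter => /andP[fx xs].
  by have [y [-> ys xy]] := gP x xs fx; rewrite /= (ff' x y).
have -> : \sum_(y <- [seq y <- s' | f' y != 0]) f' y =
    \sum_(o <- map Some [seq y <- s' | f' y != 0]) oapp f' 0 o by rewrite big_map.
apply: perm_big; apply: uniq_perm.
- rewrite map_inj_in_uniq ?filter_uniq // => x1 x2.
  rewrite !mem_filter => /andP[f1 s1] /andP[f2 s2].
  have [y1 [-> ys1 r1]] := gP x1 s1 f1; have [y2 [-> ys2 r2]] := gP x2 s2 f2 => -[e].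
  by apply: (inj _ _ y2) => //; rewrite -e.
- by rewrite map_inj_uniq ?filter_uniq // => ? ? [].
- move=> o; apply/mapP/mapP => -[z].
    rewrite mem_filter => /andP[fz zs] ->; have [y [-> ys zy]] := gP z zs fz.
    by exists y => //; rewrite mem_filter ys andbT -(ff' z y).
  rewrite mem_filter => /andP[fz zs'] ->; have [x xs xz] := tot' z zs' fz.
  have fx : f x != 0 by rewrite (ff' x z).
  exists x; first by rewrite mem_filter fx.
  by have [y [-> ys xy]] := gP x xs fx; congr Some; apply: (fct x).
Qed.

(** * Convolution as a finite sum over cosets *)

Section HeckeAlgebra.
Variables (R : realType) (F : localFieldType) (D : falgType F) (d r : nat).
Hypothesis hD : central_division_algebra D d.
Variable SF : cyclic_datum D d.
Local Notation v := (@dval F D d).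
Local Notation G := (GL D r).
Let H := dval_normalized hD SF.
Variable N : nat.
Hypothesis N0 : (0 < N)%N.
Local Notation K := (@GLcong F D r N).
Variable mu : {measure set (GLborel D r) -> \bar R}.
Hypothesis hmu : is_haar mu.

Definition hecke_fun (f : G -> R[i]) :=
  (forall k1 k2 g, K k1 -> K k2 -> f (k1 * g * k2)%g = f g) /\
  exists n : nat, forall g, f g != 0 -> bounded v n g.

Lemma K_GLO k : K k -> GLO k. Proof. exact: (GLcong_GLO H). Qed.

(** Local constancy follows from the invariance under the open group K. A compact support lies in
    some [bounded n], since these open sets exhaust the group; conversely [bounded n] is compact and
    closed. *)
Lemma heckeP f : hecke R K f <-> hecke_fun f.
Proof.
split=> [[floc fcpt finv]|[finv [n fn]]].
  split=> //; move: fcpt; rewrite compact_cover => fcpt.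
  have [|g _|S _ cov] := fcpt nat setT (fun n => @bounded F D r v n%:Z).
  - by move=> n _; apply: (open_right_invariant hD SF N0); apply: (GLcong_right_invariant_bounded hD SF N0).
  - by have [n gn] := bounded_ex H g; exists n.
  exists (\sum_(i <- S) i)%N => g gf.
  have [n nS gn] := cov g (@subset_closure _ [set h | f h != 0] g gf).
  apply: (bounded_le H _ gn); rewrite lez_nat.
  by rewrite (big_rem n) //= leq_addr.
have rinv (A : set R[i]) : right_invariant N [set g | A (f g)].
  move=> g k kK /=; have -> // : f (g * k)%g = f g.
  by have := finv 1%g k g (GLcong1 H N) kK; rewrite mul1g.
split; last exact: finv.
- move=> g; have o : open [set h | f h = f g].
    by apply: (open_right_invariant hD SF N0); apply: (rinv [set x | x = f g]).
  apply: open_nbhs_nbhs; split; [exact: o | by []].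
- apply: (@subclosed_compact _ _ (@bounded F D r v n)); first exact: closed_closure.
    exact: (bounded_compact hD SF).
  have bcl : closed (@bounded F D r v n).
    rewrite -[X in closed X]setCK; apply: open_closedC.
    apply: (open_right_invariant hD SF N0); apply: right_invariantC.
    exact: (GLcong_right_invariant_bounded hD SF N0).
  have ce := iffLR (closure_id _) bcl.
  rewrite ce; exact: closureS.
Qed.

Definition lcoset (x : G) : set G := [set g | K (x^-1 * g)%g].

Lemma lcoset_right_invariant x : right_invariant N (lcoset x).
Proof.
move=> g k kK; rewrite /lcoset /=; split=> h; last by rewrite mulgA; apply: (GLcongM H).
by rewrite -(mulgK k g) mulgA; apply: (GLcongM H) => //; apply: (GLcongV H).
Qed.

Lemma measurable_right_invariant (A : set G) : right_invariant N A -> measurable (A : set (GLborel D r)).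
Proof.
by move=> /(open_right_invariant hD SF N0) Ao; apply: sub_sigma_algebra.
Qed.

Lemma measurable_K : measurable (K : set (GLborel D r)).
Proof.
apply: measurable_right_invariant; move=> g k kK; split=> h; last exact: (GLcongM H).
by rewrite -(mulgK k g); apply: (GLcongM H) => //; apply: (GLcongV H).
Qed.

Lemma mu_lcoset x : mu (lcoset x) = mu K.
Proof.
have [linv _] := hmu; rewrite -(linv x K measurable_K).
congr (mu _); apply/seteqP; split=> [g gK|_ [k kK <-]].
  by exists (x^-1 * g)%g => //; rewrite mulVKg.
by rewrite /lcoset /= mulKg.
Qed.

Lemma GLO_right_invariant : right_invariant N (@GLO F D r).
Proof.
move=> g k /K_GLO kO; split=> h; last exact: (GLOM H).
by rewrite -(mulgK k g); apply: (GLOM H) => //; apply: (GLOV H).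
Qed.

Lemma measurable_GLO : measurable (@GLO F D r : set (GLborel D r)).
Proof. apply: measurable_right_invariant; exact: GLO_right_invariant. Qed.

Lemma mu_lcoset_lty x : (mu (lcoset x) < +oo)%E.
Proof.
rewrite mu_lcoset; have [_ mu1] := hmu.
apply: (@le_lt_trans _ _ (mu (@GLO F D r))); last by rewrite mu1 ltry.
have KG : (K : set (GLborel D r)) `<=` (@GLO F D r : set (GLborel D r)) by exact: K_GLO.
by apply: (le_measure mu _ _ KG); apply/mem_set; [exact: measurable_K | exact: measurable_GLO].
Qed.

Definition vol : R := fine (mu K).

(** Representatives of the cosets gK contained in [bounded n]; all integrals below become sums over
    them. *)
Definition reps (n : int) : seq G := sval (cid (coset_reps r hD SF N0 n)).

Lemma repsP (n : int) : [/\ uniq (reps n), forall g, g \in reps n -> bounded v n g,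
  forall g, bounded v n g -> exists2 x, x \in reps n & K (x^-1 * g)%g &
  forall x y, x \in reps n -> y \in reps n -> K (x^-1 * y)%g -> x = y].
Proof. by rewrite /reps; case: cid. Qed.

Lemma Rintegral_reps (u : G -> R) n : (forall g k, K k -> u (g * k)%g = u g) ->
  (forall g, u g != 0 -> bounded v n g) ->
  Rintegral mu setT u = vol * \sum_(x <- reps n) u x.
Proof.
move=> uK un; have [us sn cov irr] := repsP n.
have uE : u = (fun g => \sum_(x <- reps n) u x * \1_(lcoset x) g).
  apply/funext => g; have [gn|gn] := pselect (bounded v n g).
    have [x xs xg] := cov g gn.
    rewrite (bigD1_seq x) //= indicE mem_set // mulr1 big_seq_cond big1 ?addr0.
      by rewrite -[X in u X](mulVKg x) uK.
    move=> y /andP[ys yx]; rewrite indicE memNset ?mulr0 // => yg.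
    move/eqP: yx; apply; apply: irr => //.
    have -> : (y^-1 * x = (y^-1 * g) * (x^-1 * g)^-1)%g by rewrite invgM invgK mulgA mulgK.
    by apply: (GLcongM H) => //; apply: (GLcongV H).
  have -> : u g = 0 by apply: contrapT => /eqP /un.
  rewrite big_seq big1 // => x xs; rewrite indicE memNset ?mulr0 // => xg.
  apply: gn; rewrite -(mulVKg x g); apply: (bounded_GLOr H); first exact: sn.
  exact: K_GLO.
rewrite {1}uE; have [_ ->] := Rintegral_sum_indic (reps n) u
  (fun x => measurable_right_invariant (lcoset_right_invariant x)) mu_lcoset_lty.
rewrite mulr_sumr; apply: eq_bigr => x _; rewrite mulrC /vol; congr (fine _ * _).
exact: mu_lcoset.
Qed.

(** The sum is the index of K in GL_r(O). It is extended over the representatives of [bounded n],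
    the form in which [sum_appr] compares the two fields. *)
Lemma vol_GLO (n : nat) : vol * \sum_(x <- reps n) \1_(@GLO F D r) x = 1.
Proof.
rewrite -Rintegral_reps.
- have -> : Rintegral mu setT (\1_(@GLO F D r) : GLborel D r -> R) = fine (mu (@GLO F D r)).
    by rewrite /Rintegral integral_indic ?setIT //; exact: measurable_GLO.
  by have [_ ->] := hmu.
- by move=> g k kK; rewrite !indicE; congr (nat_of_bool _)%:R; apply/idP/idP => /set_mem h; apply/mem_set; have := GLO_right_invariant g kK; tauto.
- move=> g; rewrite indicE; case: (boolP (g \in _)) => [/set_mem gO _|_]; last by rewrite eqxx.
  by apply: (bounded_le H) (iffLR (GLO_bounded H g) gO).
Qed.

Lemma complex_integral_reps (f : G -> R[i]) n : (forall g k, K k -> f (g * k)%g = f g) ->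
  (forall g, f g != 0 -> bounded v n g) ->
  complex_integral mu f = (vol%:C)%C * \sum_(x <- reps n) f x.
Proof.
move=> fK fn; rewrite /complex_integral.
rewrite (@Rintegral_reps (fun g => complex.Re (f g)) n).
- rewrite (@Rintegral_reps (fun g => complex.Im (f g)) n).
  + elim: (reps n) => [|x s IHs]; first by rewrite !big_nil !mulr0.
    rewrite !big_cons !mulrDr -IHs; case: (f x) => a b /=.
    by apply/eqP; rewrite eq_complex /= !mul0r subr0 addr0 !eqxx.
  + by move=> g k kK; rewrite fK.
  + by move=> g h; apply: fn; apply: contraNneq h => ->.
- by move=> g k kK; rewrite fK.
- by move=> g h; apply: fn; apply: contraNneq h => ->.
Qed.

Lemma bounded_nz_nat (f : G -> R[i]) (m n : nat) : (m <= n)%N ->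
  (forall g, f g != 0 -> bounded v m g) -> forall g, f g != 0 -> bounded v n g.
Proof. by move=> mn fm g /fm; apply: (bounded_le H); rewrite lez_nat. Qed.

(** Translation by z permutes the cosets gK and carries [bounded n] into [bounded (m + n)], whence
    the two different systems of representatives. *)
Lemma complex_integral_translate (f : G -> R[i]) (n : nat) z : (forall g k, K k -> f (g * k)%g = f g) ->
  (forall g, f g != 0 -> bounded v n g) ->
  complex_integral mu (fun g => f (z^-1 * g)%g) = complex_integral mu f.
Proof.
move=> fK fn; have [m zm] := bounded_ex H z.
rewrite (complex_integral_reps (n := n) fK fn).
rewrite (@complex_integral_reps (fun g => f (z^-1 * g)%g) (m + n)%N%:Z); first last.
- by move=> g /fn gn; rewrite -(mulVKg z g) PoszD; apply: (boundedM H).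
- by move=> g k kK; rewrite mulgA fK.
congr (_ * _); apply/esym.
have [us sn cov irr] := repsP n; have [us' sn' cov' irr'] := repsP (m + n)%N.
apply: (sum_match (r := fun x x' => K ((z * x)^-1 * x')%g)) => //.
- move=> x /sn xn _; have [|x' xs' h] := cov' (z * x)%g.
    by rewrite PoszD; apply: (boundedM H).
  by exists x' => //; have := GLcongV H N0 h; rewrite invgM invgK.
- move=> x' _ /fn /cov[x xs xx']; exists x => //; by rewrite invgM -mulgA.
- move=> x y y' _ ys ys' h h'; apply: irr' => //.
  have -> : (y^-1 * y' = ((z * x)^-1 * y)^-1 * ((z * x)^-1 * y'))%g.
    by rewrite [in RHS]invgM invgK -mulgA mulVKg.
  by apply: (GLcongM H) => //; apply: (GLcongV H).
- move=> x y x' xs ys _ h h'; apply: irr => //.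
  have -> : (x^-1 * y = ((z * x)^-1 * x') * ((z * y)^-1 * x')^-1)%g.
    by rewrite [((z * y)^-1 * x')^-1%g]invgM invgK mulgA mulgK invgM -mulgA mulKg.
  by apply: (GLcongM H) => //; apply: (GLcongV H).
- by move=> x x' _ _ h; rewrite -(fK x _ h) invgM -mulgA mulVKg.
Qed.

Lemma convolution_reps (f1 f2 : G -> R[i]) n y : (forall g k, K k -> f1 (g * k)%g = f1 g) ->
  (forall g, f1 g != 0 -> bounded v n g) -> (forall g k, K k -> f2 (k * g)%g = f2 g) ->
  convolution mu f1 f2 y = (vol%:C)%C * \sum_(x <- reps n) f1 x * f2 (x^-1 * y)%g.
Proof.
move=> f1K f1n f2K; rewrite /convolution; apply: (@complex_integral_reps _ n).
  by move=> g k kK; rewrite f1K // invgM -mulgA f2K //; apply: (GLcongV H).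
by move=> g h; apply: f1n; apply: contraNneq h => ->; rewrite mul0r.
Qed.

Lemma hecke_fun_r f : hecke_fun f -> forall g k, K k -> f (g * k)%g = f g.
Proof. by move=> [h _] g k kK; rewrite -(h 1%g k g) ?mul1g //; apply: (GLcong1 H). Qed.

Lemma hecke_fun_l f : hecke_fun f -> forall g k, K k -> f (k * g)%g = f g.
Proof. by move=> [h _] g k kK; rewrite -(h k 1%g g) ?mulg1 //; apply: (GLcong1 H). Qed.

Lemma hecke_fun_bounded f : hecke_fun f -> exists n : nat, forall m : nat, (n <= m)%N ->
  forall g, f g != 0 -> bounded v m g.
Proof. by move=> [_ [n fn]]; exists n => m nm; apply: bounded_nz_nat fn. Qed.

(** Left invariance is the translation invariance of the integral; the support lies in the product
    of both supports, whence the bound n + m. *)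
Lemma hecke_fun_convolution f1 f2 : hecke_fun f1 -> hecke_fun f2 -> hecke_fun (convolution mu f1 f2).
Proof.
move=> h1 h2; have f1r := hecke_fun_r h1; have f1l := hecke_fun_l h1.
have f2r := hecke_fun_r h2; have f2l := hecke_fun_l h2.
have [_ [n fn]] := h1; have [_ [m fm]] := h2; split.
  move=> k1 k2 g k1K k2K; rewrite [RHS](_ : _ = convolution mu f1 f2 (k1 * g)%g); last first.
    rewrite /convolution -(@complex_integral_translate (fun x => f1 x * f2 (x^-1 * g)%g) n k1).
    - congr complex_integral; apply/funext => x; rewrite f1l; last exact: (GLcongV H).
      by rewrite invgM invgK mulgA.
    - by move=> x k kK; rewrite f1r // invgM -mulgA f2l //; apply: (GLcongV H).
    - by move=> x h; apply: fn; apply: contraNneq h => ->; rewrite mul0r.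
  rewrite !(convolution_reps _ f1r fn f2l); congr (_ * _); apply: eq_bigr => x _.
  by rewrite mulgA f2r.
exists (n + m)%N => g; rewrite (convolution_reps _ f1r fn f2l) => gn0.
have [x [x0 x1]] : exists x, f1 x != 0 /\ f2 (x^-1 * g)%g != 0.
  apply: contrapT => no; move/eqP: gn0; apply; rewrite big1 ?mulr0 // => x _.
  case: (eqVneq (f1 x) 0) => [->|f1x]; first by rewrite mul0r.
  case: (eqVneq (f2 (x^-1 * g)%g) 0) => [->|f2x]; first by rewrite mulr0.
  by case: no; exists x.
by rewrite -(mulVKg x g) PoszD; apply: (boundedM H); [apply: fn | apply: fm].
Qed.

Lemma convolutionDl c f f' h : hecke_fun f -> hecke_fun f' -> hecke_fun h ->
  convolution mu (fun x => c * f x + f' x) h = (fun y => c * convolution mu f h y + convolution mu f' h y).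
Proof.
move=> hf hf' hh; apply/funext => y; have hl := hecke_fun_l hh.
have [n fn] := hecke_fun_bounded hf; have [n' fn'] := hecke_fun_bounded hf'.
have rf := hecke_fun_r hf; have rf' := hecke_fun_r hf'.
have {}fn := fn (n + n')%N (leq_addr _ _); have {}fn' := fn' (n + n')%N (leq_addl _ _).
rewrite (convolution_reps _ rf fn hl) (convolution_reps _ rf' fn' hl).
rewrite (@convolution_reps _ _ (n + n')%N); first last.
- exact: hl.
- move=> g; case: (eqVneq (f g) 0) => [->|/fn//]; rewrite mulr0 add0r; exact: fn'.
- by move=> g k kK; rewrite rf // rf'.
rewrite mulrCA -mulrDr; congr (_ * _); rewrite mulr_sumr -big_split /=.
by apply: eq_bigr => x _; rewrite mulrDl mulrA.
Qed.

Lemma convolutionDr c f h h' : hecke_fun f -> hecke_fun h -> hecke_fun h' ->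
  convolution mu f (fun x => c * h x + h' x) = (fun y => c * convolution mu f h y + convolution mu f h' y).
Proof.
move=> hf hh hh'; apply/funext => y; have hl := hecke_fun_l hh; have hl' := hecke_fun_l hh'.
have [_ [n fn]] := hf; have rf := hecke_fun_r hf.
rewrite (convolution_reps _ rf fn hl) (convolution_reps _ rf fn hl').
rewrite (convolution_reps _ rf fn); last by move=> g k kK; rewrite hl // hl'.
rewrite mulrCA -mulrDr; congr (_ * _); rewrite mulr_sumr -big_split /=.
by apply: eq_bigr => x _; rewrite mulrDr mulrCA.
Qed.

(** Fubini reduces to the exchange of two finite sums; the inner sum over g is then translated by
    x. *)
Lemma convolutionA f1 f2 f3 : hecke_fun f1 -> hecke_fun f2 -> hecke_fun f3 ->
  convolution mu (convolution mu f1 f2) f3 = convolution mu f1 (convolution mu f2 f3).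
Proof.
move=> h1 h2 h3; apply/funext => y.
have r1 := hecke_fun_r h1; have [_ [n1 f1n]] := h1.
have r2 := hecke_fun_r h2; have l2 := hecke_fun_l h2; have [_ [n2 f2n]] := h2.
have l3 := hecke_fun_l h3.
have h12 := hecke_fun_convolution h1 h2; have h23 := hecke_fun_convolution h2 h3.
(* The bound n1 + n2 + n12 covers both the support of the inner convolution and the translates of
   the support of f2 by elements x with n(x) <= n1. *)
have [n12 f12n] := hecke_fun_bounded h12; have {}f12n := f12n (n1 + n2 + n12)%N (leq_addl _ _).
rewrite (convolution_reps _ (hecke_fun_r h12) f12n l3) (convolution_reps _ r1 f1n (hecke_fun_l h23)).
transitivity ((vol%:C)%C * \sum_(x <- reps n1) f1 x *
    ((vol%:C)%C * \sum_(g <- reps (n1 + n2 + n12)%N) f2 (x^-1 * g)%g * f3 (g^-1 * y)%g)).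
  congr (_ * _); under [RHS]eq_bigr do rewrite mulrCA mulr_sumr.
  rewrite -mulr_sumr exchange_big /= mulr_sumr; apply: eq_bigr => g _.
  rewrite (convolution_reps _ r1 f1n l2) -mulrA; congr (_ * _); rewrite mulr_suml.
  by apply: eq_bigr => x _; rewrite mulrA.
congr (_ * _); rewrite !big_seq; apply: eq_bigr => x xs; congr (_ * _).
have [_ sn _ _] := repsP n1; have xn := sn x xs.
rewrite -(@complex_integral_reps (fun g => f2 (x^-1 * g)%g * f3 (g^-1 * y)%g)); first last.
- move=> g h; have : f2 (x^-1 * g)%g != 0 by apply: contraNneq h => ->; rewrite mul0r.
  move=> /f2n gn; rewrite -(mulVKg x g); apply: (bounded_le H _ (boundedM H xn gn)); lia.
- by move=> g k kK; rewrite mulgA r2 // invgM -mulgA l3 //; apply: (GLcongV H).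
rewrite /convolution -(@complex_integral_translate (fun g => f2 g * f3 (g^-1 * (x^-1 * y))%g) n2 x).
- by congr complex_integral; apply/funext => g; rewrite invgM invgK -mulgA mulVKg.
- by move=> g k kK; rewrite r2 // invgM -mulgA l3 //; apply: (GLcongV H).
- by move=> g h; apply: f2n; apply: contraNneq h => ->; rewrite mul0r.
Qed.

End HeckeAlgebra.

(** * Correspondence of elements modulo lower powers of P *)

Record valued_truncated_iso (D D' : unitRingType) (v : D -> int) (v' : D' -> int)
    (p : D) (p' : D') (M : nat) (R0 : D -> D' -> Prop) : Prop := ValuedTruncatedIso {
  vti_l : is_valuation v;
  vti_r : is_valuation v';
  vti_neq0_l : p != 0;
  vti_neq0_r : p' != 0;
  vti_unif_l : v p = 1;
  vti_unif_r : v' p' = 1;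
  vti_iso : truncated_iso v v' p p' M R0
}.

Section TruncatedIso.
Variables (D D' : unitRingType) (v : D -> int) (v' : D' -> int) (p : D) (p' : D').
Variables (M : nat) (R0 : D -> D' -> Prop).
Hypothesis HS : valued_truncated_iso v v' p p' M R0.
Let Hv := vti_l HS.
Let Hv' := vti_r HS.
Let p0 := vti_neq0_l HS.
Let p0' := vti_neq0_r HS.
Let vp := vti_unif_l HS.
Let vp' := vti_unif_r HS.
Let HR := vti_iso HS.

Lemma tiso0 : R0 0 0.
Proof.
have [y h] := tiso_total_l HR (val_ge0 v 0).
apply: (tiso_congr HR h); rewrite sub0r (val_geN Hv') -(tiso_val_ge HR h); exact: val_ge0.
Qed.

Lemma tisoN x y : R0 x y -> R0 (- x) (- y).
Proof.
move=> xy; have nx : val_ge v 0 (- x) by rewrite (val_geN Hv); apply: (tiso_l HR xy).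
have [z xz] := tiso_total_l HR nx; apply: (tiso_congr HR xz).
have := tisoD HR xy xz; rewrite addrN => /(tiso_val_ge HR); rewrite val_ge0 => /esym h.
by rewrite -opprD (val_geN Hv') .
Qed.

Lemma tisoB x y x' y' : R0 x x' -> R0 y y' -> R0 (x - y) (x' - y').
Proof. by move=> h /tisoN; apply: (tisoD HR). Qed.

Lemma tiso_congr_l x x' y : R0 x y -> val_ge v M (x' - x) -> R0 x' y.
Proof.
move=> xy xx'; have x'0 : val_ge v 0 x'.
  rewrite -[x'](subrK x) (val_geD Hv) ?(tiso_l HR xy) //; apply: val_ge_le xx'; lia.
have [z x'z] := tiso_total_l HR x'0; apply: (tiso_congr HR x'z).
have := tisoB xy x'z; move=> /(tiso_val_ge HR) <-.
by rewrite (val_ge_sym Hv).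
Qed.

Lemma valued_truncated_iso_sym : valued_truncated_iso v' v p' p M (fun y x => R0 x y).
Proof.
split=> //; split.
- by move=> x y; apply: tiso_r HR _ _.
- by move=> x y; apply: tiso_l HR _ _.
- exact: tiso_total_r HR.
- exact: tiso_total_l HR.
- by move=> x y x' y'; apply: tisoD HR _ _ _ _.
- by move=> x y x' y'; apply: tisoM HR _ _ _ _.
- exact: tiso1 HR.
- exact: tiso_unif HR.
- by move=> x y; apply: tiso_conj HR _ _.
- by move=> x y /(tiso_val_ge HR).
- by move=> x y y'; apply: tiso_congr_l.
Qed.

(** For k <= M, the reduction modulo P^k of the isomorphism given by [R0]; k records how many digits
    of y are prescribed by x. *)
Definition tiso_mod (k : nat) (x : D) (y : D') := exists2 y', R0 x y' & val_ge v' k (y - y').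

Lemma tiso_mod0 k x y : R0 x y -> tiso_mod k x y.
Proof. by move=> xy; exists y => //; rewrite subrr val_ge0. Qed.

Lemma tiso_modM_full x y : tiso_mod M x y <-> R0 x y.
Proof.
split=> [[y' xy' yy']|]; last exact: tiso_mod0.
exact: (tiso_congr HR xy').
Qed.

Lemma tiso_unifX k : R0 (p ^+ k) (p' ^+ k).
Proof.
elim: k => [|k IHk]; first exact: (tiso1 HR).
by rewrite !exprS; apply: (tisoM HR) => //; apply: (tiso_unif HR).
Qed.

Lemma val_unifX k : v (p ^+ k) = k.
Proof. by rewrite (valuationX Hv) // vp -mulr_natr natz mul1r. Qed.

Lemma val_unifX' k : v' (p' ^+ k) = k.
Proof. by rewrite (valuationX Hv') // vp' -mulr_natr natz mul1r. Qed.

(** Multiplication by p^(M - j) reduces divisibility by P^j to the divisibility by P^M that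
    [tiso_val_ge] compares. *)
Lemma tiso_mod_val_ge (k j : nat) x y : (k <= M)%N -> (j <= k)%N -> tiso_mod k x y ->
  val_ge v j x = val_ge v' j y.
Proof.
move=> kM jk [y' xy' yy']; have {yy'}-> : val_ge v' j y = val_ge v' j y'.
  by apply: (val_ge_eqr Hv'); apply: val_ge_le yy'; lia.
have h : R0 (p ^+ (M - j) * x) (p' ^+ (M - j) * y') by apply: (tisoM HR) => //; apply: tiso_unifX.
have := tiso_val_ge HR h.
rewrite (val_geMl Hv) ?(vdiv_expf_neq0 Hv) // (val_geMl Hv') ?(vdiv_expf_neq0 Hv') //.
rewrite val_unifX val_unifX'; have -> : M%:Z - (M - j)%N%:Z = j%:Z by lia.
by [].
Qed.

Lemma tiso_mod_l k x y : tiso_mod k x y -> val_ge v 0 x.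
Proof. by move=> [y' /(tiso_l HR)]. Qed.

Lemma tiso_mod_r k x y : tiso_mod k x y -> val_ge v' 0 y.
Proof.
move=> [y' /(tiso_r HR) y'0 yy']; rewrite -[y](subrK y') (val_geD Hv') //.
by apply: val_ge_le yy'; lia.
Qed.

Lemma tiso_modD k x y x' y' : tiso_mod k x x' -> tiso_mod k y y' -> tiso_mod k (x + y) (x' + y').
Proof.
move=> [a xa ha] [b yb hb]; exists (a + b); first exact: (tisoD HR).
by rewrite opprD addrACA (val_geD Hv').
Qed.

Lemma tiso_modM k x y x' y' : tiso_mod k x x' -> tiso_mod k y y' -> tiso_mod k (x * y) (x' * y').
Proof.
move=> xx' yy'; have x'0 := tiso_mod_r xx'; have [a xa ha] := xx'; have [b yb hb] := yy'.
have b0 := tiso_r HR yb; exists (a * b); first exact: (tisoM HR).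
rewrite -(subrKA (x' * b)) -mulrBr -mulrBl.
by apply: (val_geD Hv'); [apply: (val_ge0M Hv') | apply: (val_geM0 Hv')].
Qed.

Lemma tiso_mod_congr k x y y' : tiso_mod k x y -> val_ge v' k (y' - y) -> tiso_mod k x y'.
Proof. by move=> [z xz yz] yy'; exists z => //; apply: (val_ge_trans Hv') yy' yz. Qed.

Lemma tiso_mod_le j k x y : (j <= k)%N -> tiso_mod k x y -> tiso_mod j x y.
Proof. by move=> jk [z xz yz]; exists z => //; apply: val_ge_le yz; lia. Qed.

Lemma tiso_mod_inj k x y y' : (k <= M)%N -> tiso_mod k x y -> tiso_mod k x y' -> val_ge v' k (y - y').
Proof.
move=> kM [a xa ha] [b xb hb]; apply: (val_ge_trans Hv') ha _.
have := tisoB xa xb; rewrite subrr => /(tiso_mod0 k) /(tiso_mod_val_ge kM (leqnn k)).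
by rewrite val_ge0 => /esym h; apply: (val_ge_trans Hv') h _; rewrite (val_ge_sym Hv').
Qed.

Lemma tiso_mod_congr_l k x x' y : (k <= M)%N -> tiso_mod k x y -> val_ge v k (x' - x) ->
  tiso_mod k x' y.
Proof.
move=> kM xy xx'; have x'0 : val_ge v 0 x'.
  rewrite -[x'](subrK x) (val_geD Hv) ?(tiso_mod_l xy) //; apply: val_ge_le xx'; lia.
have [z x'z] := tiso_total_l HR x'0; exists z => //.
have [y' xy' yy'] := xy; apply: (val_ge_trans Hv') yy' _.
have := tisoB xy' x'z => /(tiso_mod0 k) /(tiso_mod_val_ge kM (leqnn k)) <-.
by rewrite (val_ge_sym Hv).
Qed.

Lemma tiso_mod_sym k x y : (k <= M)%N -> tiso_mod k x y ->
  exists2 x', R0 x' y & val_ge v k (x - x').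
Proof.
move=> kM xy; have [x' x'y] := tiso_total_r HR (tiso_mod_r xy); exists x' => //.
have [y' xy' yy'] := xy.
have := tisoB xy' x'y => /(tiso_mod0 k) /(tiso_mod_val_ge kM (leqnn k)) ->.
by rewrite (val_ge_sym Hv').
Qed.

Lemma tiso_mod_unifXM k x y t j : (j <= k + t)%N -> (j <= M)%N -> tiso_mod k x y ->
  tiso_mod j (p ^+ t * x) (p' ^+ t * y).
Proof.
move=> jkt jM [y' xy' yy']; exists (p' ^+ t * y').
  by apply: (tisoM HR) => //; apply: tiso_unifX.
rewrite -mulrBr (val_geMl Hv') ?(vdiv_expf_neq0 Hv') // val_unifX'.
by apply: val_ge_le yy'; lia.
Qed.

Lemma tiso_mod_divl k x y t j : (k <= M)%N -> (j + t <= k)%N -> val_ge v 0 x ->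
  tiso_mod k (p ^+ t * x) (p' ^+ t * y) -> tiso_mod j x y.
Proof.
move=> kM jtk x0 h; have [y' xy'] := tiso_total_l HR x0.
apply: (tiso_mod_congr (tiso_mod0 j xy')).
have h' : tiso_mod k (p ^+ t * x) (p' ^+ t * y').
  by apply/tiso_mod0/(tisoM HR) => //; apply: tiso_unifX.
have := tiso_mod_inj kM h h'.
rewrite -mulrBr (val_geMl Hv') ?(vdiv_expf_neq0 Hv') // val_unifX'.
by apply: val_ge_le; lia.
Qed.

Let pzD (y z : int) : p ^ (y + z) = p ^ y * p ^ z := p_exprzD Hv p0 y z.
Let pzD' (y z : int) : p' ^ (y + z) = p' ^ y * p' ^ z := p_exprzD Hv' p0' y z.

(** Passing from p^s x to p^s' x gains s' - s digits, or loses s - s' of them; the precision is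
    capped at M. *)
Lemma tiso_mod_shift (s s' : int) (k j : nat) x y : (k <= M)%N -> (j <= M)%N ->
  j%:Z <= k%:Z + s' - s -> val_ge v 0 (p ^ s' * x) ->
  tiso_mod k (p ^ s * x) (p' ^ s * y) -> tiso_mod j (p ^ s' * x) (p' ^ s' * y).
Proof.
move=> kM jM jk x0 h; have [ss'|s's] := lerP s s'.
  have -> : s' = (`|s' - s|%N)%:Z + s by lia.
  rewrite pzD pzD' -!mulrA; apply: tiso_mod_unifXM h => //; lia.
have e : s = (`|s - s'|%N)%:Z + s' by lia.
move: h; rewrite e pzD pzD' -!mulrA; apply: tiso_mod_divl => //; lia.
Qed.

Lemma tiso_mod_conj1 k x y : (k <= M)%N -> tiso_mod k x y ->
  tiso_mod k (p^-1 * x * p) (p'^-1 * y * p').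
Proof.
move=> kM [y' xy' yy']; exists (p'^-1 * y' * p'); first exact: (tiso_conj HR).
rewrite -mulrBl -mulrBr (val_geMr Hv') // (val_geMl Hv') ?invr_eq0 //.
by rewrite (valuationV Hv') // opprK subrK.
Qed.

Lemma tiso_mod_conj1V k x y : (k <= M)%N -> tiso_mod k x y ->
  tiso_mod k (p * x * p^-1) (p' * y * p'^-1).
Proof.
move=> kM xy; set z := p * x * p^-1.
have z0 : val_ge v 0 z.
  rewrite /z (val_geMr Hv) ?invr_eq0 // (val_geMl Hv) // (valuationV Hv) // vp opprK add0r subrr.
  exact: tiso_mod_l xy.
have [w /(tiso_mod0 k) zw] := tiso_total_l HR z0; apply: (tiso_mod_congr zw).
have := tiso_mod_conj1 kM zw.
have -> : p^-1 * z * p = x by rewrite /z !mulrA (vdiv_mulVf Hv) // mul1r -mulrA (vdiv_mulVf Hv) // mulr1.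
move=> /(tiso_mod_inj kM xy).
have -> : y - p'^-1 * w * p' = p'^-1 * (p' * y * p'^-1 - w) * p'.
  rewrite mulrBr mulrBl; congr (_ - _).
  by rewrite !mulrA (vdiv_mulVf Hv') // mul1r -mulrA (vdiv_mulVf Hv') // mulr1.
rewrite (val_geMr Hv') // (val_geMl Hv') ?invr_eq0 //.
by rewrite (valuationV Hv') // opprK subrK.
Qed.

Lemma tiso_mod_conj k x y (t : int) : (k <= M)%N -> tiso_mod k x y ->
  tiso_mod k (p ^ t * x * p ^ (- t)) (p' ^ t * y * p' ^ (- t)).
Proof.
move=> kM xy; have pos (n : nat) : tiso_mod k (p ^ n * x * p ^ (- n%:Z)) (p' ^ n * y * p' ^ (- n%:Z)).
  elim: n => [|n IHn]; first by rewrite oppr0 !expr0z !mul1r !mulr1.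
  have := tiso_mod_conj1V kM IHn.
  have -> : - n.+1%:Z = - n%:Z + (- 1) by lia.
  by rewrite pzD pzD' -!exprnP !exprS !mulrA.
have neg (n : nat) : tiso_mod k (p ^ (- n%:Z) * x * p ^ n) (p' ^ (- n%:Z) * y * p' ^ n).
  elim: n => [|n IHn]; first by rewrite oppr0 !expr0z !mul1r !mulr1.
  have := tiso_mod_conj1 kM IHn.
  have -> : - n.+1%:Z = - 1 - n%:Z by lia.
  by rewrite pzD pzD' -!exprnP !exprSr !mulrA.
case: t => n; first exact: pos.
by rewrite NegzE opprK; apply: neg.
Qed.

Lemma tiso_mod_mulr k a x y : (k <= M)%N -> tiso_mod k (p ^ a * x) (p' ^ a * y) ->
  tiso_mod k (x * p ^ a) (y * p' ^ a).
Proof.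
move=> kM /(tiso_mod_conj (- a) kM).
by rewrite opprK !mulrA -pzD -pzD' addNr !expr0z !mul1r.
Qed.

(* For s - t <= K - l one can take y' = y; otherwise p^-s x p^t being integral
   makes x so divisible that y' = p'^s c' p'^-t is still congruent to y. *)
Lemma tiso_mod_adjust (l n K : nat) (s t : int) x y c' : (l <= K)%N -> (K + n <= M)%N ->
  tiso_mod (K + n) (p ^ n%:Z * x) (p' ^ n%:Z * y) ->
  tiso_mod l (p ^ (- s) * x * p ^ t) c' ->
  exists2 y', val_ge v' K (y' - y) & val_ge v' l (p' ^ (- s) * y' * p' ^ t - c').
Proof.
move=> lK KnM xy cc'; have lM : (l <= M)%N by lia.
have pzn0' z : p' ^ z != 0 := p_exprz_neq0 Hv' p0' z.
have c0 := tiso_mod_l cc'.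
have [st|st] := lerP (s - t) (K%:Z - l%:Z).
  exists y; first by rewrite subrr val_ge0.
  apply: (tiso_mod_inj lM) cc'.
  have cE : p ^ (- s) * x * p ^ t = (p ^ (- s) * x * p ^ s) * p ^ (t - s).
    by rewrite -[RHS]mulrA -pzD [s + _]addrC subrK.
  have cE' : p' ^ (- s) * y * p' ^ t = (p' ^ (- s) * y * p' ^ s) * p' ^ (t - s).
    by rewrite -[RHS]mulrA -pzD' [s + _]addrC subrK.
  rewrite cE cE'; apply: tiso_mod_mulr => //.
  apply: (tiso_mod_shift (s := n) KnM lM); first by lia.
    rewrite cE (val_geMr Hv) ?(p_exprz_neq0 Hv) // in c0.
    by rewrite (val_geMl Hv) ?(p_exprz_neq0 Hv).
  have := tiso_mod_conj (- s) KnM xy; rewrite opprK !mulrA -!pzD -!pzD' [- s + _]addrC.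
  by [].
exists (p' ^ s * c' * p' ^ (- t)); last first.
  by rewrite !mulrA -pzD' addNr expr0z mul1r -mulrA -pzD' addNr expr0z mulr1 subrr val_ge0.
set y' := _ * _ * _; set c := p ^ (- s) * x * p ^ t in cc' c0.
have xE : x = (p ^ s * c * p ^ (- s)) * p ^ (s - t).
  rewrite /c -[RHS]mulrA -pzD addrA addNr add0r !mulrA -pzD subrr expr0z mul1r.
  by rewrite -mulrA -pzD subrr expr0z mulr1.
have yE : y' = (p' ^ s * c' * p' ^ (- s)) * p' ^ (s - t).
  by rewrite /y' -[RHS]mulrA -pzD' addrA addNr add0r.
(* As c is known modulo P^l and s - t > K - l, the product p^n x = p^n (p^s c p^-s) p^(s-t) is known
   modulo P^(K + n). *)
have h : tiso_mod (K + n) (p ^ n%:Z * x) (p' ^ n%:Z * y').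
  rewrite xE yE [X in tiso_mod _ X]mulrA [X in tiso_mod _ _ X]mulrA.
  apply: tiso_mod_mulr => //; rewrite [X in tiso_mod _ X]mulrA [X in tiso_mod _ _ X]mulrA -pzD -pzD'.
  have hc := tiso_mod_conj s lM cc'.
  apply: (tiso_mod_shift (s := 0) lM KnM); first by lia.
    rewrite (val_geMl Hv) ?(p_exprz_neq0 Hv) // (val_p_exprz Hv) //.
    by apply: val_ge_le (tiso_mod_l hc); lia.
  by rewrite !expr0z !mul1r.
have := tiso_mod_inj KnM h xy; rewrite -mulrBr (val_geMl Hv') // (val_p_exprz Hv') //.
by apply: val_ge_le; lia.
Qed.

End TruncatedIso.

(** * Transfer between close fields *)

Section CongruenceDoubleCosets.
Variables (F : localFieldType) (D : falgType F) (r : nat) (v : D -> int) (p : D).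
Hypothesis H : is_normalized_valuation v p.
Variable N : nat.
Hypothesis N0 : (0 < N)%N.
Local Notation G := (GL D r).
Local Notation K := (@GLcong F D r N).
Implicit Types g h x y : G.

Lemma dcoset_refl g : dcoset K g g.
Proof. by exists 1%g, 1%g; rewrite mul1g mulg1; split=> //; apply: (GLcong1 H). Qed.

Lemma dcoset_sym g h : dcoset K g h -> dcoset K h g.
Proof.
move=> [k1 [k2 [h1 h2 ->]]]; exists k1^-1%g, k2^-1%g; split; try exact: (GLcongV H).
by rewrite !mulgA mulVg mul1g mulgK.
Qed.

Lemma dcoset_trans g h x : dcoset K g h -> dcoset K h x -> dcoset K g x.
Proof.
move=> [k1 [k2 [h1 h2 ->]]] [k3 [k4 [h3 h4 ->]]].
exists (k3 * k1)%g, (k2 * k4)%g; split; try exact: (GLcongM H).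
by rewrite !mulgA.
Qed.

Lemma dcoset_mulr g k : K k -> dcoset K g (g * k)%g.
Proof. by move=> kK; exists 1%g, k; rewrite mul1g; split=> //; apply: (GLcong1 H). Qed.

Lemma dcoset_congr g h x : dcoset K g h -> (dcoset K x g <-> dcoset K x h).
Proof. by move=> gh; split=> [/dcoset_trans|h1]; [apply | apply: dcoset_trans h1 (dcoset_sym gh)]. Qed.

Lemma dcoset_bounded n g h : bounded v n g -> dcoset K g h -> bounded v n h.
Proof.
move=> gn [k1 [k2 [h1 h2 ->]]].
by apply: (bounded_GLOr H); [apply: (bounded_GLOl H) => // |]; apply: (GLcong_GLO H N0).
Qed.

End CongruenceDoubleCosets.

(** * Corresponding matrices and double cosets *)

Section GLTransfer.
Variables (F F' : localFieldType) (D : falgType F) (D' : falgType F') (r : nat).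
Variables (v : D -> int) (v' : D' -> int) (p : D) (p' : D').
Hypotheses (H : is_normalized_valuation v p) (H' : is_normalized_valuation v' p').
Variables (M N : nat) (R0 : D -> D' -> Prop).
Hypothesis HR : truncated_iso v v' p p' M R0.
Hypotheses (N0 : (0 < N)%N) (NM : (N + 4 <= M)%N).
Let Hv := nval_valuation H.
Let Hv' := nval_valuation H'.
Let p0 := nval_unif_neq0 H.
Let p0' := nval_unif_neq0 H'.
Let vp := nval_unif H.
Let vp' := nval_unif H'.
Let HS : valued_truncated_iso v v' p p' M R0 := ValuedTruncatedIso Hv Hv' p0 p0' vp vp' HR.
Local Notation G := (GL D r).
Local Notation G' := (GL D' r).
Local Notation K := (@GLcong F D r N).
Local Notation K' := (@GLcong F' D' r N).
Local Notation pd a := (gl_pdiag (r := r) H a).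
Local Notation pd' a := (gl_pdiag (r := r) H' a).

Definition mx_corr (k : nat) m n (X : 'M[D]_(m, n)) (X' : 'M[D']_(m, n)) :=
  forall i j, tiso_mod v' R0 k (X i j) (X' i j).

Lemma mx_corrM k m n q (X : 'M[D]_(m, n)) X' (Y : 'M[D]_(n, q)) Y' :
  mx_corr k X X' -> mx_corr k Y Y' -> mx_corr k (X *m Y) (X' *m Y').
Proof.
move=> XX' YY' i j; rewrite !mxE.
elim: (index_enum _) => [|t s IHs].
  by rewrite !big_nil; apply/tiso_mod0/(tiso0 HS).
by rewrite !big_cons; apply: (tiso_modD HS) => //; apply: (tiso_modM HS).
Qed.

Lemma mx_corr1 k n : mx_corr k (1%:M : 'M[D]_n) 1%:M.
Proof.
move=> i j; rewrite !mxE; apply: tiso_mod0; case: (_ == _).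
  exact: (tiso1 HR).
exact: (tiso0 HS).
Qed.

Lemma mx_corr_congr k m n (X : 'M[D]_(m, n)) X' Y' :
  mx_corr k X X' -> mx_ge v' k (Y' - X') -> mx_corr k X Y'.
Proof.
move=> XX' YX i j; apply: (tiso_mod_congr HS (XX' i j)).
by have := YX i j; rewrite !mxE.
Qed.

Lemma mx_corr_congr_l k m n (X Y : 'M[D]_(m, n)) X' : (k <= M)%N ->
  mx_corr k X X' -> mx_ge v k (Y - X) -> mx_corr k Y X'.
Proof.
move=> kM XX' YX i j; apply: (tiso_mod_congr_l HS kM (XX' i j)).
by have := YX i j; rewrite !mxE.
Qed.

Lemma mx_corr_inj k m n (X : 'M[D]_(m, n)) X' Y' : (k <= M)%N ->
  mx_corr k X X' -> mx_corr k X Y' -> mx_ge v' k (X' - Y').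
Proof.
move=> kM XX' XY' i j; rewrite !mxE.
exact: (tiso_mod_inj HS kM (XX' i j) (XY' i j)).
Qed.

Lemma mx_corr_le j k m n (X : 'M[D]_(m, n)) X' : (j <= k)%N -> mx_corr k X X' -> mx_corr j X X'.
Proof. by move=> jk XX' a b; apply: (tiso_mod_le HS jk). Qed.

Lemma mx_corr_total k m n (X : 'M[D]_(m, n)) : mx_ge v 0 X -> exists X', mx_corr k X X'.
Proof.
move=> X0; have /choice[f fP] (ij : 'I_m * 'I_n) : exists y, R0 (X ij.1 ij.2) y.
  exact: (tiso_total_l HR).
by exists (\matrix_(i, j) f (i, j)) => i j; rewrite mxE; apply: tiso_mod0; apply: (fP (i, j)).
Qed.

Lemma mx_corr_ge0 k m n (X : 'M[D]_(m, n)) X' : mx_corr k X X' -> mx_ge v' 0 X'.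
Proof. by move=> XX' i j; apply: (tiso_mod_r HS (XX' i j)). Qed.

Lemma GLO_corrV k (g : G) (g' : G') : (k <= M)%N -> GLO g -> GLO g' ->
  mx_corr k (glmx g) (glmx g') -> mx_corr k (glmx g^-1%g) (glmx g'^-1%g).
Proof.
move=> kM gO g'O gg'.
have [h' hh'] := mx_corr_total k (GLO_ge0 H (GLOV H gO)).
apply: (mx_corr_congr hh').
have -> : glmx g'^-1%g - h' = glmx g'^-1%g *m (1%:M - glmx g' *m h').
  by rewrite mulmxBr mulmx1 mulmxA glmxVl mul1mx.
apply: (mx_ge0M Hv'); first exact/(GLO_ge0 H')/(GLOV H').
have e : mx_corr k 1%:M (glmx g' *m h') by rewrite -(glmxV g); apply: mx_corrM.
exact: (mx_corr_inj kM (@mx_corr1 k r) e).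
Qed.

(** Entrywise lifts X of g and Z of g^-1 satisfy XZ = ZX = 1 modulo P^M, which makes X invertible
    with an integral inverse. *)
Lemma GLO_lift (g : G) : GLO g -> exists2 g' : G', GLO g' & mx_corr M (glmx g) (glmx g').
Proof.
move=> gO; have [X XP] := mx_corr_total M (GLO_ge0 H gO).
have [Z ZP] := mx_corr_total M (GLO_ge0 H (GLOV H gO)).
have M1 : (1%:Z <= M%:Z) by lia.
have e1 : mx_ge v' M (X *m Z - 1%:M).
  have e : mx_corr M 1%:M (X *m Z) by rewrite -(glmxV g); apply: mx_corrM.
  exact: (mx_corr_inj (leqnn M) e (@mx_corr1 M r)).
have e2 : mx_ge v' M (Z *m X - 1%:M).
  have e : mx_corr M 1%:M (Z *m X) by rewrite -(glmxVl g); apply: mx_corrM.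
  exact: (mx_corr_inj (leqnn M) e (@mx_corr1 M r)).
have [u uE] : exists u : G', glmx u = X *m Z.
  by apply: invertible_GL; apply: (invertible_congr1 Hv'); apply: mx_ge_le e1.
have [w wE] : exists w : G', glmx w = Z *m X.
  by apply: invertible_GL; apply: (invertible_congr1 Hv'); apply: mx_ge_le e2.
have XR : X *m (Z *m glmx u^-1%g) = 1%:M by rewrite mulmxA -uE glmxV.
have XL : (glmx w^-1%g *m Z) *m X = 1%:M by rewrite -mulmxA -wE glmxVl.
have LR : glmx w^-1%g *m Z = Z *m glmx u^-1%g.
  by rewrite -[LHS]mulmx1 -XR mulmxA XL mul1mx.
have [g' g'X] : exists g' : G', glmx g' = X.
  by apply: invertible_GL; exists (Z *m glmx u^-1%g); rewrite XR -LR XL.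
have uO : GLO u by apply: (GLcong_GLO H' (k := M)); [lia | apply/(GLcongE H'); rewrite uE].
exists g'; last by rewrite g'X.
apply/(GLO_bounded H'); split; rewrite oppr0.
  by rewrite g'X; apply: mx_corr_ge0 XP.
have -> : glmx g'^-1%g = Z *m glmx u^-1%g.
  by rewrite -[LHS]mulmx1 -XR mulmxA -g'X glmxVl mul1mx.
apply: (mx_ge0M Hv'); first exact: mx_corr_ge0 ZP.
exact/(GLO_ge0 H')/(GLOV H').
Qed.

(* The correspondence of double cosets realized by zeta on characteristic functions. *)
Definition gl_corr (g : G) (g' : G') := exists a B C B' C',
  [/\ GLO B /\ GLO C, GLO B' /\ GLO C',
      mx_corr N (glmx B) (glmx B') /\ mx_corr N (glmx C) (glmx C'),
      dcoset K (B * pd a * C^-1)%g g & dcoset K' (B' * pd' a * C'^-1)%g g'].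

(** The entries of c are p^(-a2) h p^a1. By [tiso_mod_adjust], h' can be moved within its class
    modulo P^K0 until p'^(-a2) h' p'^a1 is congruent to c' modulo P^N; [GL_approx] turns both
    congruences into factors in K'. The exponents a1 and a2 are unrestricted, and the inequalities
    on N, n, K0 and M do not involve them. *)
Lemma GL_adjust (n K0 : nat) (h : G) (h' : G') (a1 a2 : 'I_r -> int) (c : G) (c' : G') :
  (N + n <= K0)%N -> (K0 + n <= M)%N -> bounded v' n h' ->
  (forall i j, tiso_mod v' R0 (K0 + n) (p ^ n%:Z * glmx h i j) (p' ^ n%:Z * glmx h' i j)) ->
  GLO c' -> mx_corr N (glmx c) (glmx c') -> (h * pd a1 = pd a2 * c)%g ->
  exists k1 k2, [/\ K' k1, K' k2 & (k1 * h' * pd' a1 = pd' a2 * c' * k2)%g].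
Proof.
move=> NK KM h'n hh' c'O cc' hc.
have cE i j : glmx c i j = p ^ (- a2 i) * glmx h i j * p ^ (a1 j).
  have -> : c = ((pd a2)^-1 * h * pd a1)%g by rewrite -mulgA hc mulKg.
  by rewrite !glmxM gl_pdiagV gl_pdiagE pdiag_conjE.
have /choice[Y YP] (ij : 'I_r * 'I_r) : exists y',
    val_ge v' K0 (y' - glmx h' ij.1 ij.2) /\
    val_ge v' N (p' ^ (- a2 ij.1) * y' * p' ^ (a1 ij.2) - glmx c' ij.1 ij.2).
  have cij := cc' ij.1 ij.2; rewrite cE in cij.
  have [|y' y1 y2] := tiso_mod_adjust HS _ KM (hh' ij.1 ij.2) cij.
    by lia.
  by exists y'.
pose Z := \matrix_(i, j) Y (i, j).
have Zh : mx_ge v' K0 (Z - glmx h') by move=> i j; rewrite !mxE; have [] := YP (i, j).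
have [|h2 [h2E h2K _]] := GL_approx H' N0 _ h'n Zh; first by lia.
have c2c : mx_ge v' N (glmx ((pd' a2)^-1 * h2 * pd' a1)%g - glmx c').
  move=> i j; rewrite [(_ - _ : 'M[D']_r) i j]mxE [X in _ + X]mxE !glmxM gl_pdiagV gl_pdiagE.
  by rewrite pdiag_conjE h2E mxE; have [] := YP (i, j).
have c'0 := iffLR (GLO_bounded H' c') c'O.
have [|c2 [c2E _ c2K]] := GL_approx H' N0 _ c'0 c2c; first by lia.
have {}c2E := glmx_inj c2E; exists (h2 * h'^-1)%g, (c'^-1 * c2)%g; split=> //.
by rewrite c2E mulgVK -!mulgA !mulVKg.
Qed.

(** Well-definedness of zeta on double cosets. An equality k B1 p^a1 C1^-1 kt = B2 p^a2 C2^-1 reads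
    h p^a1 = p^a2 c with h and c in GL_r(O), so that [GL_adjust] applies with n = 0 and K0 = N. *)
Lemma gl_corr_dcoset g1 g1' g2 g2' : gl_corr g1 g1' -> gl_corr g2 g2' ->
  dcoset K g1 g2 -> dcoset K' g1' g2'.
Proof.
move=> [a1 [B1 [C1 [B1' [C1' [[B1O C1O] [B1'O C1'O] [B11 C11] g1E g1'E]]]]]].
move=> [a2 [B2 [C2 [B2' [C2' [[B2O C2O] [B2'O C2'O] [B22 C22] g2E g2'E]]]]]] g12.
have NleM : (N <= M)%N by lia.
suff : dcoset K' (B2' * pd' a2 * C2'^-1)%g (B1' * pd' a1 * C1'^-1)%g.
  move=> /(dcoset_sym H' N0) h; apply: (dcoset_trans H' N0) (dcoset_sym H' N0 g1'E) _.
  exact: (dcoset_trans H' N0) h g2'E.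
have [k [kt [kK ktK e]]] : dcoset K (B1 * pd a1 * C1^-1)%g (B2 * pd a2 * C2^-1)%g.
  apply: (dcoset_trans H N0) g1E _; apply: (dcoset_trans H N0) g12 _; exact: (dcoset_sym H N0).
pose h := (B2^-1 * k * B1)%g; pose c := (C2^-1 * kt^-1 * C1)%g.
have hc : (h * pd a1 = pd a2 * c)%g.
  apply: (mulgI B2); apply: (mulIg (C1^-1 * kt)%g).
  rewrite /h /c !mulgA mulgV mul1g !(mulgK, mulgVK). by rewrite e !mulgA.
have corrV (B : G) (B' : G') : GLO B -> GLO B' -> mx_corr N (glmx B) (glmx B') -> mx_corr N (glmx B^-1%g) (glmx B'^-1%g).
  by move=> BO B'O BB'; have := GLO_corrV NleM BO B'O BB'.
have corrK k3 : K k3 -> mx_corr N (glmx k3) (1%:M : 'M[D']_r).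
  by move=> /(GLcongE H) k3K; apply: (mx_corr_congr_l NleM (@mx_corr1 N r)).
have hh' : mx_corr N (glmx h) (glmx (B2'^-1 * B1')%g).
  rewrite !glmxM; apply: mx_corrM => //; rewrite -[glmx B2'^-1%g]mulmx1.
  by apply: mx_corrM; [exact: corrV | exact: corrK].
have cc' : mx_corr N (glmx c) (glmx (C2'^-1 * C1')%g).
  rewrite !glmxM; apply: mx_corrM => //; rewrite -[glmx C2'^-1%g]mulmx1.
  by apply: mx_corrM; [exact: corrV | apply/corrK/(GLcongV H)].
have h'0 : bounded v' 0%N (B2'^-1 * B1')%g.
  by apply/(GLO_bounded H'); apply: (GLOM H') => //; apply: (GLOV H').
have c'O : GLO (C2'^-1 * C1')%g by apply: (GLOM H') => //; apply: (GLOV H').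
have [||i j|k1 [k2 [k1K k2K e']]] := GL_adjust (K0 := N) _ _ h'0 _ c'O cc' hc.
- by lia.
- by lia.
- by rewrite addn0 !expr0z !mul1r.
exists (B2' * k1^-1 * B2'^-1)%g, (C1' * k2 * C1'^-1)%g; split.
- by apply: (GLcong_conj H') => //; apply: (GLcongV H').
- exact: (GLcong_conj H').
apply: (mulIg C1'); apply: (mulgI (B2' * k1 * B2'^-1)%g).
have -> : (B2' * k1 * B2'^-1 * (B1' * pd' a1 * C1'^-1 * C1') = B2' * (k1 * (B2'^-1 * B1') * pd' a1))%g.
  by rewrite mulgVK !mulgA.
by rewrite e' !mulgA !(mulgVK, mulgK).
Qed.

(** For matrices whose denominators are cleared by p^n: the entries of X and X' correspond to
    precision M - n. *)
Definition appr_mx (n : nat) (X : 'M[D]_r) (X' : 'M[D']_r) :=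
  forall i j, R0 (p ^+ n * X i j) (p' ^+ n * X' i j).

Definition appr (n : nat) (g : G) (g' : G') :=
  appr_mx n (glmx g) (glmx g') /\ appr_mx n (glmx g^-1%g) (glmx g'^-1%g).

Lemma R0_sum (I : Type) (s : seq I) f f' : (forall i, R0 (f i) (f' i)) ->
  R0 (\sum_(i <- s) f i) (\sum_(i <- s) f' i).
Proof.
move=> ff'; elim: s => [|i s IHs]; first by rewrite !big_nil; apply: (tiso0 HS).
by rewrite !big_cons; apply: (tisoD HR).
Qed.

(** In p^(m + n) X Y = (p^n (p^m X) p^(-n)) (p^n Y) the first factor is a conjugate, which is why
    truncated isomorphisms are required to respect conjugation by p. *)
Lemma appr_mxM m n X X' Y Y' : appr_mx m X X' -> appr_mx n Y Y' ->
  appr_mx (m + n) (X *m Y) (X' *m Y').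
Proof.
move=> XX' YY' i j; rewrite !mxE !mulr_sumr; apply: R0_sum => k.
have xx : R0 (p ^ n * (p ^+ m * X i k) * p ^ (- n%:Z)) (p' ^ n * (p' ^+ m * X' i k) * p' ^ (- n%:Z)).
  apply/(tiso_modM_full HS); apply: (tiso_mod_conj HS) => //.
  exact/(tiso_modM_full HS).
have := tisoM HR xx (YY' k j); rewrite -!exprnP -!exprnN.
have -> : p ^+ n * (p ^+ m * X i k) * p ^- n * (p ^+ n * Y k j) = p ^+ (m + n) * (X i k * Y k j).
  by rewrite (addnC m) exprD -!mulrA (mulrA (p ^- n)) (vdiv_mulVf Hv) ?(vdiv_expf_neq0 Hv) // mul1r.
have -> // : p' ^+ n * (p' ^+ m * X' i k) * p' ^- n * (p' ^+ n * Y' k j) = p' ^+ (m + n) * (X' i k * Y' k j).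
by rewrite (addnC m) exprD -!mulrA (mulrA (p' ^- n)) (vdiv_mulVf Hv') ?(vdiv_expf_neq0 Hv') // mul1r.
Qed.

Lemma apprM m n g g' h h' : appr m g g' -> appr n h h' -> appr (m + n) (g * h)%g (g' * h')%g.
Proof.
move=> [g1 g2] [h1 h2]; split; first exact: appr_mxM.
by rewrite !invgM addnC; apply: appr_mxM.
Qed.

Lemma apprV n g g' : appr n g g' -> appr n g^-1%g g'^-1%g.
Proof. by move=> [h1 h2]; split=> //; rewrite !invgK. Qed.

Lemma appr_GLO0 g g' : GLO g -> GLO g' -> mx_corr M (glmx g) (glmx g') -> appr 0 g g'.
Proof.
move=> gO g'O gg'; have gV := GLO_corrV (leqnn M) gO g'O gg'.
by split=> i j; rewrite !expr0 !mul1r; apply/(tiso_modM_full HS).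
Qed.

Lemma appr_pdiag (n : nat) (a : 'I_r -> int) : (forall i, - n%:Z <= a i <= n%:Z) -> appr n (pd a) (pd' a).
Proof.
have aux (b : 'I_r -> int) : (forall i, - n%:Z <= b i <= n%:Z) -> appr_mx n (pdiag p b) (pdiag p' b).
  move=> bn i j; rewrite !mxE; case: eqP => [->|_]; last by rewrite !mulr0; apply: (tiso0 HS).
  rewrite !mulr1n !exprnP -(p_exprzD Hv p0) -(p_exprzD Hv' p0').
  have -> : n%:Z + b j = Posz (absz (n%:Z + b j)) by have := bn j; lia.
  exact: (tiso_unifX HS).
by move=> an; split; [exact: aux | apply: aux => i; have := an i; lia].
Qed.

(** An entrywise lift would not control the inverse; the factors of a Cartan decomposition are
    lifted instead. *)
Lemma appr_total n g : bounded v n%:Z g -> exists g', appr n g g'.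
Proof.
have [a [B [C [_ BO CO ->]]]] := cartan H g.
move=> /(cartan_bounded H _ _ BO CO) /(gl_pdiag_bounded H) an.
have [B' B'O BB'] := GLO_lift BO; have [C' C'O CC'] := GLO_lift CO.
exists (B' * pd' a * C'^-1)%g; rewrite -[n]addn0; apply: apprM; last exact/apprV/appr_GLO0.
by rewrite -[n]add0n; apply: apprM; [exact: appr_GLO0 | exact: appr_pdiag].
Qed.

Lemma appr_mx_bounded n X X' : appr_mx n X X' -> mx_ge v' (- n%:Z) X'.
Proof.
move=> XX' i j; have := tiso_r HR (XX' i j).
by rewrite (val_geMl Hv') ?(vdiv_expf_neq0 Hv') // (val_unifX' HS) // sub0r.
Qed.

Lemma appr_bounded n g g' : appr n g g' -> bounded v' n g'.
Proof. by move=> [/appr_mx_bounded h1 /appr_mx_bounded h2]; split. Qed.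

Lemma appr1 n : appr n (1%g : G) (1%g : G').
Proof.
split; rewrite ?invg1 => i j; apply: (tisoM HR); first exact: (tiso_unifX HS).
- by apply/(tiso_modM_full HS); rewrite !glmx1; apply: mx_corr1.
- exact: (tiso_unifX HS).
- by apply/(tiso_modM_full HS); rewrite !glmx1; apply: mx_corr1.
Qed.

Lemma appr_mx_val_ge n k X X' : (n + k <= M)%N -> appr_mx n X X' -> (mx_ge v k X <-> mx_ge v' k X').
Proof.
move=> nkM XX'.
have e i j : val_ge v k (X i j) = val_ge v' k (X' i j).
  have := tiso_mod_val_ge HS (leqnn M) nkM (iffRL (tiso_modM_full HS _ _) (XX' i j)).
  rewrite (val_geMl Hv) ?(vdiv_expf_neq0 Hv) // (val_geMl Hv') ?(vdiv_expf_neq0 Hv') //.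
  by rewrite (val_unifX HS) (val_unifX' HS) PoszD addrC addKr.
by split=> h i j; have := h i j; rewrite e.
Qed.

Lemma appr_GLcong n g g' : (n + N <= M)%N -> appr n g g' -> (K g <-> K' g').
Proof.
move=> nM [gg' _]; have [one _] := appr1 n.
rewrite (GLcongE H) (GLcongE H'); apply: (appr_mx_val_ge nM) => i j.
by have := one i j; rewrite !mxE !mulrBr; apply: (tisoB HS).
Qed.

Lemma appr_GLO n g g' : (n <= M)%N -> appr n g g' -> (GLO g <-> GLO g').
Proof.
move=> nM [g1 g2]; rewrite (GLO_bounded H) (GLO_bounded H') /bounded oppr0.
by split=> -[h1 h2]; split; apply/(appr_mx_val_ge (k := 0) _ g1) || apply/(appr_mx_val_ge (k := 0) _ g2); rewrite ?addn0.
Qed.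

(** The Cartan decomposition of h p^a is lifted, and [GL_adjust] with K0 = M - n places h' p'^a in
    the double coset of the lift. Its two conditions, N + n <= K0 and K0 + n <= M, combine to 2n + N
    <= M. *)
Lemma gl_corr_mul_pdiag n h h' a C C' : (n + n + N <= M)%N -> appr n h h' ->
  GLO C -> GLO C' -> mx_corr N (glmx C) (glmx C') ->
  gl_corr (h * pd a * C^-1)%g (h' * pd' a * C'^-1)%g.
Proof.
move=> nM hh' CO C'O CC'.
have [a2 [B2 [C2 [_ B2O C2O e]]]] := cartan H (h * pd a)%g.
have [B2' B2'O BB2] := GLO_lift B2O; have [C2' C2'O CC2] := GLO_lift C2O.
have NleM : (N <= M)%N by lia.
have CV : mx_corr N (glmx C2^-1%g) (glmx C2'^-1%g).
  by apply: GLO_corrV => //; apply: mx_corr_le CC2.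
have h2 : appr n (B2^-1 * h)%g (B2'^-1 * h')%g.
  by rewrite -[n]add0n; apply: apprM => //; apply/apprV/appr_GLO0.
have hc : (B2^-1 * h * pd a = pd a2 * C2^-1)%g by rewrite -mulgA e !mulgA mulVg mul1g.
have [||i j|k1 [k2 [k1K k2K e']]] :=
  GL_adjust (K0 := M - n) (n := n) _ _ (appr_bounded h2) _ (GLOV H' C2'O) CV hc.
- by lia.
- by lia.
- by rewrite -!exprnP; apply: tiso_mod0; case: h2 => /(_ i j).
exists a2, B2, (C * C2)%g, B2', (C' * C2')%g; split.
- by split=> //; apply: (GLOM H).
- by split=> //; apply: (GLOM H').
- split; first exact: mx_corr_le BB2.
  by rewrite !glmxM; apply: mx_corrM => //; apply: mx_corr_le CC2.
- by rewrite e invgM !mulgA; apply: (dcoset_refl H).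
exists (B2' * k1^-1 * B2'^-1)%g, (C' * k2 * C'^-1)%g; split.
- by apply: (GLcong_conj H') => //; apply: (GLcongV H').
- exact: (GLcong_conj H').
have -> : (h' * pd' a = B2' * k1^-1 * (pd' a2 * C2'^-1 * k2))%g.
  by rewrite -e' !mulgA mulgVK mulgV mul1g.
by rewrite invgM !mulgA !mulgVK.
Qed.

Lemma gl_corr_mul n h h' a B C B' C' : (n + n + N <= M)%N -> appr n h h' ->
  GLO B -> GLO C -> GLO B' -> GLO C' -> mx_corr M (glmx B) (glmx B') -> mx_corr N (glmx C) (glmx C') ->
  gl_corr (h * (B * pd a * C^-1))%g (h' * (B' * pd' a * C'^-1))%g.
Proof.
move=> nM hh' BO CO B'O C'O BB' CC'; rewrite !mulgA; apply: (@gl_corr_mul_pdiag n) => //.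
by rewrite -[n]addn0; apply: apprM => //; apply: appr_GLO0.
Qed.

Lemma gl_corr_lift a B C B' C' :
  GLO B -> GLO C -> GLO B' -> GLO C' -> mx_corr N (glmx B) (glmx B') -> mx_corr N (glmx C) (glmx C') ->
  gl_corr (B * pd a * C^-1)%g (B' * pd' a * C'^-1)%g.
Proof.
move=> BO CO B'O C'O BB' CC'; exists a, B, C, B', C'; split=> //.
- exact: (dcoset_refl H).
- exact: (dcoset_refl H').
Qed.

Lemma gl_corr_total g : exists g', gl_corr g g'.
Proof.
have [a [B [C [_ BO CO ->]]]] := cartan H g.
have [B' B'O BB'] := GLO_lift BO; have [C' C'O CC'] := GLO_lift CO.
exists (B' * pd' a * C'^-1)%g; apply: gl_corr_lift => //; apply: mx_corr_le (BB') || apply: mx_corr_le (CC'); lia.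
Qed.

Lemma gl_corr_congr g1 g1' g2 g2' : gl_corr g1 g1' -> dcoset K g1 g2 -> dcoset K' g1' g2' -> gl_corr g2 g2'.
Proof.
move=> [a [B [C [B' [C' [BC BC' BB' g1E g1'E]]]]]] g12 g12'; exists a, B, C, B', C'; split=> //.
  exact: (dcoset_trans H N0) g1E g12.
exact: (dcoset_trans H' N0) g1'E g12'.
Qed.

Lemma gl_corr_bounded n g g' : gl_corr g g' -> bounded v n g -> bounded v' n g'.
Proof.
move=> [a [B [C [B' [C' [[BO CO] [B'O C'O] _ gE g'E]]]]]] gn.
apply: (dcoset_bounded H' N0) g'E; apply/(cartan_bounded H' _ _ B'O C'O)/(gl_pdiag_bounded H').
apply/(gl_pdiag_bounded H)/(cartan_bounded H n a BO CO).
exact: (dcoset_bounded H N0) gn (dcoset_sym H N0 gE).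
Qed.

End GLTransfer.

Section GLTransferSym.
Variables (F F' : localFieldType) (D : falgType F) (D' : falgType F') (r : nat).
Variables (v : D -> int) (v' : D' -> int) (p : D) (p' : D').
Hypotheses (H : is_normalized_valuation v p) (H' : is_normalized_valuation v' p').
Variables (M N : nat) (R0 : D -> D' -> Prop).
Hypothesis HR : truncated_iso v v' p p' M R0.
Hypotheses (N0 : (0 < N)%N) (NM : (N + 4 <= M)%N).
Let Hv := nval_valuation H.
Let Hv' := nval_valuation H'.
Let HS : valued_truncated_iso v v' p p' M R0 :=
  ValuedTruncatedIso Hv Hv' (nval_unif_neq0 H) (nval_unif_neq0 H') (nval_unif H) (nval_unif H') HR.
Local Notation R0' := (fun y x => R0 x y).
Local Notation G := (GL D r).
Local Notation G' := (GL D' r).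
Local Notation K := (@GLcong F D r N).
Local Notation K' := (@GLcong F' D' r N).
Local Notation corr := (@gl_corr F F' D D' r v v' p p' H H' N R0).
Local Notation appr := (@appr F F' D D' r p p' R0).

Lemma truncated_iso_sym : truncated_iso v' v p' p M R0'.
Proof. exact: vti_iso (valued_truncated_iso_sym HS). Qed.

Lemma mx_corr_sym k m n (X : 'M[D]_(m, n)) (X' : 'M[D']_(m, n)) : (k <= M)%N ->
  mx_corr v' R0 k X X' -> mx_corr v R0' k X' X.
Proof. by move=> kM XX' i j; apply: (tiso_mod_sym HS kM). Qed.

Lemma gl_corr_sym g g' : corr g g' -> gl_corr H' H N R0' g' g.
Proof.
have NleM : (N <= M)%N by lia.
move=> [a [B [C [B' [C' [BC BC' [BB' CC'] gE g'E]]]]]]; exists a, B', C', B, C; split=> //.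
by split; apply: mx_corr_sym.
Qed.

Lemma gl_corr_dcoset_iff g1 g1' g2 g2' : corr g1 g1' -> corr g2 g2' ->
  (dcoset K g1 g2 <-> dcoset K' g1' g2').
Proof.
move=> h1 h2; split; first exact: (gl_corr_dcoset HR N0 NM h1 h2).
exact: (gl_corr_dcoset truncated_iso_sym N0 NM (gl_corr_sym h1) (gl_corr_sym h2)).
Qed.

(** In contrast to [gl_corr], the Cartan factors correspond to full precision M and their products
    are g and g' themselves, not merely up to K. Such pairs can be multiplied on the left by
    approximations, as in [appr_full_corr]. *)
Definition full_corr (g : G) (g' : G') := exists a B C B' C',
  [/\ GLO B /\ GLO C, GLO B' /\ GLO C',
      mx_corr v' R0 M (glmx B) (glmx B') /\ mx_corr v' R0 M (glmx C) (glmx C'),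
      g = (B * gl_pdiag H a * C^-1)%g & g' = (B' * gl_pdiag H' a * C'^-1)%g].

Lemma full_corr_total g : exists g', full_corr g g'.
Proof.
have [a [B [C [_ BO CO ->]]]] := cartan H g.
have [B' B'O BB'] := GLO_lift H H' HR N0 NM BO; have [C' C'O CC'] := GLO_lift H H' HR N0 NM CO.
by exists (B' * gl_pdiag H' a * C'^-1)%g, a, B, C, B', C'.
Qed.

Lemma appr_full_corr n h h' g g' : (n + n + N <= M)%N -> appr n h h' -> full_corr g g' ->
  corr (h * g)%g (h' * g')%g.
Proof.
move=> nM hh' [a [B [C [B' [C' [[BO CO] [B'O C'O] [BB' CC'] -> ->]]]]]].
apply: (@gl_corr_mul _ _ _ _ _ _ _ _ _ H H' M N R0 HR N0 NM n) => //.
by move=> i j; apply: (tiso_mod_le HS _ (CC' i j)); lia.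
Qed.

Lemma full_corr_gl_corr g g' : full_corr g g' -> corr g g'.
Proof.
by move=> h; rewrite -(mul1g g) -(mul1g g'); apply: (@appr_full_corr 0) h;
  [lia | exact: (appr1 r H H' HR)].
Qed.

Lemma full_corr_sym g g' : full_corr g g' ->
  exists a B C B' C', [/\ GLO B /\ GLO C, GLO B' /\ GLO C',
      mx_corr v R0' M (glmx B) (glmx B') /\ mx_corr v R0' M (glmx C) (glmx C'),
      g' = (B * gl_pdiag H' a * C^-1)%g & g = (B' * gl_pdiag H a * C'^-1)%g].
Proof.
move=> [a [B [C [B' [C' [BC BC' [BB' CC'] gE g'E]]]]]]; exists a, B', C', B, C; split=> //.
by split; apply: mx_corr_sym.
Qed.

Lemma appr_gl_corr n g g' : (n + n + N <= M)%N -> appr n g g' -> corr g g'.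
Proof.
move=> nM gg'; rewrite -(mulg1 g) -(mulg1 g'); apply: (appr_full_corr nM gg').
exists (fun=> 0), 1%g, 1%g, 1%g, 1%g; split; try by split; apply: (GLO1 H) || apply: (GLO1 H').
- by split; rewrite !glmx1; apply: (mx_corr1 H H' HR).
- rewrite invg1 mulg1 mul1g; apply: glmx_inj; rewrite glmx1 gl_pdiagE.
  by apply/matrixP => i j; rewrite !mxE.
- rewrite invg1 mulg1 mul1g; apply: glmx_inj; rewrite glmx1 gl_pdiagE.
  by apply/matrixP => i j; rewrite !mxE.
Qed.

Lemma appr_lcoset n x y x' y' : (n + n + N <= M)%N -> appr n x x' -> appr n y y' ->
  (K (x^-1 * y)%g <-> K' (x'^-1 * y')%g).
Proof.
move=> nM xx' yy'; apply: (appr_GLcong H H' HR nM).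
by apply: (apprM H H' HR) => //; apply: apprV.
Qed.

(** Approximants of representatives need not be representatives: x is matched with the
    representative of the coset of an approximant of x. That this is a bijection is the comparison
    of x^-1 y with K, which costs 2n + N digits. *)
Lemma sum_appr (V : nmodType) (n : nat) (s : seq G) (s' : seq G') (f : G -> V) (f' : G' -> V) :
  (n + n + N <= M)%N ->
  [/\ uniq s, forall g, g \in s -> bounded v n g,
      forall g, bounded v n g -> exists2 x, x \in s & K (x^-1 * g)%g &
      forall x y, x \in s -> y \in s -> K (x^-1 * y)%g -> x = y] ->
  [/\ uniq s', forall g, g \in s' -> bounded v' n g,
      forall g, bounded v' n g -> exists2 x, x \in s' & K' (x^-1 * g)%g &
      forall x y, x \in s' -> y \in s' -> K' (x^-1 * y)%g -> x = y] ->
  (forall g k, K' k -> f' (g * k)%g = f' g) -> (forall x x', appr n x x' -> f x = f' x') ->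
  \sum_(x <- s) f x = \sum_(x <- s') f' x.
Proof.
move=> nM [us sn cov irr] [us' sn' cov' irr'] f'K ff'.
have K'12 x y z : K' (x^-1 * y)%g -> K' (x^-1 * z)%g -> K' (y^-1 * z)%g.
  move=> h1 h2; have -> : (y^-1 * z = (x^-1 * y)^-1 * (x^-1 * z))%g.
    by rewrite invgM invgK -mulgA mulVKg.
  by apply: (GLcongM H') => //; apply: (GLcongV H').
have K'C x y : K' (x^-1 * y)%g -> K' (y^-1 * x)%g.
  by move=> /(GLcongV H' N0); rewrite invgM invgK.
apply: (sum_match (r := fun x x' => exists2 x1, appr n x x1 & K' (x1^-1 * x')%g)) => //.
- move=> x /sn xn _; have [x1 xx1] := appr_total H H' HR N0 NM xn.
  have [x' x's' h] := cov' x1 (appr_bounded H H' HR xx1).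
  by exists x' => //; exists x1 => //; apply: K'C.
- move=> x' /sn' x'n _; have [x1 x1x'] := appr_total H' H truncated_iso_sym N0 NM x'n.
  have [x xs h] := cov x1 (appr_bounded H' H truncated_iso_sym x1x').
  exists x => //; have [x2 xx2] := appr_total H H' HR N0 NM (sn x xs); exists x2 => //.
  exact/(appr_lcoset nM xx2 x1x').
- move=> x y z _ ys zs [x1 xx1 h1] [x2 xx2 h2]; apply: irr' => //.
  apply: (K'12 _ _ _ h1); apply: (K'12 x2) => //; apply/(appr_lcoset nM xx2 xx1).
  by rewrite mulVg; apply: (GLcong1 H).
- move=> x y z xs ys _ [x1 xx1 h1] [y1 yy1 h2]; apply: irr => //.
  by apply/(appr_lcoset nM xx1 yy1); apply: (K'12 z); apply: K'C.
- by move=> x x' _ _ [x1 /ff'-> h]; rewrite -(f'K x1 _ h) mulgA mulgV mul1g.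
Qed.

End GLTransferSym.

Lemma indic_iff (T T' : Type) (S : pzRingType) (A : set T) (A' : set T') x x' :
  (A x <-> A' x') -> \1_A x = \1_A' x' :> S.
Proof.
move=> AA'; rewrite !indicE; congr (nat_of_bool _)%:R.
by apply/idP/idP => /set_mem h; apply/mem_set; tauto.
Qed.

(** * Convolution of two characteristic functions *)

Section HeckeIndicator.
Variables (R : realType) (F : localFieldType) (D : falgType F) (d r : nat).
Hypotheses (hD : central_division_algebra D d) (SF : cyclic_datum D d).
Variable N : nat.
Hypothesis N0 : (0 < N)%N.
Local Notation v := (@dval F D d).
Local Notation G := (GL D r).
Local Notation K := (@GLcong F D r N).
Let H := dval_normalized hD SF.

Lemma hecke_fun_dcoset g : hecke_fun d N (\1_(dcoset K g) : G -> R[i]).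
Proof.
split=> [k1 k2 x k1K k2K|].
  apply: indic_iff; apply: (dcoset_congr H N0).
  apply: (dcoset_sym H N0); exists k1, k2; split=> //.
have [n gn] := bounded_ex H g; exists n => x.
rewrite indicE; case: (boolP (x \in _)) => [/set_mem gx _|_]; last by rewrite eqxx.
exact: (dcoset_bounded H N0) gn gx.
Qed.

Lemma convolution_indic (mu : {measure set (GLborel D r) -> \bar R}) (hmu : is_haar mu) (n : int) x g y :
  bounded v n x ->
  convolution mu (\1_(dcoset K x) : G -> R[i]) \1_(dcoset K g) y =
  ((vol N mu)%:C)%C * \sum_(z <- reps r hD SF N0 n) \1_(dcoset K x) z * \1_(dcoset K g) (z^-1 * y)%g.
Proof.
move=> xn; apply: (convolution_reps hD SF N0 hmu).
- have h := hecke_fun_dcoset x; exact: (hecke_fun_r hD SF h).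
- move=> z; rewrite indicE; case: (boolP (z \in _)) => [/set_mem xz _|_]; last by rewrite eqxx.
  exact: (dcoset_bounded H N0) xn xz.
- have h := hecke_fun_dcoset g; exact: (hecke_fun_l hD SF h).
Qed.

End HeckeIndicator.

Section IndicatorConvolution.
Variables (R : realType) (F F' : localFieldType) (D : falgType F) (D' : falgType F') (d r : nat).
Hypotheses (hD : central_division_algebra D d) (hD' : central_division_algebra D' d).
Variables (SF : cyclic_datum D d) (SF' : cyclic_datum D' d).
Local Notation v := (@dval F D d).
Local Notation v' := (@dval F' D' d).
Local Notation p := (cd_piD SF).
Local Notation p' := (cd_piD SF').
Local Notation G := (GL D r).
Local Notation G' := (GL D' r).
Let H := dval_normalized hD SF.
Let H' := dval_normalized hD' SF'.
Variables (M N : nat) (R0 : D -> D' -> Prop).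
Hypothesis HR : truncated_iso v v' p p' M R0.
Hypotheses (N0 : (0 < N)%N) (NM : (N + 4 <= M)%N).
Local Notation K := (@GLcong F D r N).
Local Notation K' := (@GLcong F' D' r N).
Local Notation corr := (@gl_corr F F' D D' r v v' p p' H H' N R0).
Local Notation appr := (@appr F F' D D' r p p' R0).
Variables (mu : {measure set (GLborel D r) -> \bar R}) (mu' : {measure set (GLborel D' r) -> \bar R}).
Hypotheses (hmu : is_haar mu) (hmu' : is_haar mu').

Lemma vol_eq : vol N mu = vol N mu'.
Proof.
have h := vol_GLO hD SF N0 hmu 1; have h' := vol_GLO hD' SF' N0 hmu' 1.
have e : \sum_(x <- reps r hD SF N0 1) \1_(@GLO F D r) x =
    \sum_(x <- reps r hD' SF' N0 1) \1_(@GLO F' D' r) x :> R.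
  apply: (sum_appr (n := 1%N) H H' HR N0 NM) => //.
  - by lia.
  - exact: repsP.
  - exact: repsP.
  - by move=> g k kK; apply: indic_iff; apply: (GLO_right_invariant hD' SF' N0).
  - by move=> x x' xx'; apply: indic_iff; apply: (appr_GLO H H' HR _ xx'); lia.
apply: (mulIf (x := \sum_(x <- reps r hD SF N0 1) \1_(@GLO F D r) x)).
  by apply: contra_eq_neq h => ->; rewrite mulr0 eq_sym oner_eq0.
by rewrite h e h'.
Qed.

Lemma convolution_indic_appr x0 x0' g g' x1 x1' :
  appr 1 x0 x0' -> full_corr H H' M R0 g g' -> appr 1 x1 x1' ->
  convolution mu (\1_(dcoset K x0) : G -> R[i]) \1_(dcoset K g) (x1 * g)%g =
  convolution mu' (\1_(dcoset K' x0') : G' -> R[i]) \1_(dcoset K' g') (x1' * g')%g.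
Proof.
move=> xx0 gg' xx1.
have NM1 : (1 + 1 + N <= M)%N by lia.
(* The second condition of the count concerns z^-1 x1 g, where z^-1 x1 is an approximated product of
   denominator p^2; the bound 2n + N <= M is thus used with n = 2. *)
have NM2 : ((1 + 1) + (1 + 1) + N <= M)%N by lia.
have x0b := appr_bounded H' H (truncated_iso_sym H H' HR) xx0.
have x0b' := appr_bounded H H' HR xx0.
rewrite (convolution_indic hD SF N0 hmu _ _ x0b) (convolution_indic hD' SF' N0 hmu' _ _ x0b').
rewrite vol_eq; congr (_ * _); apply: (sum_appr (n := 1%N) H H' HR N0 NM) => //.
- exact: repsP.
- exact: repsP.
- move=> z k kK; rewrite (hecke_fun_r hD' SF' (hecke_fun_dcoset R hD' SF' N0 x0')) //.
  rewrite invgM -[(k^-1 * _ * _)%g]mulgA (hecke_fun_l hD' SF' (hecke_fun_dcoset R hD' SF' N0 g')) //.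
  exact: (GLcongV H').
- move=> x x' xx'; congr (_ * _); apply: indic_iff.
    by apply: (gl_corr_dcoset_iff HR N0 NM); apply: (appr_gl_corr _ _ HR N0 NM NM1).
  rewrite !mulgA; apply: (gl_corr_dcoset_iff HR N0 NM); first exact: (full_corr_gl_corr HR N0 NM).
  apply: (appr_full_corr HR N0 NM NM2) => //.
  by apply: (apprM H H' HR) => //; apply: apprV.
Qed.

(** A point y of K x0 K g K has the form x1 g k2 with x1 in K x0 K. By invariance of the
    convolutions, y may be replaced by x1 g and y' by x1' g' for an approximant x1' of x1. *)
Lemma convolution_indic_corr_aux x0 x0' g g' y y' :
  appr 1 x0 x0' -> full_corr H H' M R0 g g' -> corr y y' ->
  (exists2 x, dcoset K x0 x & dcoset K g (x^-1 * y)%g) ->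
  convolution mu (\1_(dcoset K x0) : G -> R[i]) \1_(dcoset K g) y =
  convolution mu' (\1_(dcoset K' x0') : G' -> R[i]) \1_(dcoset K' g') y'.
Proof.
move=> xx0 gg' yy' [x x0x [k1 [k2 [k1K k2K e]]]].
have NM1 : (1 + 1 + N <= M)%N by lia.
pose x1 := (x * k1)%g.
have x0x1 : dcoset K x0 x1 by apply: (dcoset_trans H N0) x0x _; apply: (dcoset_mulr H).
have yE : y = (x1 * g * k2)%g by rewrite -(mulVKg x y) e /x1 !mulgA.
have x0b := appr_bounded H' H (truncated_iso_sym H H' HR) xx0.
have x1b := dcoset_bounded H N0 x0b x0x1.
have [x1' xx1] := appr_total H H' HR N0 NM x1b.
have h := appr_full_corr HR N0 NM NM1 xx1 gg'.
have yx : dcoset K y (x1 * g)%g by rewrite yE; apply/(dcoset_sym H N0)/(dcoset_mulr H).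
have [k3 [k4 [k3K k4K e']]] := gl_corr_dcoset HR N0 NM yy' h yx.
have [hc _] := hecke_fun_convolution hD SF N0 hmu (hecke_fun_dcoset R hD SF N0 x0) (hecke_fun_dcoset R hD SF N0 g).
have [hc' _] := hecke_fun_convolution hD' SF' N0 hmu' (hecke_fun_dcoset R hD' SF' N0 x0') (hecke_fun_dcoset R hD' SF' N0 g').
transitivity (convolution mu (\1_(dcoset K x0) : G -> R[i]) \1_(dcoset K g) (x1 * g)%g).
  by rewrite yE -[X in convolution _ _ _ (X * k2)%g]mul1g hc //; apply: (GLcong1 H).
by rewrite (convolution_indic_appr xx0 gg' xx1) e' hc'.
Qed.

End IndicatorConvolution.

Section IndicatorConvolutionSym.
Variables (R : realType) (F F' : localFieldType) (D : falgType F) (D' : falgType F') (d r : nat).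
Hypotheses (hD : central_division_algebra D d) (hD' : central_division_algebra D' d).
Variables (SF : cyclic_datum D d) (SF' : cyclic_datum D' d).
Local Notation v := (@dval F D d).
Local Notation v' := (@dval F' D' d).
Local Notation p := (cd_piD SF).
Local Notation p' := (cd_piD SF').
Local Notation G := (GL D r).
Local Notation G' := (GL D' r).
Let H := dval_normalized hD SF.
Let H' := dval_normalized hD' SF'.
Variables (M N : nat) (R0 : D -> D' -> Prop).
Hypothesis HR : truncated_iso v v' p p' M R0.
Hypotheses (N0 : (0 < N)%N) (NM : (N + 4 <= M)%N).
Local Notation K := (@GLcong F D r N).
Local Notation K' := (@GLcong F' D' r N).
Local Notation corr := (@gl_corr F F' D D' r v v' p p' H H' N R0).
Local Notation appr := (@appr F F' D D' r p p' R0).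
Variables (mu : {measure set (GLborel D r) -> \bar R}) (mu' : {measure set (GLborel D' r) -> \bar R}).
Hypotheses (hmu : is_haar mu) (hmu' : is_haar mu').

(** If y or y' lies in the respective product of double cosets, the preceding case applies, after
    exchanging the two fields if necessary; otherwise all terms of both sums vanish. *)
Lemma convolution_indic_corr x0 x0' g g' y y' :
  appr 1 x0 x0' -> full_corr H H' M R0 g g' -> corr y y' ->
  convolution mu (\1_(dcoset K x0) : G -> R[i]) \1_(dcoset K g) y =
  convolution mu' (\1_(dcoset K' x0') : G' -> R[i]) \1_(dcoset K' g') y'.
Proof.
move=> xx0 gg' yy'; have HR' := truncated_iso_sym H H' HR.
have [h|no] := pselect (exists2 x, dcoset K x0 x & dcoset K g (x^-1 * y)%g).
  exact: (convolution_indic_corr_aux HR N0 NM hmu hmu' xx0 gg' yy' h).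
have [h|no'] := pselect (exists2 x, dcoset K' x0' x & dcoset K' g' (x^-1 * y')%g).
  apply/esym; apply: (convolution_indic_corr_aux HR' N0 NM hmu' hmu xx0 _ _ h).
    exact: (full_corr_sym HR).
  exact: (gl_corr_sym HR N0 NM yy').
have x0b := appr_bounded H' H HR' xx0.
have x0b' := appr_bounded H H' HR xx0.
rewrite (convolution_indic hD SF N0 hmu _ _ x0b) (convolution_indic hD' SF' N0 hmu' _ _ x0b').
rewrite !big1 ?mulr0 // => z _; rewrite !indicE.
  case: (boolP (z \in _)) => [/set_mem h|_]; last by rewrite mul0r.
  case: (boolP (_ \in _)) => [/set_mem h'|_]; last by rewrite mulr0.
  by case: no'; exists z.
case: (boolP (z \in _)) => [/set_mem h|_]; last by rewrite mul0r.
case: (boolP (_ \in _)) => [/set_mem h'|_]; last by rewrite mulr0.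
by case: no; exists z.
Qed.

End IndicatorConvolutionSym.

(** * Generation of the Hecke algebra *)

Section HeckeGeneration.
Variables (R : realType) (F : localFieldType) (D : falgType F) (d r : nat).
Hypotheses (hD : central_division_algebra D d) (SF : cyclic_datum D d).
Variable N : nat.
Hypothesis N0 : (0 < N)%N.
Variable mu : {measure set (GLborel D r) -> \bar R}.
Hypothesis hmu : is_haar mu.
Local Notation v := (@dval F D d).
Local Notation G := (GL D r).
Local Notation K := (@GLcong F D r N).
Let H := dval_normalized hD SF.
Local Notation pd a := (gl_pdiag (r := r) H a).
Local Notation ind g := (\1_(dcoset K g) : G -> R[i]).
Implicit Types g h x y : G.

Lemma hecke_fun_linear c (f f' : G -> R[i]) : hecke_fun d N f -> hecke_fun d N f' ->
  hecke_fun d N (fun x => c * f x + f' x).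
Proof.
move=> hf hf'; have [n fn] := hecke_fun_bounded hD SF hf; have [n' fn'] := hecke_fun_bounded hD SF hf'.
move: hf hf' => [fK _] [fK' _]; split=> [k1 k2 g k1K k2K|]; first by rewrite fK // fK'.
exists (n + n')%N => g; case: (eqVneq (f g) 0) => [->|f0 _]; last by apply: fn => //; apply: leq_addr.
by rewrite mulr0 add0r; apply: fn'; apply: leq_addl.
Qed.

(** Induction on a list of representatives meeting the support: subtracting f(y) times the
    characteristic function of K y K removes y from the list. *)
Lemma hecke_span (P : (G -> R[i]) -> Prop) :
  (forall c f f', hecke_fun d N f -> hecke_fun d N f' -> P f -> P f' -> P (fun x => c * f x + f' x)) ->
  (forall g, P (ind g)) -> forall f, hecke_fun d N f -> P f.
Proof.
move=> Plin Pind f hf; have hI g : hecke_fun d N (ind g) by apply: (hecke_fun_dcoset R hD SF N0).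
(* The empty combination is obtained as - f + f for a characteristic function f. *)
have P0 : P (fun=> 0).
  have := Plin (-1) _ _ (hI 1%g) (hI 1%g) (Pind _) (Pind _).
  by congr P; apply/funext => x; rewrite mulN1r addNr.
have [_ [n fn]] := hf; have [_ _ cov _] := repsP r hD SF N0 n.
have {cov fn} : forall x, f x != 0 -> exists2 y, y \in reps r hD SF N0 n & K (y^-1 * x)%g.
  by move=> x /fn/cov.
elim: (reps _ _ _ _ _) f hf => [|y s IHs] f hf fs.
  have -> // : f = fun=> 0.
  by apply/funext => x; apply: contrapT => /eqP/fs[].
pose f' := fun x => - f y * ind y x + f x.
have hf' : hecke_fun d N f' by apply: hecke_fun_linear.
have -> : f = fun x => f y * ind y x + f' x by apply/funext => x; rewrite /f' mulNr addrA addrN add0r.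
apply: Plin => //; apply: IHs => // x; rewrite /f' indicE.
case: (boolP (x \in _)) => [/set_mem[k1 [k2 [k1K k2K ->]]]|xy].
  by case: hf => fK _; rewrite fK // mulr1 addNr eqxx.
rewrite mulr0 add0r => /fs[z]; rewrite inE => /orP[/eqP->|zs] zx; last by exists z.
case/negP: xy; apply/mem_set; exists 1%g, (y^-1 * x)%g.
by split=> //; [apply: (GLcong1 H) | rewrite mul1g mulVKg].
Qed.

(** By hypothesis K g K h K is a single double coset, so that the convolution is a multiple of its
    characteristic function. The factor is nonzero because the sum at gh has nonnegative terms, with
    a positive one at the representative of gK. *)
Lemma convolution_indic_product g h :
  (forall k, K k -> dcoset K (g * h)%g (g * k * h)%g) ->
  exists2 c : R[i], c != 0 & convolution mu (ind g) (ind h) = fun y => c * ind (g * h)%g y.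
Proof.
move=> gKh; pose f := convolution mu (ind g) (ind h).
have [fK _] : hecke_fun d N f.
  by apply: (hecke_fun_convolution hD SF N0 hmu); apply: (hecke_fun_dcoset R hD SF N0).
have [n gn] := bounded_ex H g; have fE y := convolution_indic hD SF N0 hmu h y gn.
exists (f (g * h)%g).
  rewrite /f fE mulf_eq0 negb_or; apply/andP; split.
    apply/eqP => -[v0]; have := vol_GLO hD SF N0 hmu 0.
    by rewrite v0 mul0r => /eqP; rewrite eq_sym oner_eq0.
  have [_ _ cov _] := repsP r hD SF N0 n; have [x xs gx] := cov g gn.
  rewrite psumr_eq0 => [|y _]; last by rewrite !indicE mulr_ge0 ?ler0n.
  apply/negP => /allP/(_ x xs).
  rewrite !indicE !mem_set ?mulr1 ?oner_eq0 //.
    rewrite mulgA; exists (x^-1 * g)%g, 1%g; split; rewrite ?mulg1 //; exact: (GLcong1 H).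
  apply: (dcoset_sym H N0); exists 1%g, (x^-1 * g)%g.
  by split=> //; [apply: (GLcong1 H) | rewrite mul1g mulVKg].
apply/funext => y; rewrite indicE; case: (boolP (y \in _)) => [/set_mem[k1 [k2 [k1K k2K ->]]]|ygh].
  by rewrite mulr1 -/f fK.
rewrite mulr0 fE big1 ?mulr0 // => z _; rewrite !indicE.
case: (boolP (z \in _)) => [/set_mem[k1 [k2 [k1K k2K ->]]]|_]; last by rewrite mul0r.
case: (boolP (_ \in _)) => [/set_mem[k3 [k4 [k3K k4K e]]]|_]; last by rewrite mulr0.
case/negP: ygh; apply/mem_set.
have [k5 [k6 [k5K k6K e']]] := gKh (k2 * k3)%g (GLcongM H N0 k2K k3K).
exists (k1 * k5)%g, (k6 * k4)%g; split; try exact: (GLcongM H).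
rewrite -[y in LHS](mulVKg (k1 * g * k2)%g) e.
by move: (congr1 (fun t => k1 * t * k4)%g e'); rewrite !mulgA.
Qed.

(* The pi^eps with eps_i = c + [k0 <= i] and -1 <= eps_i <= 1 suffice besides
   GL_r(O): for dominant a, K pi^eps K pi^a K is the single double coset
   K pi^(eps + a) K. *)
Lemma hecke_generation (P : (G -> R[i]) -> Prop) :
  (forall c f f', hecke_fun d N f -> hecke_fun d N f' -> P f -> P f' -> P (fun x => c * f x + f' x)) ->
  (forall f f', hecke_fun d N f -> hecke_fun d N f' -> P f -> P f' -> P (convolution mu f f')) ->
  (forall g, bounded v 1 g -> P (ind g)) -> forall f, hecke_fun d N f -> P f.
Proof.
move=> Plin Pconv P1; have hI g : hecke_fun d N (ind g) by apply: (hecke_fun_dcoset R hD SF N0).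
have PM g h : (forall k, K k -> dcoset K (g * h)%g (g * k * h)%g) -> P (ind g) -> P (ind h) -> P (ind (g * h)%g).
  move=> /convolution_indic_product[c c0 e] Pg Ph.
  have hgh := hecke_fun_convolution hD SF N0 hmu (hI g) (hI h).
  have Pgh := Pconv _ _ (hI g) (hI h) Pg Ph.
  (* Closure under [c * f + f'] yields the multiple c^-1 f as (c^-1 - 1) f + f. *)
  have := Plin (c^-1 - 1) _ _ hgh hgh Pgh Pgh; congr P; apply/funext => y.
  by rewrite e -[X in _ + X]mul1r -mulrDl subrK mulrA mulVf // mul1r.
have PO g : GLO g -> P (ind g).
  by move=> /(GLO_bounded H) g0; apply: P1; apply: (bounded_le H) g0.
(* The condition on c and k0 keeps all eps_i in [-1, 1], so that pi^eps has n(pi^eps) <= 1. *)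
have Peps (k0 : nat) (c : int) (a : 'I_r -> int) : (-1 <= c <= 0) || (c == 1) && (k0 == r) ->
    (forall i j : 'I_r, (i <= j)%N -> a i <= a j) -> P (ind (pd a)) ->
    P (ind (pd (fun i => c + (k0 <= i)%N%:Z + a i))).
  move=> c1 amono Pa; have epsM := @gl_pdiagM F D r v (cd_piD SF) H (fun i => c + (k0 <= i)%N%:Z) a.
  rewrite -epsM; apply: PM => //.
    move=> k kK; have [//|k1 [k2 [k1K k2K ->]]] :=
      @pdiag_product_dcoset F D r v (cd_piD SF) H N k0 c (fun i => c + (k0 <= i)%N%:Z) a k N0 _ amono kK.
    by rewrite -epsM; exists k1, k2.
  apply: P1; apply/(gl_pdiag_bounded H) => i; move: c1 (ltn_ord i); case: (leqP k0 i) => /=; lia.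
(* Induction on the sum of the exponents: 1 is subtracted from all positive exponents, which occupy
   the positions i >= k0 because a is increasing. *)
have Ppos (n : nat) (a : 'I_r -> int) : (forall i j : 'I_r, (i <= j)%N -> a i <= a j) ->
    (forall i, 0 <= a i) -> (\sum_i `|a i| <= n)%N -> P (ind (pd a)).
  elim: n a => [|n IHn] a amono a0 an.
    apply: PO; apply/(GLO_bounded H)/(gl_pdiag_bounded H) => i.
    by move: an; rewrite (bigD1 i) //= leqn0 addn_eq0 absz_eq0 => /andP[/eqP-> _].
  have [ex|no] := pselect (exists k, [exists i : 'I_r, (i == k :> nat) && (0 < a i)]); last first.
    apply: PO; apply/(GLO_bounded H)/(gl_pdiag_bounded H) => i; have := a0 i.
    have : ~ (0 < a i) by move=> h; apply: no; exists (i : nat); apply/existsP; exists i; rewrite eqxx.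
    by lia.
  case: (ex_minnP ex) => k0 /existsP[i0 /andP[/eqP i0k ai0]] k0min.
  have az (i : 'I_r) : (i < k0)%N -> a i = 0.
    move=> ik; have := a0 i; rewrite le_eqVlt => /orP[/eqP//|ai].
    have : (k0 <= i)%N by apply: k0min; apply/existsP; exists i; rewrite eqxx.
    by rewrite leqNgt ik.
  have ap (i : 'I_r) : (k0 <= i)%N -> 0 < a i.
    by move=> ki; apply: lt_le_trans ai0 (amono _ _ _); rewrite i0k.
  pose b (i : 'I_r) := a i - (k0 <= i)%N%:Z.
  have bE (i : 'I_r) : b i = if (k0 <= i)%N then a i - 1 else 0.
    by rewrite /b; case: (leqP k0 i) => // /az->.
  have -> : a = fun i => 0 + (k0 <= i)%N%:Z + b i by apply/funext => i; rewrite /b add0r addrC subrK.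
  apply: Peps => //; first by move=> i j ij; rewrite !bE; have := amono i j ij; case: (leqP k0 j) => [/ap|] h1; case: (leqP k0 i) => h2 /=; lia.
  apply: IHn.
  - by move=> i j ij; rewrite !bE; have := amono i j ij; case: (leqP k0 j) => [/ap|] h1; case: (leqP k0 i) => h2 /=; lia.
  - by move=> i; rewrite bE; case: leqP => // /ap; lia.
  - rewrite -ltnS; apply: leq_trans an; rewrite (bigD1 i0) //= [X in (_ < X)%N](bigD1 i0) //=.
    have h1 : (`|b i0| < `|a i0|)%N by rewrite bE i0k leqnn; lia.
    have h2 : (\sum_(i < r | i != i0) `|b i| <= \sum_(i < r | i != i0) `|a i|)%N.
      by apply: leq_sum => i _; rewrite bE; case: (leqP k0 i) => // /ap; lia.
    by rewrite -addSn; apply: leq_add.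
have Pmono (n : nat) (a : 'I_r -> int) : (forall i j : 'I_r, (i <= j)%N -> a i <= a j) ->
    (forall i, - n%:Z <= a i) -> P (ind (pd a)).
  elim: n a => [|n IHn] a amono an; first by apply: (Ppos (\sum_i `|a i|)%N).
  (* With k0 = r the weight eps is the constant -1: the scalar matrix pi^-1 is split off and all
     exponents move up by 1. *)
  have -> : a = fun i : 'I_r => -1 + (r <= i)%N%:Z + (1 + a i).
    by apply/funext => i; rewrite leqNgt ltn_ord addr0 addKr.
  apply: Peps => //; first by move=> i j ij; have := amono i j ij; lia.
  by apply: IHn => [i j ij|i]; [have := amono i j ij; lia | have := an i; lia].
apply: hecke_span => // g; have [a [B [C [amono BO CO ->]]]] := cartan H g.
have [n] := bounded_ex H (pd a); move=> /(gl_pdiag_bounded H) an.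
apply: (PM).
- move=> k kK; exists 1%g, (C * k * C^-1)%g; split; rewrite ?mul1g.
  + exact: (GLcong1 H).
  + exact: (GLcong_conj H).
  + by rewrite !mulgA mulgVK.
- apply: (PM); [move=> k kK | exact: PO |].
    exists (B * k * B^-1)%g, 1%g; split; rewrite ?mulg1.
    + exact: (GLcong_conj H).
    + exact: (GLcong1 H).
    + by rewrite !mulgA mulgVK.
  by apply: (Pmono n) => // i; case/andP: (an i).
- exact/PO/(GLOV H).
Qed.

End HeckeGeneration.

(** * The map zeta and its multiplicativity *)

Section Zeta.
Variables (R : realType) (F F' : localFieldType) (D : falgType F) (D' : falgType F') (r : nat).
Variables (v : D -> int) (v' : D' -> int) (p : D) (p' : D').
Hypotheses (H : is_normalized_valuation v p) (H' : is_normalized_valuation v' p').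
Variables (M N : nat) (R0 : D -> D' -> Prop).
Hypothesis HR : truncated_iso v v' p p' M R0.
Hypotheses (N0 : (0 < N)%N) (NM : (N + 4 <= M)%N).
Local Notation G := (GL D r).
Local Notation G' := (GL D' r).
Local Notation K := (@GLcong F D r N).
Local Notation K' := (@GLcong F' D' r N).
Local Notation corr := (@gl_corr F F' D D' r v v' p p' H H' N R0).

Lemma gl_corr_total_r (y : G') : exists g : G, corr g y.
Proof.
have HR' := truncated_iso_sym H H' HR.
have [g yg] := gl_corr_total H' H HR' N0 NM y; exists g.
exact: (gl_corr_sym HR' N0 NM yg).
Qed.

(** Transport of f along the bijection of double cosets; by [zetaE] the chosen preimage of y is
    immaterial when f is bi-invariant under K. *)
Definition zeta (f : G -> R[i]) (y : G') : R[i] := f (sval (cid (gl_corr_total_r y))).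

Lemma zetaE f g y : (forall k1 k2 x, K k1 -> K k2 -> f (k1 * x * k2)%g = f x) -> corr g y -> zeta f y = f g.
Proof.
rewrite /zeta; case: cid => g1 /= g1y fK gy.
have [k1 [k2 [k1K k2K ->]]] : dcoset K g g1.
  by apply/(gl_corr_dcoset_iff HR N0 NM gy g1y); apply: (dcoset_refl H').
exact: fK.
Qed.

Lemma zeta_indic g g' : corr g g' -> zeta \1_(dcoset K g) = \1_(dcoset K' g').
Proof.
move=> gg'; apply/funext => y; rewrite /zeta; case: cid => x /= xy.
by apply: indic_iff; apply: (gl_corr_dcoset_iff HR N0 NM).
Qed.

End Zeta.

Section ZetaHecke.
Variables (R : realType) (F F' : localFieldType) (D : falgType F) (D' : falgType F') (d r : nat).
Hypotheses (hD : central_division_algebra D d) (hD' : central_division_algebra D' d).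
Variables (SF : cyclic_datum D d) (SF' : cyclic_datum D' d).
Local Notation G := (GL D r).
Local Notation G' := (GL D' r).
Let H := dval_normalized hD SF.
Let H' := dval_normalized hD' SF'.
Variables (M N : nat) (R0 : D -> D' -> Prop).
Hypothesis HR : truncated_iso (@dval F D d) (@dval F' D' d) (cd_piD SF) (cd_piD SF') M R0.
Hypotheses (N0 : (0 < N)%N) (NM : (N + 4 <= M)%N).
Local Notation K := (@GLcong F D r N).
Local Notation K' := (@GLcong F' D' r N).
Local Notation corr := (@gl_corr _ _ _ _ r _ _ _ _ H H' N R0).
Let HR' := truncated_iso_sym H H' HR.
Local Notation tr := (@zeta R _ _ _ _ r _ _ _ _ H H' M N R0 HR N0 NM).
Local Notation tr' := (@zeta R _ _ _ _ r _ _ _ _ H' H M N _ HR' N0 NM).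

Lemma zeta_hecke_fun f : hecke_fun d N f -> hecke_fun d N (tr f).
Proof.
move=> [fK [n fn]]; split=> [k1 k2 y k1K k2K|].
  have [g gy] := gl_corr_total_r H H' HR N0 NM y; rewrite !(zetaE HR N0 NM fK (g := g)) //.
  apply: (gl_corr_congr N0 gy); first exact: (dcoset_refl H).
  by exists k1, k2.
exists n => y; have [g gy] := gl_corr_total_r H H' HR N0 NM y; rewrite (zetaE HR N0 NM fK gy) => /fn.
exact: (gl_corr_bounded N0 gy).
Qed.

Lemma zetaK f : hecke_fun d N f -> tr' (tr f) = f.
Proof.
move=> hf; apply/funext => g; have [y gy] := gl_corr_total H H' HR N0 NM g.
have [fK' _] := zeta_hecke_fun hf; have [fK _] := hf.
rewrite (zetaE HR' N0 NM fK' (gl_corr_sym HR N0 NM gy)).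
exact: (zetaE HR N0 NM fK gy).
Qed.

Variables (mu : {measure set (GLborel D r) -> \bar R}) (mu' : {measure set (GLborel D' r) -> \bar R}).
Hypotheses (hmu : is_haar mu) (hmu' : is_haar mu').

Lemma zeta_convolution f h : hecke_fun d N f -> hecke_fun d N h ->
  tr (convolution mu f h) = convolution mu' (tr f) (tr h).
Proof.
move=> hf; move: f hf h.
have cF := hecke_fun_convolution hD SF N0 hmu.
have zF := zeta_hecke_fun.
(* Quantifying over the right factor makes P stable under convolution, since (f f') h = f (f' h). *)
pose P f := forall h, hecke_fun d N h -> tr (convolution mu f h) = convolution mu' (tr f) (tr h).
suff : forall f, hecke_fun d N f -> P f by [].
apply: (hecke_generation hD SF N0 hmu).
- move=> c f f' hf hf' Pf Pf' h hh; rewrite (convolutionDl hD SF N0 hmu) //.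
  transitivity (fun y => c * tr (convolution mu f h) y + tr (convolution mu f' h) y) => //.
  rewrite Pf // Pf' // -(convolutionDl hD' SF' N0 hmu' c (zF _ hf) (zF _ hf') (zF _ hh)).
  by [].
- move=> f f' hf hf' Pf Pf' h hh; rewrite (convolutionA hD SF N0 hmu) // Pf; last exact: cF.
  rewrite Pf' // Pf // (convolutionA hD' SF' N0 hmu') //; exact: zF.
move=> x xb h hh; have [x' xx'] := appr_total H H' HR N0 NM xb.
have NM1 : (1 + 1 + N <= M)%N by lia.
have hx := hecke_fun_dcoset R hD SF N0 x.
rewrite (zeta_indic R HR N0 NM (appr_gl_corr H H' HR N0 NM NM1 xx')).
have hx' := hecke_fun_dcoset R hD' SF' N0 x'.
move: h hh; apply: (hecke_span hD SF N0).
- move=> c f f' hf hf' Pf Pf'; rewrite (convolutionDr hD SF N0 hmu) //.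
  transitivity (fun y => c * tr (convolution mu \1_(dcoset K x) f) y + tr (convolution mu \1_(dcoset K x) f') y) => //.
  rewrite Pf Pf' -(convolutionDr hD' SF' N0 hmu' c hx' (zF _ hf) (zF _ hf')).
  by [].
move=> g; have [g' gg'] := full_corr_total H H' HR N0 NM g.
rewrite (zeta_indic R HR N0 NM (full_corr_gl_corr HR N0 NM gg')).
apply/funext => y'; have [y yy'] := gl_corr_total_r H H' HR N0 NM y'.
have [cK _] := cF _ _ hx (hecke_fun_dcoset R hD SF N0 g).
rewrite (zetaE HR N0 NM cK yy').
exact: (convolution_indic_corr HR N0 NM hmu hmu' xx' gg' yy').
Qed.

End ZetaHecke.

Lemma GLlift_mx_corr (F L : localFieldType) (DF : falgType F) (DL : falgType L) (d r n M : nat)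
    (hL : central_division_algebra DL d) (SF : cyclic_datum DF d) (SL : cyclic_datum DL d)
    (lam : DF -> DL) (B : GL DF r) (BL : GL DL r) :
  GLlift SF SL lam n B BL ->
  mx_corr (@dval L DL d) (class_corr SF SL lam M) n (glmx B) (glmx BL).
Proof.
move=> [_ BBL] i j; have [e [eO xE yE]] := BBL i j.
exists (\sum_(k < d) cd_piD SL ^+ k * lam (e k)); last exact/(PD_val_ge hL SL).
by exists e; split=> //; rewrite subrr; apply/(PD_val_ge hL SL)/val_ge0.
Qed.

Theorem mainTheorem4 (R : realType) (F : localFieldType) (p : nat)
    (hF : p \in [pchar F]) (d r l : nat) (hr : (0 < r)%N) (hl : (0 < l)%N)
    (DF : falgType F) (hDF : central_division_algebra DF d)
    (SF : cyclic_datum DF d)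
    (muF : {measure set (GLborel DF r) -> \bar R}) (hmuF : is_haar muF) :
  exists m : nat, (l <= m)%N /\
    forall (L : localFieldType) (DL : falgType L) (SL : cyclic_datum DL d)
      (lamFL : F -> L) (lamEK : DF -> DL)
      (muL : {measure set (GLborel DL r) -> \bar R}),
      [pchar L] =i pred0 ->
      central_division_algebra DL d ->
      close_datum SF SL m lamFL lamEK ->
      is_haar muL ->
      exists zeta : (GL DF r -> R[i]) -> (GL DL r -> R[i]),
        is_zeta SF SL lamEK l zeta /\
        convolution_morphism muF muL (hecke R (GLcong (l * d))) zeta.
Proof.
have d0 := cda_deg_gt0 hDF.
exists (l + 4)%N; split=> [|L DL SL lamFL lamEK muL _ hDL hc hmuL]; first exact: leq_addr.
have m0 : (0 < l + 4)%N by lia.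
have HR := class_corr_truncated_iso hDF hDL m0 hc.
have N0 : (0 < l * d)%N by rewrite muln_gt0 hl.
(* One power of P_F counts for d powers of P_D, and d >= 1: the margin of four digits over N = l d
   is available whatever d is. *)
have NM : (l * d + 4 <= (l + 4) * d)%N by nia.
pose H := dval_normalized hDF SF; pose H' := dval_normalized hDL SL.
have heckeF f := heckeP hDF SF N0 f; have heckeL f := heckeP hDL SL N0 f.
pose HR' := truncated_iso_sym H H' HR.
exists (@zeta R _ _ _ _ r _ _ _ _ H H' _ _ _ HR N0 NM); split; last first.
  by move=> f g /heckeF hf /heckeF hg; apply: zeta_convolution.
split=> //.
- split.
  + by move=> f /heckeF hf; apply/heckeL; apply: zeta_hecke_fun.
  + move=> f g /set_mem/heckeF hf /set_mem/heckeF hg e.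
    by rewrite -(zetaK hDF hDL HR N0 NM hf) e (zetaK hDF hDL HR N0 NM hg).
  + move=> f' /heckeL hf'; exists (@zeta R _ _ _ _ r _ _ _ _ H' H _ _ _ HR' N0 NM f').
      by apply/heckeF; apply: zeta_hecke_fun.
    have := zetaK hDL hDF HR' N0 NM hf'.
    (* Exchanging the fields twice produces another proof of the statement of [HR]; as [zeta] takes
       this proof as an argument, the two are identified. *)
    by rewrite (_ : truncated_iso_sym H' H HR' = HR) //; apply: Prop_irrelevance.
- move=> a A B C AL BL CL _ AE ALE BO CO [BLO BL'] [CLO CL'].
  have -> : A = gl_pdiag H a by apply: glmx_inj; rewrite AE.
  have -> : AL = gl_pdiag H' a by apply: glmx_inj; rewrite ALE.
  apply: zeta_indic; apply: gl_corr_lift => //; by apply: (GLlift_mx_corr _ hDL); split.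
Qed.
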